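(* For $X\sim N(\theta^*,\sigma^2I_n)$ and every $k\in[n]$, $$\inf_{\widehat{\theta}}\sup_{\theta^*\in\Theta_{k}^{\wedge}}\mathbb{E}\|\widehat{\theta}-\theta^*\|^2\asymp\begin{cases} \sigma^2, & k=1, \\ \sigma^2\log\log(16n), & k=2, \\ \sigma^2\log(en), & 3\leq k\leq \frac{\log(en)}{\log\log(16n)}, \\ \sigma^2k\log\log(16n/k), & k>\frac{\log(en)}{\log\log(16n)}, \end{cases}$$ where $\asymp$ means two-sided bounds up to universal positive constant factors and the infimum is over all measurable functions of $X$.
   Context: $[n]=\{1,\dots,n\}$. For reals $a\le b$, $(a:b]$ is the set of integers $i$ with $a<i\le b$. For $k\in[n]$, $\Theta_k^{\wedge}$ is the set of $\theta\in\mathbb{R}^n$ for which there exist integers $0=a_0\le a_1\le\cdots\le a_k=n$, an index $\ell\in[k]$ and reals $\mu_1,\dots,\mu_k$ with $\mu_1\le\cdots\le\mu_{\ell-1}\le\mu_\ell\ge\mu_{\ell+1}\ge\cdots\ge\mu_k$ and $\theta_i=\mu_j$ for all $i\in(a_{j-1}:a_j]$ (unimodal vectors with at most $k$ constant pieces). *)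

(* Defs.v *)
From HB Require Import structures.
From mathcomp Require Import all_boot all_order all_algebra.
From mathcomp Require Import all_classical all_reals all_analysis.
Set Implicit Arguments. Unset Strict Implicit. Unset Printing Implicit Defensive.
Import Order.TTheory GRing.Theory Num.Theory.
Local Open Scope classical_set_scope.
Local Open Scope ring_scope.

Section Defs.
Context {R : realType}.

(* Theta_k^wedge : unimodal vectors of R^n (vectors are n.-tuples, index
   i : 'I_n is the paper's coordinate i+1) with at most k constant pieces. *)
Definition unimodal_k (n k : nat) (theta : n.-tuple R) : Prop :=
  exists (a : nat -> nat) (l : nat) (mu : nat -> R),
    [/\ a 0%N = 0%N /\ a k = n, (forall j, (j < k)%N -> (a j <= a j.+1)%N),
        (1 <= l <= k)%N,
        (forall j, (1 <= j)%N -> (j.+1 <= l)%N -> mu j <= mu j.+1) /\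
        (forall j, (l <= j)%N -> (j.+1 <= k)%N -> mu j.+1 <= mu j) &
        (forall (j : nat) (i : 'I_n), (1 <= j <= k)%N ->
            (a j.-1 < i.+1 <= a j)%N -> tnth theta i = mu j)].

Definition Theta_wedge (n k : nat) : set (n.-tuple R) := [set t | unimodal_k k t].

(* Iterated integral of f against independent N(m_i, s^2) coordinates,
   i.e. the expectation of f(X) for X ~ N(ms, s^2 I) (Tonelli). *)
Fixpoint gauss_iter (s : R) (ms : seq R) (f : seq R -> \bar R) : \bar R :=
  match ms with
  | [::] => f [::]
  | m :: ms' =>
      (\int[normal_prob m s]_x gauss_iter s ms' (fun xs => f (x :: xs)))%E
  end.

Definition to_tuple (n : nat) (xs : seq R) : n.-tuple R :=
  insubd (nseq_tuple n 0) xs.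

(* E_{X ~ N(theta, s^2 I_n)} g(X) for nonnegative g. *)
Definition gauss_expect (n : nat) (s : R) (theta : n.-tuple R)
    (g : n.-tuple R -> \bar R) : \bar R :=
  gauss_iter s theta (fun xs => g (to_tuple n xs)).

Definition sqdist (n : nat) (u v : n.-tuple R) : R :=
  \sum_(i < n) (tnth u i - tnth v i) ^+ 2.

Definition risk (n : nat) (s : R) (that : n.-tuple R -> n.-tuple R)
    (theta : n.-tuple R) : \bar R :=
  gauss_expect s theta (fun x => (sqdist (that x) theta)%:E).

Definition minimax_risk (n : nat) (s : R) (Theta : set (n.-tuple R)) : \bar R :=
  ereal_inf [set r | exists that : n.-tuple R -> n.-tuple R,
      measurable_fun setT that /\
      r = ereal_sup [set risk s that theta | theta in Theta]].

Definition wedge_rate (n k : nat) : R :=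
  if k == 1%N then (1 : R)
  else if k == 2%N then ln (ln (16 * n%:R : R))
  else if k%:R <= ln (expR 1 * n%:R) / ln (ln (16 * n%:R : R)) then ln (expR 1 * n%:R)
  else k%:R * ln (ln (16 * n%:R / k%:R)).

End Defs.

(* Main.v *)
(** Lower bounds. For M hypotheses with pairwise squared distance at least r^2,
    at most one is within r/2 of a given estimate, so the Bayes risk exceeds
    r^2/4 (1 - E max_i L_i / M) with L_i the likelihood ratios against a common
    reference; a second moment bound on the L_i shows this is of order r^2 when
    the hypotheses are within sqrt(ln M) of the reference. Spikes (M = n + 1)
    give ln(en). For k lnln(16n/k), a staircase of k/2 blocks carries in each
    block a suffix bump of length 4^i and of fixed norm, with about ln(n/k)
    values of i, under a product prior.

    Upper bounds. The estimator is a least squares estimator up to an additive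
    error sigma^2, chosen among the rational points of the parameter set so that
    it is measurable. Writing v for its normalized error and e for the noise,
    |v|^2 <= 2<v,e> + 1. Cut [n] where the true vector jumps, at multiples of
    n/k, and at the mode of the estimate: on each block v is monotone. Its
    positive and negative parts, monotone towards an end of the block, are
    compared on cells of length 4^l from that end with the maximal partial sums
    of e in the cell. Only cells containing a jump of v pay the threshold
    t^2 = 8 ln f, f the number of cells per block; the excess over t is
    exponentially small by a maximal inequality for the martingale
    exp(S_d^2/(2(c+d)))/sqrt(c+d), and cells are independent. The n + 1
    possible modes cost the additional ln(en); no such cut is needed for k = 2,
    where both vectors are monotone. *)

Require Import Defs.
From HB Require Import structures.
From mathcomp Require Import all_boot all_order all_algebra.
From mathcomp Require Import all_classical all_reals all_analysis.
From mathcomp Require Import measurable_realfun ring lra zify.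
Import Order.TTheory GRing.Theory Num.Theory.
Local Open Scope classical_set_scope.
Local Open Scope ring_scope.
Set Implicit Arguments. Unset Strict Implicit. Unset Printing Implicit Defensive.

(** * Gaussian integrals *)

(** The error v depends on the noise e, so [dot v e] is bounded pointwise by functionals of e alone,
    and only these are integrated. They are logarithms of products with one factor per cell. A
    factor dominates exp((S^2/c - t^2)/8) for every prefix sum S of a cell of at most c terms and
    has mean at most 1 + 3 exp(-t^2/8). Independence multiplies these means, and a tangent line of
    ln converts the mean of the product into a bound on the mean of its logarithm; the same step
    replaces the maximum over the modes by a sum.

    With t^2 = 8 ln f the f factors of a block have a product of bounded mean, while each jump and
    each block pay t^2, of order lnln(16n/k): this is the origin of the iterated logarithm.

    The factors use the square root of the exponential martingale because the maximum of a
    nonnegative martingale need not be integrable, whereas the maximum of its square root is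
    controlled by the mean of the martingale. *)

Section normal_1d.
Context {R : realType}.
Local Notation mu := (@lebesgue_measure R).
Implicit Types (f : R -> \bar R) (m s d : R).

Lemma ge0_integral_normal_prob m s f :
  measurable_fun setT f -> (forall x, (0 <= f x)%E) ->
  (\int[normal_prob m s]_x f x = \int[mu]_x (f x * (normal_pdf m s x)%:E))%E.
Proof.
move=> mf f0.
have dom := @normal_prob_dominates R m s.
rewrite -(Radon_Nikodym_SigmaFinite.change_of_variables dom)//=.
have mpdf : measurable_fun setT (fun x => (normal_pdf m s x)%:E).
  by apply/measurable_EFinP; exact: measurable_normal_pdf.
have irn := Radon_Nikodym_SigmaFinite.f_integrable dom.
apply: ae_eq_integral => //.
- by apply: emeasurable_funM => //; exact: measurable_int irn.
- exact: emeasurable_funM.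
- apply: ae_eqe_mul2l; apply: integral_ae_eq => // E _ mE.
  by rewrite -Radon_Nikodym_SigmaFinite.f_integral.
Qed.

Lemma normal_pdf_shift m s d x : s != 0 ->
  normal_pdf (m + d) s x =
  expR (d * (x - m) / s ^+ 2 - d ^+ 2 / (2 * s ^+ 2)) * normal_pdf m s x.
Proof.
move=> s0; rewrite !normal_pdfE// /normal_fun mulrCA -expRD; congr (_ * expR _).
by field.
Qed.

Lemma normal_change_of_mean m s d f : s != 0 ->
  measurable_fun setT f -> (forall x, (0 <= f x)%E) ->
  (\int[normal_prob (m + d) s]_x f x =
   \int[normal_prob m s]_x
     ((expR (d * (x - m) / s ^+ 2 - d ^+ 2 / (2 * s ^+ 2)))%:E * f x))%E.
Proof.
move=> s0 mf f0; rewrite (ge0_integral_normal_prob (m + d))//.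
rewrite (ge0_integral_normal_prob m); last 2 first.
- apply: emeasurable_funM => //; apply/measurable_EFinP/measurableT_comp => //.
  apply: measurable_funB => //; apply: measurable_funM => //.
  by apply: measurable_funM => //; apply: measurable_funB.
- by move=> x; rewrite mule_ge0// lee_fin expR_ge0.
apply: eq_integral => x _.
by rewrite normal_pdf_shift// EFinM muleA (muleC (f x)).
Qed.

Lemma normal_prob_setT m s : normal_prob m s setT = 1%E.
Proof. by rewrite /normal_prob integral_normal_pdf. Qed.

(* The Gaussian integrand is the density of N(m + s S/b, s^2 (b+1)/b) up to
   a factor; this identity makes exp(S_d^2/(2(b+d)))/sqrt(b+d) a martingale. *)
Lemma normal_exp_square m s S b : 0 < s -> 0 < b ->
  (\int[normal_prob m s]_x
     (expR ((S + (x - m) / s) ^+ 2 / (2 * (b + 1))) / Num.sqrt (b + 1))%:E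
   = (expR (S ^+ 2 / (2 * b)) / Num.sqrt b)%:E)%E.
Proof.
move=> s0 b0; have sn0 : s != 0 by rewrite gt_eqF.
have b1 : 0 < b + 1 by rewrite addr_gt0.
have sb0 : 0 < Num.sqrt b by rewrite sqrtr_gt0.
have sb1 : 0 < Num.sqrt (b + 1) by rewrite sqrtr_gt0.
rewrite ge0_integral_normal_prob; last 2 first.
- apply/measurable_EFinP/measurable_funM => //; apply/measurableT_comp => //.
  apply: measurable_funM => //; apply: measurable_funX.
  apply: measurable_funD => //; apply: measurable_funM => //.
  exact: measurable_funB.
- by move=> x; rewrite lee_fin divr_ge0// ?expR_ge0 ?sqrtr_ge0.
pose s' := s * Num.sqrt ((b + 1) / b).
have s'0 : 0 < s' by rewrite mulr_gt0// sqrtr_gt0 divr_gt0.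
have s'2 : s' ^+ 2 = s ^+ 2 * ((b + 1) / b).
  by rewrite exprMn sqr_sqrtr// ltW// divr_gt0.
transitivity (\int[mu]_x ((expR (S ^+ 2 / (2 * b)) / Num.sqrt b)%:E *
   (normal_pdf (m + s * S / b) s' x)%:E))%E; last first.
  rewrite ge0_integralZl_EFin//.
  - by rewrite integral_normal_pdf mule1.
  - by move=> x _; rewrite lee_fin normal_pdf_ge0.
  - by apply/measurable_EFinP; exact: measurable_normal_pdf.
apply: eq_integral => x _; rewrite -!EFinM; congr EFin.
rewrite !normal_pdfE ?gt_eqF// /normal_peak.
have q0 : 0 < s ^+ 2 * pi *+ 2.
  by rewrite mulrn_wgt0// mulr_gt0 ?pi_gt0// exprn_gt0.
have -> : Num.sqrt (s' ^+ 2 * pi *+ 2) =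
    Num.sqrt (s ^+ 2 * pi *+ 2) * Num.sqrt (b + 1) / Num.sqrt b.
  rewrite s'2 -mulrA -sqrtrV ?ltW// -!sqrtrM ?mulr_ge0 ?(ltW q0) ?ltW//.
  by apply: congr1; field; rewrite gt_eqF.
set P := Num.sqrt (s ^+ 2 * pi *+ 2).
have P0 : 0 < P by rewrite sqrtr_gt0.
rewrite /normal_fun.
transitivity ((P * Num.sqrt (b + 1))^-1 * (expR (S ^+ 2 / (2 * b)) *
   expR (- (x - (m + s * S / b)) ^+ 2 / (s' ^+ 2 *+ 2)))); last first.
  by field; rewrite ?gt_eqF.
rewrite -expRD.
have -> : S ^+ 2 / (2 * b) + - (x - (m + s * S / b)) ^+ 2 / (s' ^+ 2 *+ 2) =
  (S + (x - m) / s) ^+ 2 / (2 * (b + 1)) + (- (x - m) ^+ 2 / (s ^+ 2 *+ 2)).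
  by rewrite s'2; field; rewrite sn0 !gt_eqF.
by rewrite [in RHS]expRD; field; rewrite ?gt_eqF.
Qed.

End normal_1d.

(** * Iterated Gaussian expectations and likelihood ratios *)

Section gauss_iter_theory.
Context {R : realType}.
Implicit Types (s m : R) (ms : seq R) (f g : seq R -> \bar R).

(** [gauss_iter] integrates functions on lists, which carry no sigma-algebra here; measurability is
    therefore tested on the tuples of one length. *)
Definition tmeas (n : nat) (f : seq R -> \bar R) :=
  measurable_fun [set: n.-tuple R] (fun t : n.-tuple R => f t).

Lemma gauss_iter_ge0 s ms f : (forall xs, (0 <= f xs)%E) ->
  (0 <= gauss_iter s ms f)%E.
Proof.
elim: ms f => [|m ms IH] f f0 //=.
by apply: integral_ge0 => x _; apply: IH.
Qed.

(** The parameter space T is arbitrary because the induction moves each coordinate into it: the step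
    uses the hypothesis at T * R and then integrates R out by Tonelli. *)
Lemma measurable_gauss_iter (d : measure_display) (T : measurableType d) s ms
    (f : T -> seq R -> \bar R) :
  (forall t xs, (0 <= f t xs)%E) ->
  measurable_fun [set: T * (size ms).-tuple R]
    (fun p : T * (size ms).-tuple R => f p.1 p.2) ->
  measurable_fun [set: T] (fun t => gauss_iter s ms (f t)).
Proof.
elim: ms d T f => [|m ms IH] d T f f0 mf /=.
  have -> : (fun t => f t [::]) =
    (fun p : T * 0.-tuple R => f p.1 p.2) \o (fun t => (t, [tuple])).
    by apply/funext => t.
  apply: measurableT_comp => //.
pose F (p : T * R) := gauss_iter s ms (fun xs => f p.1 (p.2 :: xs)).
have F0 p : (0 <= F p)%E by apply: gauss_iter_ge0.
have mF : measurable_fun setT F.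
  apply: (IH _ _ (fun (p : T * R) xs => f p.1 (p.2 :: xs))) => //.
  have -> : (fun p : (T * R) * (size ms).-tuple R => f p.1.1 (p.1.2 :: p.2)) =
    (fun p : T * (size ms).+1.-tuple R => f p.1 p.2) \o
    (fun p : (T * R) * (size ms).-tuple R =>
       (p.1.1, [the (size ms).+1.-tuple R of p.1.2 :: p.2])).
    by apply/funext => p.
  apply: measurableT_comp => //; apply: measurable_fun_pair.
    exact: measurableT_comp.
  by apply: measurable_cons => //; exact: measurableT_comp.
exact: (@measurable_fun_fubini_tonelli_F _ _ T _ R (normal_prob m s) F mF F0).
Qed.

Lemma tmeas_cons (n : nat) f x : tmeas n.+1 f -> tmeas n (fun xs => f (x :: xs)).
Proof.
move=> mf; rewrite /tmeas.
have -> : (fun t : n.-tuple R => f (x :: t)) =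
  (fun t : n.+1.-tuple R => f t) \o (fun t : n.-tuple R => [the n.+1.-tuple R of x :: t]).
  by apply/funext.
by apply: measurableT_comp => //; apply: measurable_cons.
Qed.

Lemma measurable_gauss_iter_cons s ms f : (forall xs, (0 <= f xs)%E) ->
  tmeas (size ms).+1 f ->
  measurable_fun [set: R] (fun x => gauss_iter s ms (fun xs => f (x :: xs))).
Proof.
move=> f0 mf.
apply: (@measurable_gauss_iter _ R s ms (fun x xs => f (x :: xs))) => //.
have -> : (fun p : R * (size ms).-tuple R => f (p.1 :: p.2)) =
  (fun t : (size ms).+1.-tuple R => f t) \o
  (fun p : R * (size ms).-tuple R => [the (size ms).+1.-tuple R of p.1 :: p.2]).
  by apply/funext.
by apply: measurableT_comp => //; exact: measurable_cons.
Qed.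

Lemma eq_gauss_iter s ms f g :
  (forall xs, size xs = size ms -> f xs = g xs) ->
  gauss_iter s ms f = gauss_iter s ms g.
Proof.
elim: ms f g => [|m ms IH] f g fg /=; first exact: fg.
by apply: eq_integral => x _; apply: IH => xs sz; apply: fg; rewrite /= sz.
Qed.

Lemma gauss_iter_cst s ms (c : R) : gauss_iter s ms (fun=> c%:E) = c%:E.
Proof.
elim: ms => //= m ms ->.
rewrite integral_cst// -[RHS]mule1; congr mule; exact: normal_prob_setT.
Qed.

Lemma tmeas_cst (n : nat) (c : \bar R) : tmeas n (fun=> c).
Proof. exact: measurable_cst. Qed.

Lemma tmeas_add n f g : tmeas n f -> tmeas n g -> tmeas n (fun xs => f xs + g xs)%E.
Proof. by move=> mf mg; apply: emeasurable_funD. Qed.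

Lemma tmeas_mul n f g : tmeas n f -> tmeas n g -> tmeas n (fun xs => f xs * g xs)%E.
Proof. by move=> mf mg; apply: emeasurable_funM. Qed.

Lemma le_gauss_iter s ms f g :
  (forall xs, (0 <= f xs)%E) -> (forall xs, (0 <= g xs)%E) ->
  tmeas (size ms) f -> tmeas (size ms) g ->
  (forall xs, size xs = size ms -> (f xs <= g xs)%E) ->
  (gauss_iter s ms f <= gauss_iter s ms g)%E.
Proof.
elim: ms f g => [|m ms IH] f g f0 g0 mf mg fg /=; first exact: fg.
apply: ge0_le_integral => //.
- by move=> x _; apply: gauss_iter_ge0.
- exact: measurable_gauss_iter_cons.
- exact: measurable_gauss_iter_cons.
- move=> x _; apply: IH => //; try exact: tmeas_cons.
  by move=> xs sz; apply: fg; rewrite /= sz.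
Qed.

Lemma gauss_iterD s ms f g :
  (forall xs, (0 <= f xs)%E) -> (forall xs, (0 <= g xs)%E) ->
  tmeas (size ms) f -> tmeas (size ms) g ->
  gauss_iter s ms (fun xs => f xs + g xs)%E =
  (gauss_iter s ms f + gauss_iter s ms g)%E.
Proof.
elim: ms f g => [|m ms IH] f g f0 g0 mf mg //=.
rewrite -ge0_integralD//; last 4 first.
- by move=> x _; apply: gauss_iter_ge0.
- exact: measurable_gauss_iter_cons.
- by move=> x _; apply: gauss_iter_ge0.
- exact: measurable_gauss_iter_cons.
by apply: eq_integral => x _; rewrite IH//; exact: tmeas_cons.
Qed.

Lemma gauss_iterZl s ms (c : R) f : 0 <= c ->
  (forall xs, (0 <= f xs)%E) -> tmeas (size ms) f ->
  gauss_iter s ms (fun xs => c%:E * f xs)%E = (c%:E * gauss_iter s ms f)%E.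
Proof.
move=> c0; elim: ms f => [|m ms IH] f f0 mf //=.
rewrite -ge0_integralZl_EFin//; last 2 first.
- by move=> x _; apply: gauss_iter_ge0.
- exact: measurable_gauss_iter_cons.
by apply: eq_integral => x _; rewrite IH//; exact: tmeas_cons.
Qed.

Lemma gauss_iter_sum s ms (I : Type) (r : seq I) (F : I -> seq R -> \bar R) :
  (forall i xs, (0 <= F i xs)%E) -> (forall i, tmeas (size ms) (F i)) ->
  gauss_iter s ms (fun xs => \sum_(i <- r) F i xs)%E =
  (\sum_(i <- r) gauss_iter s ms (F i))%E.
Proof.
move=> F0 mF; elim: r => [|i r IH].
  rewrite big_nil; transitivity (gauss_iter s ms (fun=> 0%:E));
    last exact: gauss_iter_cst.
  by apply: eq_gauss_iter => xs _; rewrite big_nil.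
rewrite big_cons -IH -gauss_iterD//; last 2 first.
- by move=> xs; apply: sume_ge0.
- exact: emeasurable_sum.
by apply: eq_gauss_iter => xs _; rewrite big_cons.
Qed.

Lemma gauss_iter_cat s ms1 ms2 f :
  gauss_iter s (ms1 ++ ms2) f =
  gauss_iter s ms1 (fun xs => gauss_iter s ms2 (fun ys => f (xs ++ ys))).
Proof.
elim: ms1 f => [|m ms1 IH] f //=.
by apply: eq_integral => x _; rewrite IH.
Qed.

Lemma tmeas_coord n (g : R -> R) i (x0 : R) : measurable_fun setT g -> (i < n)%N ->
  measurable_fun [set: n.-tuple R] (fun t : n.-tuple R => g (nth x0 t i)).
Proof.
move=> mg ltin.
have -> : (fun t : n.-tuple R => g (nth x0 t i)) =
    g \o (fun t => tnth t (Ordinal ltin)).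
  by apply/funext => t /=; rewrite (tnth_nth x0).
by apply: measurableT_comp => //; exact: measurable_tnth.
Qed.

(* Likelihood ratio of N(ms + ds, s^2 I) with respect to N(ms, s^2 I). *)
Fixpoint likelihood s (ms ds xs : seq R) : R :=
  match ms, ds, xs with
  | m :: ms', d :: ds', x :: xs' =>
      expR (d * (x - m) / s ^+ 2 - d ^+ 2 / (2 * s ^+ 2)) *
      likelihood s ms' ds' xs'
  | _, _, _ => 1
  end.

Lemma likelihood_ge0 s ms ds xs : 0 <= likelihood s ms ds xs.
Proof.
elim: ms ds xs => [|m ms IH] [|d ds] [|x xs] //=.
by rewrite mulr_ge0// expR_ge0.
Qed.

Lemma tmeas_likelihood s ms ds :
  tmeas (size ms) (fun xs => (likelihood s ms ds xs)%:E).
Proof.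
apply/measurable_EFinP.
elim: ms ds => [|m ms IH] ds /=; first exact: measurable_cst.
case: ds => [|d ds]; first exact: measurable_cst.
have -> : (fun t : (size ms).+1.-tuple R => likelihood s (m :: ms) (d :: ds) t) =
  (fun t : (size ms).+1.-tuple R =>
    expR (d * (thead t - m) / s ^+ 2 - d ^+ 2 / (2 * s ^+ 2)) *
    likelihood s ms ds [tuple of behead t]).
  by apply/funext; case/tupleP => x t /=; rewrite theadE.
apply: measurable_funM.
  apply: measurableT_comp => //; apply: measurable_funB => //.
  apply: measurable_funM => //; apply: measurable_funM => //.
  by apply: measurable_funB => //; exact: measurable_tnth.
apply: (measurableT_comp (IH ds)).
exact: measurable_behead.
Qed.

Lemma gauss_iter_change_of_mean s ms ds f : s != 0 -> size ds = size ms ->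
  (forall xs, (0 <= f xs)%E) -> tmeas (size ms) f ->
  gauss_iter s [seq p.1 + p.2 | p <- zip ms ds] f =
  gauss_iter s ms (fun xs => (likelihood s ms ds xs)%:E * f xs)%E.
Proof.
move=> s0; elim: ms ds f => [|m ms IH] ds f sz f0 mf.
  by case: ds sz => [|//] _; rewrite /= mul1e.
case: ds sz => [//|d ds] [sz].
have szz : size [seq p.1 + p.2 | p <- zip ms ds] = size ms.
  by rewrite size_map size_zip sz minnn.
transitivity (\int[normal_prob (m + d)%R s]_x
    gauss_iter s [seq p.1 + p.2 | p <- zip ms ds]%R (fun xs => f (x :: xs)))%E.
  by [].
rewrite [LHS]normal_change_of_mean; [|exact: s0| |]; last 2 first.
- by apply: measurable_gauss_iter_cons => //; rewrite szz.
- by move=> x; apply: gauss_iter_ge0.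
apply: eq_integral => x _; rewrite IH//; last exact: tmeas_cons.
rewrite -[RHS]/(gauss_iter s ms (fun xs =>
  (likelihood s (m :: ms) (d :: ds) (x :: xs))%:E * f (x :: xs)))%E.
rewrite -gauss_iterZl ?expR_ge0//.
- by apply: eq_gauss_iter => xs _; rewrite EFinM muleA.
- by move=> xs; rewrite mule_ge0// lee_fin likelihood_ge0.
- by apply: tmeas_mul; [exact: tmeas_likelihood|exact: tmeas_cons].
Qed.

Lemma gauss_likelihood s ms ds : s != 0 -> size ds = size ms ->
  gauss_iter s ms (fun xs => (likelihood s ms ds xs)%:E) = 1%E.
Proof.
move=> s0 sz; rewrite -[RHS](gauss_iter_cst s [seq p.1 + p.2 | p <- zip ms ds] 1).
rewrite gauss_iter_change_of_mean//; last exact: tmeas_cst.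
by apply: eq_gauss_iter => xs _; rewrite mule1.
Qed.

(** Completing the square shows that the square of the ratio for the shift d is exp(|d|^2/s^2) times
    the ratio for the shift 2d, whose mean is 1. *)
Lemma gauss_likelihood_sqr s ms ds : s != 0 -> size ds = size ms ->
  gauss_iter s ms (fun xs => (likelihood s ms ds xs ^+ 2)%:E) =
  (expR ((\sum_(d <- ds) d ^+ 2) / s ^+ 2))%:E.
Proof.
move=> s0 sz.
have L2 xs : size xs = size ms -> likelihood s ms ds xs ^+ 2 =
    expR ((\sum_(d <- ds) d ^+ 2) / s ^+ 2) *
    likelihood s ms [seq 2 * d | d <- ds] xs.
  elim: ms ds xs sz => [|m ms IH] [|d ds] [|x xs] //=.
    by rewrite big_nil mul0r expR0 expr1n mulr1.
  move=> [szd] [szx]; rewrite exprMn IH// big_cons [(_ + \sum_(j <- ds) _) / _]mulrDl.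
  have -> : expR (d * (x - m) / s ^+ 2 - d ^+ 2 / (2 * s ^+ 2)) ^+ 2 =
    expR (d ^+ 2 / s ^+ 2) *
    expR (2 * d * (x - m) / s ^+ 2 - (2 * d) ^+ 2 / (2 * s ^+ 2)).
    by rewrite expr2 -!expRD; congr expR; field.
  by rewrite [expR (_ + _ / s ^+ 2)]expRD; ring.
transitivity (gauss_iter s ms (fun xs => (expR ((\sum_(d <- ds) d ^+ 2) / s ^+ 2))%:E *
    (likelihood s ms [seq 2 * d | d <- ds] xs)%:E)%E).
  by apply: eq_gauss_iter => xs szx; rewrite L2// EFinM.
rewrite gauss_iterZl ?expR_ge0//; last 2 first.
- by move=> xs; rewrite lee_fin likelihood_ge0.
- exact: tmeas_likelihood.
by rewrite gauss_likelihood ?size_map// mule1.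
Qed.

End gauss_iter_theory.

(** * Bayes risk of separated hypotheses *)

Section bayes_lower_bound.
Context {R : realType}.

Lemma to_tupleK (n : nat) (t : n.-tuple R) : to_tuple n t = t.
Proof. exact: valKd. Qed.

Lemma tmeas_loss (n : nat) (that : n.-tuple R -> n.-tuple R) (B : pred 'I_n)
    (th : n.-tuple R) : measurable_fun setT that ->
  tmeas n (fun xs =>
    (\sum_(j < n | B j) (tnth (that (to_tuple n xs)) j - tnth th j) ^+ 2)%:E).
Proof.
move=> mthat; apply/measurable_EFinP.
have -> : (fun t : n.-tuple R =>
    \sum_(j < n | B j) (tnth (that (to_tuple n t)) j - tnth th j) ^+ 2) =
  (fun t : n.-tuple R => \sum_(j <- enum B) (tnth (that t) j - tnth th j) ^+ 2).
  by apply/funext => t; rewrite to_tupleK big_enum.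
apply: measurable_sum => j; apply: measurable_funX; apply: measurable_funB => //.
by move/measurable_fun_tnthP : mthat; exact.
Qed.

(* At most one hypothesis can be closer than sqrt(r2)/2 to the estimate; its
   weight L i0 is controlled by 1 + x <= 1 + M/4 + x^2/M with x = L i0 - 1. *)
Lemma separated_weighted_loss (M : nat) (L l : 'I_M -> R) (r2 : R) :
  (0 < M)%N -> 0 <= r2 -> (forall i, 0 <= L i) -> (forall i, 0 <= l i) ->
  (forall i j, i != j -> r2 <= 2 * (l i + l j)) ->
  \sum_i (r2 / 4 * (1 + 2 / M%:R)) * L i <=
  \sum_i L i * l i + \sum_i (r2 / (4 * M%:R)) * L i ^+ 2 +
    r2 / 4 * (2 + M%:R / 4).
Proof.
move=> M0 r20 L0 l0 sep.
have M0' : (0 : R) < M%:R by rewrite ltr0n.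
have [i0 close] : exists i0, forall i, i != i0 -> r2 / 4 <= l i.
  have [[i1 hi1]|far] := pselect (exists i, l i < r2 / 4).
    by exists i1 => i ii1; have := sep _ _ ii1; lra.
  exists (Ordinal M0) => i _; rewrite leNgt; apply/negP => hi.
  by apply: far; exists i.
have h1 : r2 / 4 * (\sum_i L i - L i0) <= \sum_i L i * l i.
  rewrite (bigD1 i0)//= [X in _ <= X](bigD1 i0)//= [L i0 + _]addrC addrK mulr_sumr.
  rewrite -[leLHS]add0r lerD ?mulr_ge0//; apply: ler_sum => i ii0.
  by rewrite mulrC ler_wpM2l// close.
have h2 : L i0 <= 1 + M%:R / 4 + \sum_i (L i - 1) ^+ 2 / M%:R.
  apply: (@le_trans _ _ (1 + M%:R / 4 + (L i0 - 1) ^+ 2 / M%:R)).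
    rewrite -(ler_pM2r M0') !mulrDl -!mulrA mulVf ?gt_eqF// mulr1.
    by have := sqr_ge0 (L i0 - 1 - M%:R / 2); nra.
  rewrite lerD2l (bigD1 i0)//= lerDl; apply: sumr_ge0 => i _.
  by rewrite divr_ge0 ?sqr_ge0// ltW.
have h3 : \sum_i (L i - 1) ^+ 2 / M%:R =
    (\sum_i L i ^+ 2) / M%:R - 2 * (\sum_i L i) / M%:R + 1.
  transitivity (\sum_i (L i ^+ 2 / M%:R - 2 / M%:R * L i + M%:R^-1)).
    by apply: eq_bigr => i _; ring.
  rewrite big_split sumrB -mulr_suml -mulr_sumr /= sumr_const card_ord.
  by rewrite -(mulr_natr M%:R^-1 M) mulVf ?gt_eqF//; ring.
rewrite -!mulr_sumr.
have h4 := ler_wpM2l (divr_ge0 r20 (ler0n R 4)) h2.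
rewrite h3 in h4.
have -> : r2 / (4 * M%:R) * \sum_i L i ^+ 2 =
  r2 / 4 * ((\sum_i L i ^+ 2) / M%:R) by field; rewrite gt_eqF.
have -> : r2 / 4 * (1 + 2 / M%:R) * \sum_i L i =
  r2 / 4 * \sum_i L i + r2 / 4 * (2 * (\sum_i L i) / M%:R) by field; rewrite gt_eqF.
set S1 := \sum_i L i in h1 h4 *.
move: h1 h4; rewrite !mulrDr !mulrN; lra.
Qed.

(** Take the mean under th0 in [separated_weighted_loss]. The weighted losses become the risks at th
    i, the L i have mean 1, and their second moments are at most 5M/8. What remains is r2/4 * (M + 2
    - 5M/8 - 2 - M/4) = r2 M/32. The predicate B restricts the loss to one block, as the product
    prior requires. *)
Lemma bayes_risk_lower_bound (n M : nat) (s : R)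
    (that : n.-tuple R -> n.-tuple R) (th0 : n.-tuple R)
    (th : 'I_M -> n.-tuple R) (B : pred 'I_n) (r2 b2 : R) :
  0 < s -> (0 < M)%N -> 0 <= r2 -> measurable_fun setT that ->
  (forall i, sqdist (th i) th0 <= s ^+ 2 * b2) ->
  expR b2 <= 5 / 8 * M%:R ->
  (forall i i', i != i' ->
     r2 <= \sum_(j < n | B j) (tnth (th i) j - tnth (th i') j) ^+ 2) ->
  ((r2 * M%:R / 32)%:E <= \sum_(i < M) gauss_expect s (th i)
     (fun x => (\sum_(j < n | B j) (tnth (that x) j - tnth (th i) j) ^+ 2)%:E))%E.
Proof.
move=> s0 M0 r20 mthat near eb sep.
have sn0 : s != 0 by rewrite gt_eqF.
have M0' : (0 : R) < M%:R by rewrite ltr0n.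
pose ds i := [seq p.2 - p.1 | p <- zip th0 (th i)].
have szds i : size (ds i) = size th0.
  by rewrite size_map size_zip !size_tuple minnn.
have thE i : (th i : seq R) = [seq p.1 + p.2 | p <- zip th0 (ds i)].
  apply: (@eq_from_nth _ 0).
    by rewrite size_map size_zip szds !size_tuple minnn.
  move=> k; rewrite size_tuple => kn.
  rewrite (nth_map (0, 0)); last by rewrite size_zip szds size_tuple minnn.
  rewrite nth_zip ?szds// /ds (nth_map (0, 0)); last first.
    by rewrite size_zip !size_tuple minnn.
  by rewrite nth_zip ?size_tuple//= subrKC.
have dsE i : \sum_(d <- ds i) d ^+ 2 = sqdist (th i) th0.
  rewrite big_map (big_nth (0, 0)) size_zip !size_tuple minnn big_mkord.
  apply: eq_bigr => k _; rewrite nth_zip ?size_tuple//=.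
  by rewrite !(tnth_nth 0).
pose L i xs := likelihood s th0 (ds i) xs.
pose l i xs := \sum_(j < n | B j) (tnth (that (to_tuple n xs)) j - tnth (th i) j) ^+ 2.
have L0 i xs : 0 <= L i xs by exact: likelihood_ge0.
have l0 i xs : 0 <= l i xs by apply: sumr_ge0 => j _; exact: sqr_ge0.
have mL i : tmeas (size th0) (fun xs => (L i xs)%:E) by exact: tmeas_likelihood.
have ml i : tmeas (size th0) (fun xs => (l i xs)%:E).
  by rewrite size_tuple; exact: tmeas_loss.
have mLl i : tmeas (size th0) (fun xs => (L i xs * l i xs)%:E).
  by rewrite (_ : (fun _ => _) = fun xs => ((L i xs)%:E * (l i xs)%:E)%E)//;
    apply: tmeas_mul.
have mL2 i : tmeas (size th0) (fun xs => (L i xs ^+ 2)%:E).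
  rewrite (_ : (fun _ => _) = fun xs => ((L i xs)%:E * (L i xs)%:E)%E)//.
  exact: tmeas_mul.
have mZ (c : R) (g : seq R -> R) : tmeas (size th0) (fun xs => (g xs)%:E) ->
    tmeas (size th0) (fun xs => (c * g xs)%:E).
  move=> mg; rewrite (_ : (fun _ => _) = fun xs => (c%:E * (g xs)%:E)%E)//.
  by apply: tmeas_mul => //; exact: tmeas_cst.
have sepl xs i j : i != j -> r2 <= 2 * (l i xs + l j xs).
  move=> ij; apply: (le_trans (sep _ _ ij)).
  rewrite /l -big_split mulr_sumr /=; apply: ler_sum => k _.
  set a := tnth (that _) _.
  have := sqr_ge0 ((a - tnth (th i) k) + (a - tnth (th j) k)).
  nra.
set c2 := r2 / 4 * (1 + 2 / M%:R).
set c1 := r2 / (4 * M%:R).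
set c0 := r2 / 4 * (2 + M%:R / 4).
have c20 : 0 <= c2 by rewrite /c2 mulr_ge0 ?divr_ge0// addr_ge0// divr_ge0// ltW.
have c10 : 0 <= c1 by rewrite /c1 divr_ge0// mulr_ge0// ltW.
have c00 : 0 <= c0 by rewrite /c0 mulr_ge0 ?divr_ge0// addr_ge0// divr_ge0// ltW.
have key : (gauss_iter s th0 (fun xs => \sum_i (c2 * L i xs)%:E) <=
  gauss_iter s th0 (fun xs => (\sum_i (L i xs * l i xs)%:E +
    \sum_i (c1 * L i xs ^+ 2)%:E) + c0%:E))%E.
  apply: le_gauss_iter.
  - by move=> xs; apply: sume_ge0 => i _; rewrite lee_fin mulr_ge0.
  - move=> xs; rewrite !adde_ge0 ?lee_fin//; apply: sume_ge0 => i _;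
      by rewrite lee_fin mulr_ge0 ?sqr_ge0.
  - by apply: emeasurable_sum => i; exact: mZ.
  - apply: tmeas_add; last exact: tmeas_cst.
    apply: tmeas_add; apply: emeasurable_sum => i; first exact: mLl.
    exact: (mZ c1 _ (mL2 i)).
  - move=> xs _; rewrite !sumEFin -!EFinD lee_fin.
    by apply: separated_weighted_loss => // *; exact: sepl.
have E1 (c : R) (g : seq R -> R) : 0 <= c -> (forall xs, 0 <= g xs) ->
    tmeas (size th0) (fun xs => (g xs)%:E) ->
    gauss_iter s th0 (fun xs => (c * g xs)%:E) =
    (c%:E * gauss_iter s th0 (fun xs => (g xs)%:E))%E.
  by move=> c0' g0 mg; rewrite -gauss_iterZl.
rewrite gauss_iter_sum in key; last 2 first.
- by move=> i xs; rewrite lee_fin mulr_ge0.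
- by move=> i; exact: mZ.
rewrite gauss_iterD in key; last 4 first.
- move=> xs; rewrite !adde_ge0 ?lee_fin//; apply: sume_ge0 => i _;
    by rewrite lee_fin mulr_ge0 ?sqr_ge0.
- by [].
- apply: tmeas_add; apply: emeasurable_sum => i; first exact: mLl.
    exact: (mZ c1 _ (mL2 i)).
- exact: tmeas_cst.
rewrite gauss_iterD in key; last 4 first.
- by move=> xs; apply: sume_ge0 => i _; rewrite lee_fin mulr_ge0.
- by move=> xs; apply: sume_ge0 => i _; rewrite lee_fin mulr_ge0 ?sqr_ge0.
- exact: emeasurable_sum.
- by apply: emeasurable_sum => i; exact: (mZ c1 _ (mL2 i)).
rewrite gauss_iter_cst !gauss_iter_sum in key; last 4 first.
- by move=> i xs; rewrite lee_fin mulr_ge0 ?sqr_ge0.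
- by move=> i; exact: (mZ c1 _ (mL2 i)).
- by move=> i xs; rewrite lee_fin mulr_ge0.
- by [].
have RE i : gauss_iter s th0 (fun xs => (L i xs * l i xs)%:E) =
    gauss_expect s (th i)
     (fun x => (\sum_(j < n | B j) (tnth (that x) j - tnth (th i) j) ^+ 2)%:E).
  rewrite /gauss_expect thE gauss_iter_change_of_mean//.
    by move=> xs; rewrite lee_fin; exact: l0.
  exact: ml.
rewrite (eq_bigr _ (fun i _ => RE i)) in key.
have Lk i : gauss_iter s th0 (fun xs => (c2 * L i xs)%:E) = c2%:E.
  by rewrite E1// gauss_likelihood// mule1.
rewrite (eq_bigr _ (fun i _ => Lk i)) in key.
have L2k i : (gauss_iter s th0 (fun xs => (c1 * L i xs ^+ 2)%:E) <=
    (c1 * (5 / 8 * M%:R))%:E)%E.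
  rewrite E1//; last by move=> xs; exact: sqr_ge0.
  rewrite gauss_likelihood_sqr// -EFinM lee_fin ler_wpM2l//.
  apply: le_trans eb; rewrite ler_expR dsE ler_pdivrMr ?exprn_gt0// mulrC.
  exact: near.
set X := (\sum_i gauss_expect _ _ _)%E in key *.
have : (\sum_(i < M) c2%:E <= X + \sum_(i < M) (c1 * (5 / 8 * M%:R))%:E + c0%:E)%E.
  apply: (le_trans key); rewrite leeD2r// leeD2l//; apply: lee_sum => i _.
  exact: L2k.
rewrite !sumEFin !sumr_const card_ord -addeA -EFinD -leeBlDr//.
apply: le_trans; rewrite -EFinB lee_fin -(mulr_natr c2) -(mulr_natr (c1 * _)) /c2 /c1 /c0.
rewrite le_eqVlt; apply/orP; left; apply/eqP.
by field; rewrite gt_eqF.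
Qed.

End bayes_lower_bound.

(** * Product priors over disjoint blocks *)

Section product_prior.
Context {R : realType}.

Lemma ereal_mulrn (n : nat) (x : \bar R) : x *+ n = (n%:R%:E * x)%E.
Proof. by rewrite mule_natl; elim: n => [//|n IH]; rewrite mulrS IH muleS. Qed.

(** The supremum is at least the average over all f, the uniform product prior. For each block b the
    f fall into fibres along which only the value at b varies; on a fibre [bayes_risk_lower_bound]
    applies, with the member equal to [ord0] at b as reference. This is Assouad's scheme with M+1
    choices per block. *)
Lemma minimax_risk_ge (n m M : nat) (s r2 b2 : R) (Theta : set (n.-tuple R))
    (th : {ffun 'I_m -> 'I_M.+1} -> n.-tuple R) (B : 'I_m -> pred 'I_n) :
  0 < s -> 0 <= r2 -> (forall f, Theta (th f)) ->
  (forall b b' j, B b j -> B b' j -> b = b') ->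
  expR b2 <= 5 / 8 * M.+1%:R ->
  (forall (f f' : {ffun 'I_m -> 'I_M.+1}) b, (forall b', b' != b -> f b' = f' b') -> f' b = ord0 ->
     sqdist (th f) (th f') <= s ^+ 2 * b2) ->
  (forall (f f' : {ffun 'I_m -> 'I_M.+1}) b, (forall b', b' != b -> f b' = f' b') -> f b != f' b ->
     r2 <= \sum_(j < n | B b j) (tnth (th f) j - tnth (th f') j) ^+ 2) ->
  ((r2 * m%:R / 32)%:E <= minimax_risk s Theta)%E.
Proof.
move=> s0 r20 Th disj eb near sep; apply: le_ereal_inf_tmp => _ [that [mthat ->]].
set S := ereal_sup _.
have riskS f : (risk s that (th f) <= S)%E.
  by apply: ereal_sup_ubound; exists (th f) => //; exact: Th.
pose Rb b f := gauss_expect s (th f)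
  (fun x => (\sum_(j < n | B b j) (tnth (that x) j - tnth (th f) j) ^+ 2)%:E).
have riskge f : (\sum_b Rb b f <= risk s that (th f))%E.
  rewrite /risk /Rb /gauss_expect -gauss_iter_sum; last 2 first.
  - by move=> i xs; rewrite lee_fin; apply: sumr_ge0 => j _; exact: sqr_ge0.
  - by move=> i; rewrite size_tuple; exact: tmeas_loss.
  apply: le_gauss_iter.
  - move=> xs; apply: sume_ge0 => i _; rewrite lee_fin.
    by apply: sumr_ge0 => j _; exact: sqr_ge0.
  - by move=> xs; rewrite lee_fin; apply: sumr_ge0 => j _; exact: sqr_ge0.
  - by apply: emeasurable_sum => i; rewrite size_tuple; exact: tmeas_loss.
  - rewrite size_tuple; exact: (tmeas_loss predT).
  (* A coordinate lies in at most one block, so the block losses add up to at most the whole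
     loss. *)
  - move=> xs _; rewrite sumEFin lee_fin /sqdist (exchange_big_dep predT)//=.
    apply: ler_sum => j _; rewrite sumr_const -mulr_natr ler_piMr ?sqr_ge0//.
    rewrite lern1; apply/card_le1P => b Bbj b'; rewrite !inE.
    by apply/idP/eqP => [Bb'j|->//]; exact: disj Bb'j Bbj.
(* Cyclic shifts of the value at b run through a fibre. Each shift permutes the f, so summing over f
   and over all shifts counts every f exactly M+1 times and no quotient by the fibres is needed. *)
pose sh (b : 'I_m) (i : 'I_M.+1) (f : {ffun 'I_m -> 'I_M.+1}) :=
  [ffun b' => if b' == b then f b' + i else f b'].
have shK b i : cancel (sh b i) (sh b (- i)).
  by move=> f; apply/ffunP => b'; rewrite !ffunE; case: eqP => // _; rewrite addrK.
have reidx b i : (\sum_f Rb b f = \sum_f Rb b (sh b i f))%E.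
  apply: reindex; exists (sh b (- i)) => f _; first exact: shK.
  by rewrite -[in X in sh b X]( opprK i) shK.
have fib b f : ((r2 * M.+1%:R / 32)%:E <= \sum_i Rb b (sh b i f))%E.
  apply: (@bayes_risk_lower_bound _ _ _ s that (th (sh b (- f b) f))
    (fun i => th (sh b i f)) (B b) r2 b2) => //.
  - move=> i; apply: (near _ _ b) => [b' b'b|].
      by rewrite !ffunE (negbTE b'b).
    by rewrite ffunE eqxx subrr.
  - move=> i i' ii'; apply: (sep _ _ b) => [b' b'b|].
      by rewrite !ffunE (negbTE b'b).
    by rewrite !ffunE eqxx (inj_eq (addrI _)).
set N := #|{ffun 'I_m -> 'I_M.+1}|.
have N0 : (0 < N)%N by apply/card_gt0P; exists [ffun=> ord0].
have NM0 : (0 < (N * M.+1)%:R%:E :> \bar R)%E.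
  by rewrite lte_fin ltr0n muln_gt0 N0.
rewrite -(lee_pmul2l _ NM0)//.
have -> : ((N * M.+1)%:R%:E * S = \sum_(i < M.+1) \sum_(f : {ffun 'I_m -> 'I_M.+1}) S)%E.
  by rewrite !sumr_const card_ord -mulrnA ereal_mulrn.
apply: (@le_trans _ _ (\sum_(i < M.+1) \sum_(f : {ffun 'I_m -> 'I_M.+1}) \sum_b Rb b f)%E); last first.
  apply: lee_sum => i _; apply: lee_sum => f _.
  exact: le_trans (riskge f) (riskS f).
have -> : (\sum_(i < M.+1) \sum_(f : {ffun 'I_m -> 'I_M.+1}) \sum_b Rb b f =
    \sum_b \sum_f \sum_(i < M.+1) Rb b (sh b i f))%E.
  transitivity (\sum_(i < M.+1) \sum_b \sum_f Rb b f)%E.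
    by apply: eq_bigr => i _; rewrite exchange_big.
  rewrite [LHS]exchange_big /=; apply: eq_bigr => b _.
  by rewrite [RHS]exchange_big /=; apply: eq_bigr => i _; exact: reidx.
apply: (@le_trans _ _ (\sum_(b < m) \sum_(f : {ffun 'I_m -> 'I_M.+1})
   (r2 * M.+1%:R / 32)%:E)%E); last first.
  by apply: lee_sum => b _; apply: lee_sum => f _; exact: fib.
rewrite !sumr_const card_ord -/N !ereal_mulrn -!EFinM lee_fin natrM.
by rewrite le_eqVlt; apply/orP; left; apply/eqP; ring.
Qed.

End product_prior.

(** * Families of hypotheses *)

Section lower_bounds.
Context {R : realType}.
Implicit Types (n k : nat) (s h : R).

Lemma minimax_risk_ge_single n M s (r2 b2 : R) (Theta : set (n.-tuple R))
    (th : 'I_M.+1 -> n.-tuple R) :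
  0 < s -> 0 <= r2 -> (forall i, Theta (th i)) ->
  expR b2 <= 5 / 8 * M.+1%:R ->
  (forall i, sqdist (th i) (th ord0) <= s ^+ 2 * b2) ->
  (forall i j, i != j -> r2 <= sqdist (th i) (th j)) ->
  ((r2 / 32)%:E <= minimax_risk s Theta)%E.
Proof.
move=> s0 r20 Th eb near sep.
have := @minimax_risk_ge R n 1 M s r2 b2 Theta (fun f => th (f ord0))
  (fun=> predT) s0 r20.
rewrite mulr1; apply => //.
- by move=> b b' j _ _; rewrite !ord1.
- by move=> f f' b _; rewrite (ord1 b) => ->.
- by move=> f f' b _; rewrite (ord1 b) => /sep.
Qed.

Lemma constant_unimodal n k (c : R) (t : n.-tuple R) : (1 <= k)%N ->
  (forall i, tnth t i = c) -> unimodal_k k t.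
Proof.
move=> k1 tc.
exists (fun j => if j == 0%N then 0%N else n), 1%N, (fun=> c); split => //.
- by split=> //; case: k k1.
- by move=> [|j].
Qed.

(** Le Cam's two-point method with the constants 0 and h: for two hypotheses the second moment
    condition reads expR b2 <= 5/4. *)
Lemma minimax_risk_ge_constant n k s : (1 <= k <= n)%N -> 0 < s ->
  ((s ^+ 2 * ln (5 / 4) / 32)%:E <= minimax_risk s (@Theta_wedge R n k))%E.
Proof.
move=> /andP[k1 kn] s0.
have n0 : (0 : R) < n%:R by rewrite ltr0n (leq_trans k1 kn).
have b20 : 0 < ln (5 / 4) :> R by apply: ln_gt0; lra.
pose h := s * Num.sqrt (ln (5 / 4) / n%:R).
have h2 : n%:R * h ^+ 2 = s ^+ 2 * ln (5 / 4).
  rewrite exprMn sqr_sqrtr ?divr_ge0 ?ltW//; field; by rewrite gt_eqF.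
apply: (@minimax_risk_ge_single n 1 s _ (ln (5 / 4)) _
  (fun i => [tuple of nseq n (h *+ i)])) => //.
- by rewrite mulr_ge0 ?sqr_ge0 ?ltW.
- by move=> i; apply: (@constant_unimodal _ _ (h *+ i)) => // j; rewrite tnth_nseq.
- rewrite lnK ?posrE; lra.
- move=> i; rewrite /sqdist -h2.
  under eq_bigr do rewrite !tnth_nseq mulr0n subr0.
  rewrite sumr_const card_ord -[X in X <= _]mulr_natl ler_pM2l// exprMn_n.
  by case: i => -[|[|]]//= _; rewrite ?mulr0n ?sqr_ge0// mulr1n.
- move=> i j ij; rewrite /sqdist -h2.
  under eq_bigr do rewrite !tnth_nseq.
  rewrite sumr_const card_ord -[X in _ <= X]mulr_natl ler_pM2l//.
  case: i j ij => -[|[|//]] hi [[|[|//]] hj] //= _.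
    by rewrite mulr0n mulr1n sub0r sqrrN.
  by rewrite mulr0n mulr1n subr0.
Qed.

(** The case i = 0 is allowed: the piece of height h is then empty and the vector is 0, the
    reference hypothesis. *)
Lemma spike_unimodal n k h (i : nat) (t : n.-tuple R) : (3 <= k)%N -> 0 <= h ->
  (i <= n)%N -> (forall j : 'I_n, tnth t j = if j.+1 == i then h else 0) ->
  unimodal_k k t.
Proof.
move=> k3 h0 iN tE.
exists (fun j => match j with 0 => 0 | 1 => i.-1 | 2 => i | _ => n end)%N, 2%N,
  (fun j => if j == 2%N then h else 0); split.
- by split=> //; move: k k3 => [|[|[|k]]].
- by move=> [|[|[|j]]] //= _; lia.
- lia.
- split; first by move=> [|[|j]] //=; lia.
  by move=> [|[|[|j]]] //= _; lia.
- move=> j q jk; rewrite tE.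
  move: j jk => [|[|[|[|j]]]] //= _ hq; case: eqP => //; try lia.
Qed.

Lemma minimax_risk_ge_spike n k s : (3 <= k <= n)%N -> 0 < s ->
  ((s ^+ 2 * ln (5 / 8 * n.+1%:R) / 32)%:E <=
   minimax_risk s (@Theta_wedge R n k))%E.
Proof.
move=> /andP[k3 kn] s0.
have n3 : (3 : R) <= n%:R by rewrite ler_nat (leq_trans k3 kn).
set b2 := ln _.
have b20 : 0 < b2 by apply: ln_gt0; rewrite -natr1; lra.
pose h := s * Num.sqrt b2.
have h0 : 0 <= h by rewrite mulr_ge0 ?sqrtr_ge0// ltW.
have h2 : h ^+ 2 = s ^+ 2 * b2 by rewrite exprMn sqr_sqrtr// ltW.
pose th (i : 'I_n.+1) := [tuple if j.+1 == i then h else 0 | j < n].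
have oneE (i : 'I_n.+1) : i != ord0 ->
    exists2 q : 'I_n, q.+1 = i & forall j : 'I_n, (j.+1 == i) = (j == q).
  move=> i0; have hq : (i.-1 < n)%N.
    by have := ltn_ord i; move: i0; rewrite -val_eqE /=; case: (val i).
  exists (Ordinal hq) => [|j]; rewrite -?val_eqE /=; move: i0;
    by rewrite -val_eqE /=; case: (val i) => [|p] //= _; rewrite ?eqSS.
apply: (@minimax_risk_ge_single n n s _ b2 _ th) => //.
- by rewrite mulr_ge0 ?sqr_ge0// ltW.
- move=> i; apply: (@spike_unimodal _ _ h i) => //; first by rewrite -ltnS.
  by move=> j; rewrite tnth_mktuple.
- by rewrite /b2 lnK// posrE mulr_gt0// ltr0n.
- move=> i; rewrite /sqdist.
  have [->|/oneE[q qi qE]] := eqVneq i ord0.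
    rewrite big1 => [|j _]; last by rewrite subrr expr0n.
    by rewrite -h2 sqr_ge0.
  rewrite (bigD1 q)//= !tnth_mktuple qE eqxx subr0 big1 ?addr0 ?h2// => j jq.
  by rewrite !tnth_mktuple qE (negbTE jq) subrr expr0n.
- suff main (i j : 'I_n.+1) : i != j -> i != ord0 ->
      s ^+ 2 * b2 <= sqdist (th i) (th j).
    move=> i j ij; have [i0|i0] := eqVneq i ord0; last exact: main.
    have -> : sqdist (th i) (th j) = sqdist (th j) (th i).
      by apply: eq_bigr => q _; rewrite -sqrrN opprB.
    by apply: main; [rewrite eq_sym|rewrite -i0 eq_sym].
  move=> ij /oneE[q qi qE]; rewrite /sqdist (bigD1 q)//= !tnth_mktuple qE eqxx.
  have -> : (q.+1 == j) = false by rewrite qi; apply: negbTE.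
  by rewrite subr0 h2 lerDl; apply: sumr_ge0 => p _; exact: sqr_ge0.
Qed.

Lemma sum_ord_interval n (lo hi : nat) (c : R) : (lo <= hi <= n)%N ->
  \sum_(j < n | (lo <= j < hi)%N) c = c * (hi - lo)%:R.
Proof.
move=> /andP[lohi hin].
rewrite -(big_mkord (fun j => (lo <= j < hi)%N) (fun=> c)).
rewrite (big_cat_nat (n := hi))//= [X in _ + X]big_nat_cond [X in _ + X]big1; last first.
  by move=> j; lia.
rewrite addr0 (big_cat_nat (n := lo))//= [X in X + _]big_nat_cond [X in X + _]big1; last first.
  by move=> j; lia.
rewrite add0r big_nat_cond (eq_bigl (fun j => (lo <= j < hi)%N)); last first.
  by move=> j; lia.
by rewrite -big_nat sumr_const_nat mulr_natr.
Qed.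

(** Block b has level b H, and its last [sz b] entries are raised by [ht b]. As long as [ht b] is
    between 0 and H the vector is nondecreasing, so the bumps can be chosen independently. The
    truncated subtraction puts the n - m W leftover coordinates into block 0. *)
Definition staircase n (m W : nat) (H : R) (sz : nat -> nat) (ht : nat -> R)
    : n.-tuple R :=
  [tuple let b := ((p - (n - m * W)) %/ W)%N in
    H *+ b + (if ((b.+1 * W + (n - m * W)) - p <= sz b)%N then ht b else 0)
  | p < n].

Lemma staircase_block n m W (p : 'I_n) : (0 < W)%N -> (0 < m)%N -> (m * W <= n)%N ->
  let b := ((p - (n - m * W)) %/ W)%N in
  [/\ (b < m)%N, (p < (n - m * W) + b.+1 * W)%N &
      (0 < b -> (n - m * W) + b * W <= p)%N].
Proof.
move=> W0 m0 mWn /=; set r := (n - m * W)%N; have pn := ltn_ord p.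
have rn : (r + m * W = n)%N by rewrite /r subnK.
split.
- rewrite ltn_divLR//; lia.
- have := ltn_ceil (p - r) W0; lia.
- move=> b0; have := leq_trunc_div (p - r) W; lia.
Qed.

Lemma staircase_unimodal n k m W (H : R) sz ht : (0 < W)%N -> (0 < m)%N ->
  (m * W <= n)%N -> (m.*2 <= k)%N -> 0 <= H ->
  (forall b, 0 <= ht b <= H) -> (forall b, (sz b <= W)%N) ->
  unimodal_k k (staircase n m W H sz ht).
Proof.
move=> W0 m0 mWn mk H0 htH szW.
set r := (n - m * W)%N; have rn : (r + m * W = n)%N by rewrite /r subnK.
(* Pieces 2b+1 and 2b+2 are the base and the bump of block b. Pieces beyond 2m are empty and repeat
   the last value, so the mode can be put at the last piece. *)
pose a j := if j == 0%N then 0%N else if (j <= m.*2)%N then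
  (if odd j then r + (j./2).+1 * W - sz j./2 else r + j./2 * W)%N else n.
pose mu j := let i := minn j m.*2 in
  if odd i then H *+ i./2 else H *+ (i./2).-1 + ht (i./2).-1.
have odd_a b : (b < m)%N -> a b.*2.+1 = (r + b.+1 * W - sz b)%N.
  by move=> bm; rewrite /a /= odd_double /= uphalf_double ltn_double bm.
have even_a b : (0 < b)%N -> (b <= m)%N -> a b.*2 = (r + b * W)%N.
  by move=> b0 bm; rewrite /a double_eq0 eqn0Ngt b0 leq_double bm odd_double doubleK.
have parity j : exists b, j = b.*2 \/ j = b.*2.+1.
  by exists j./2; lia.
have odd_mu b : (b < m)%N -> mu b.*2.+1 = H *+ b.
  move=> bm; rewrite /mu (minn_idPl _) ?ltn_double//= odd_double /=.
  by rewrite uphalf_double.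
have even_mu b : (b < m)%N -> mu b.+1.*2 = H *+ b + ht b.
  by move=> bm; rewrite /mu (minn_idPl _) ?leq_double// odd_double doubleK.
have last_mu j : (m.*2 <= j)%N -> mu j = mu m.*2.
  by move=> mj; rewrite /mu (minn_idPr mj) minnn.
exists a, k, mu; split.
- split => //; rewrite /a; case: eqP => [|_]; first by lia.
  case: ifPn => // km; have -> : k = m.*2 by apply/eqP; rewrite eqn_leq km.
  by rewrite odd_double doubleK.
- move=> j jk; have [jm|jm] := leqP m.*2 j.
    have -> : a j.+1 = n by rewrite /a /=; case: ifP => //; lia.
    rewrite /a; case: ifP => // _; case: ifP => // jm2.
    have -> : j = m.*2 by apply/eqP; rewrite eqn_leq jm2.
    by rewrite odd_double doubleK rn.
  have [b [jb|jb]] := parity j.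
    have bm : (b < m)%N by lia.
    have := szW b; rewrite jb odd_a//; case: (posnP b) => [->|b0].
      by rewrite double0 /a.
    by rewrite even_a; lia.
  have bm : (b < m)%N by lia.
  rewrite jb odd_a// -[b.*2.+2]/(b.+1.*2) even_a//; lia.
- by lia.
- split; last by move=> j; lia.
  move=> j j1 jk; have [jm|jm] := leqP m.*2 j.
    by rewrite !last_mu// leqW.
  have [b [jb|jb]] := parity j; rewrite jb.
    move: j1 jb jm; case: b => [|b] //; first by lia.
    move=> _ jb jm; have bm : (b.+1 < m)%N by lia.
    rewrite even_mu ?odd_mu//; last by lia.
    by rewrite mulrSr lerD2l; case/andP: (htH b).
  have bm : (b < m)%N by lia.
  rewrite odd_mu// -[b.*2.+2]/(b.+1.*2) even_mu// lerDl.
  by case/andP: (htH b).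
- move=> j p jk /andP[]; have pn := ltn_ord p; have [jm|jm] := ltnP m.*2 j.
    have -> : a j.-1 = n; last by lia.
    rewrite /a; case: eqP => [|_]; first by lia.
    case: ifP => // jm2; have -> : j.-1 = m.*2 by lia.
    by rewrite odd_double doubleK.
  rewrite tnth_mktuple; cbv zeta; rewrite -/r.
  have [b [jb|jb]] := parity j; rewrite jb.
    move: jk jb jm; case: b => [|b]; first by lia.
    move=> _ jb jm; have bm : (b < m)%N by lia.
    rewrite even_mu// even_a// -[b.+1.*2.-1]/(b.*2.+1) odd_a// => lo hi.
    have sb := szW b.
    have -> : ((p - r) %/ W)%N = b.
      have -> : (p - r = b * W + (p - r - b * W))%N by lia.
      by rewrite divnMDl// divn_small ?addn0//; lia.
    rewrite ifT//; lia.
  have bm : (b < m)%N by lia.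
  rewrite odd_mu// odd_a//= => lo hi.
  have lo' : (b = 0 \/ r + b * W <= p)%N.
    by case: (posnP b) => [->|b0]; [left|right; rewrite even_a// in lo; lia].
  have -> : ((p - r) %/ W)%N = b.
    case: lo' => [b0|lo']; first by rewrite divn_small ?b0//; lia.
    have -> : (p - r = b * W + (p - r - b * W))%N by lia.
    by rewrite divnMDl// divn_small ?addn0//; lia.
  by rewrite ifF ?addr0//; lia.
Qed.

End lower_bounds.

(** * The staircase family with bumps of geometric lengths *)

Section staircase_lower_bound.
Context {R : realType}.
Implicit Types (n k : nat) (s h : R).

(* Index 0 stands for the absence of a bump; all other bumps have the same
   Euclidean norm H. *)
Definition bump_size (i : nat) : nat := if i is i'.+1 then (4 ^ i')%N else 0%N.
Definition bump_height (H : R) (i : nat) : R :=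
  if i is i'.+1 then H / 2 ^+ i' else 0.

Lemma bump_mass (H : R) i : (0 < i)%N ->
  bump_height H i ^+ 2 * (bump_size i)%:R = H ^+ 2.
Proof.
case: i => // i _ /=; rewrite natrX exprMn exprVn.
have -> : (4 : R) ^+ i = (2 ^+ i) ^+ 2 by rewrite exprAC; congr (_ ^+ i); ring.
by field; rewrite expf_neq0// pnatr_eq0.
Qed.

Lemma bump_size_lt u v : (u < v)%N -> (4 * bump_size u <= bump_size v)%N.
Proof.
case: u v => [|u] [|v] //= uv.
by rewrite -expnS leq_pexp2l.
Qed.

(** Each block has [(trunc_log 4 W).+2] hypotheses: no bump, or a bump of length 4^i <= W. Two bumps
    of different lengths are compared only where the longer one stands alone; by [bump_size_lt] this
    is at least half of its length, hence the separation H^2/2. *)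
Lemma minimax_risk_ge_staircase n k m W s :
  (0 < W)%N -> (0 < m)%N -> (m * W <= n)%N -> (m.*2 <= k)%N -> 0 < s ->
  ((s ^+ 2 * ln (5 / 8 * (trunc_log 4 W).+2%:R) / 2 * m%:R / 32)%:E <=
   minimax_risk s (@Theta_wedge R n k))%E.
Proof.
move=> W0 m0 mWn mk s0; set M := (trunc_log 4 W).+1.
set b2 := ln _.
have b20 : 0 < b2.
  apply: ln_gt0; apply: (@lt_le_trans _ _ (5 / 8 * 2)); first by lra.
  by rewrite ler_pM2l ?ler_nat//; lra.
pose H := s * Num.sqrt b2.
have H0 : 0 <= H by rewrite mulr_ge0 ?sqrtr_ge0// ltW.
have H2 : H ^+ 2 = s ^+ 2 * b2 by rewrite exprMn sqr_sqrtr// ltW.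
pose idx (f : {ffun 'I_m -> 'I_M.+1}) (b : nat) : nat :=
  if insub b is Some b' then (f b' : nat) else 0%N.
have idxE f (b : 'I_m) : idx f b = f b by rewrite /idx valK.
have idxM f b : (idx f b <= M)%N.
  by rewrite /idx; case: insubP => // b' _ _; rewrite -ltnS.
have szW i : (i <= M)%N -> (bump_size i <= W)%N.
  case: i => //= i iM; apply: (@leq_trans (4 ^ trunc_log 4 W)%N).
    by rewrite leq_pexp2l.
  exact: trunc_logP.
have htH i : 0 <= bump_height H i <= H.
  case: i => [|i] /=; first by rewrite lexx.
  rewrite divr_ge0 ?exprn_ge0//= ler_pdivrMr ?exprn_gt0// ler_peMr//.
  by rewrite exprn_ege1// ler1n.
pose th f := staircase n m W H (fun b => bump_size (idx f b))
  (fun b => bump_height H (idx f b)).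
set r := (n - m * W)%N.
pose bk (p : 'I_n) := ((p - r) %/ W)%N.
have bkE p : [/\ (bk p < m)%N, (p < r + (bk p).+1 * W)%N &
    (0 < bk p -> r + bk p * W <= p)%N] by exact: staircase_block.
have thE f p : tnth (th f) p = H *+ bk p +
    (if ((bk p).+1 * W + r - p <= bump_size (idx f (bk p)))%N
     then bump_height H (idx f (bk p)) else 0).
  by rewrite tnth_mktuple.
have off (f f' : {ffun 'I_m -> 'I_M.+1}) (b : 'I_m) :
    (forall b', b' != b -> f b' = f' b') ->
    forall p, bk p != b -> tnth (th f) p = tnth (th f') p.
  move=> ff' p pb; rewrite !thE; have [bm _ _] := bkE p.
  by rewrite -[bk p]/(val (Ordinal bm)) !idxE ff'.
have on (f : {ffun 'I_m -> 'I_M.+1}) (b : 'I_m) p : bk p = b ->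
    tnth (th f) p = H *+ b + (if (b.+1 * W + r - p <= bump_size (f b))%N
     then bump_height H (f b) else 0).
  by move=> pb; rewrite thE pb idxE.
have rmW : (r + m * W = n)%N by rewrite /r subnK.
have hin (b : 'I_m) : (r + b.+1 * W <= n)%N.
  by rewrite -rmW leq_add2l leq_mul2r ltn_ord orbT.
apply: (@minimax_risk_ge R n m M s _ b2 _ th (fun b p => bk p == b)) => //.
- by rewrite divr_ge0 ?mulr_ge0 ?sqr_ge0// ltW.
- move=> f; apply: staircase_unimodal => // b; exact: szW.
- by move=> b b' p /eqP pb /eqP pb'; apply: val_inj; rewrite /= -pb -pb'.
- by rewrite /b2 lnK// posrE mulr_gt0// ltr0n.
- move=> f f' b ff' f'b; rewrite /sqdist -H2.
  set u := nat_of_ord (f b); have uM : (u <= M)%N by exact: (ltn_ord (f b)).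
  have suW := szW _ uM.
  apply: (@le_trans _ _ (\sum_(p < n | (r + b.+1 * W - bump_size u <= p < r + b.+1 * W)%N)
     bump_height H u ^+ 2)).
    rewrite [leRHS]big_mkcond /=; apply: ler_sum => p _.
    have [pb|pb] := eqVneq (bk p) b; last first.
      rewrite (off _ _ _ ff')// subrr expr0n; case: ifP => // _; exact: sqr_ge0.
    rewrite !(on _ _ _ pb) f'b /= if_same addr0 addrC addKr -/u.
    have [_ hp _] := bkE p; rewrite pb in hp.
    case: ifP => [hu|_]; last by rewrite expr0n /=; case: ifP => // _; exact: sqr_ge0.
    rewrite ifT//; lia.
  rewrite sum_ord_interval; last by rewrite leq_subr hin.
  rewrite subKn; last by rewrite (leq_trans suW)// mulSn addnA addnAC leq_addl.
  by case: (posnP u) => [->|u0]; [rewrite mulr0 sqr_ge0|rewrite bump_mass].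
- suff main (f f' : {ffun 'I_m -> 'I_M.+1}) (b : 'I_m) :
      (forall b', b' != b -> f b' = f' b') -> (f b < f' b)%N ->
      s ^+ 2 * b2 / 2 <= \sum_(p < n | bk p == b) (tnth (th f) p - tnth (th f') p) ^+ 2.
    move=> f f' b ff' nb; case: (ltngtP (f b) (f' b)) => [lt|gt|eq].
    + exact: main.
    + rewrite (eq_bigr (fun p => (tnth (th f') p - tnth (th f) p) ^+ 2)).
        by apply: main => // b' /ff'.
      by move=> p _; rewrite -sqrrN opprB.
    + by move: nb; rewrite -val_eqE /= eq eqxx.
  move=> ff' lt; rewrite -H2.
  set u := nat_of_ord (f b) in lt *; set v := nat_of_ord (f' b) in lt *.
  have vM : (v <= M)%N by exact: (ltn_ord (f' b)).
  have svW := szW _ vM; have suv := bump_size_lt lt.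
  apply: (@le_trans _ _ (\sum_(p < n |
     (r + b.+1 * W - bump_size v <= p < r + b.+1 * W - bump_size u)%N)
     bump_height H v ^+ 2)).
    rewrite sum_ord_interval; last first.
      by rewrite leq_sub2l ?(leq_trans (leq_subr _ _))//; lia.
    have -> : (r + b.+1 * W - bump_size u - (r + b.+1 * W - bump_size v) =
      bump_size v - bump_size u)%N.
      have : (W <= r + b.+1 * W)%N by rewrite mulSn addnA addnAC leq_addl.
      by lia.
    have v0 : (0 < v)%N by lia.
    rewrite -(bump_mass H v0) -mulrA ler_wpM2l ?sqr_ge0// ler_pdivrMr//.
    by rewrite -natrM ler_nat; lia.
  rewrite big_mkcond [leRHS]big_mkcond /=; apply: ler_sum => p _.
  case: ifP => [hp|_]; last by case: ifP => // _; exact: sqr_ge0.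
  have pb : bk p = b.
    rewrite /bk; have -> : (p - r = b * W + (p - r - b * W))%N by rewrite mulSn in hp; lia.
    by rewrite divnMDl// divn_small ?addn0//; rewrite mulSn in hp; lia.
  rewrite pb eqxx !(on _ _ _ pb) -/u -/v ifF; last by lia.
  by rewrite ifT ?addr0; [rewrite opprD addNKr sqrrN|lia].
Qed.

End staircase_lower_bound.

(** * A maximal inequality *)

Section seq_measurability.
Context {R : realType}.
Implicit Types (G : seq R -> R) (phi : seq R -> seq R).

Definition gmeas G := forall n, measurable_fun [set: n.-tuple R] (fun t : n.-tuple R => G t).

(** The output length may depend only on the input length; on each length phi is then a measurable
    map between tuple spaces. *)
Definition seqmeas phi := forall n, exists n' (psi : n.-tuple R -> n'.-tuple R),
  measurable_fun setT psi /\ forall t, (psi t : seq R) = phi t.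

Lemma gmeas_comp G phi : gmeas G -> seqmeas phi -> gmeas (G \o phi).
Proof.
move=> mG mphi n; have [n' [psi [mpsi psiE]]] := mphi n.
have -> : (fun t : n.-tuple R => (G \o phi) t) = (fun t : n'.-tuple R => G t) \o psi.
  by apply/funext => t /=; rewrite psiE.
exact: measurableT_comp (mG n') mpsi.
Qed.

Lemma seqmeas_nth phi (len : nat -> nat) : (forall t, size (phi t) = len (size t)) ->
  (forall i, gmeas (fun t => nth 0 (phi t) i)) -> seqmeas phi.
Proof.
move=> szphi mphi n; exists (len n), (fun t => [tuple nth 0 (phi t) i | i < len n]).
split=> [|t].
  apply/measurable_fun_tnthP => i.
  have -> : (@tnth (len n) R)^~ i \o
      (fun t : n.-tuple R => [tuple nth 0 (phi t) i | i < len n]) =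
      (fun t : n.-tuple R => nth 0 (phi t) i).
    by apply/funext => t /=; rewrite tnth_mktuple.
  exact: mphi.
apply: (@eq_from_nth _ 0); rewrite size_tuple ?szphi ?size_tuple// => i il.
by rewrite -[i]/(val (Ordinal il)) -tnth_nth tnth_mktuple.
Qed.

Lemma gmeas_nth i : gmeas (fun t => nth 0 t i).
Proof.
move=> n; have [ni|ni] := leqP n i; last first.
  by apply: (@tmeas_coord _ n idfun) => //; exact: measurable_id.
rewrite (_ : (fun _ => _) = cst 0); first exact: measurable_cst.
by apply/funext => t; rewrite nth_default// size_tuple.
Qed.

Lemma gmeas_cst c : gmeas (fun=> c).
Proof. by move=> n; exact: measurable_cst. Qed.

Lemma gmeasM G G' : gmeas G -> gmeas G' -> gmeas (fun t => G t * G' t).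
Proof. by move=> mG mG' n; apply: measurable_funM; [exact: mG|exact: mG']. Qed.

Lemma gmeasD G G' : gmeas G -> gmeas G' -> gmeas (fun t => G t + G' t).
Proof. by move=> mG mG' n; apply: measurable_funD; [exact: mG|exact: mG']. Qed.

Lemma seqmeas_take k : seqmeas (take k).
Proof.
apply: (@seqmeas_nth _ (minn k)) => [t|i].
  by rewrite size_take_min.
have [ik|ki] := ltnP i k.
  rewrite (_ : (fun _ => _) = (fun t => nth 0 t i)); first exact: gmeas_nth.
  by apply/funext => t; rewrite nth_take.
rewrite (_ : (fun _ => _) = cst 0); first exact: gmeas_cst.
by apply/funext => t; rewrite nth_default// (leq_trans _ ki)// size_take_min geq_minl.
Qed.

Lemma seqmeas_drop k : seqmeas (drop k).
Proof.
apply: (@seqmeas_nth _ (subn^~ k)) => [t|i]; first by rewrite size_drop.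
rewrite (_ : (fun _ => _) = (fun t => nth 0 t (k + i))); first exact: gmeas_nth.
by apply/funext => t; rewrite nth_drop.
Qed.

Lemma seqmeas_rev : seqmeas rev.
Proof.
move=> n; exists n, (fun t : n.-tuple R => [tuple of rev t]); split=> //.
apply/measurable_fun_tnthP => i.
have -> : (@tnth n R)^~ i \o (fun t : n.-tuple R => [tuple of rev t]) =
    (fun t : n.-tuple R => nth 0 t (n - i.+1)).
  by apply/funext => t /=; rewrite (tnth_nth 0) nth_rev size_tuple.
exact: gmeas_nth.
Qed.

Definition noise (s : R) (ms xs : seq R) := [seq (p.2 - p.1) / s | p <- zip ms xs].

Lemma size_noise s ms xs : size xs = size ms -> size (noise s ms xs) = size ms.
Proof. by move=> sz; rewrite size_map size_zip sz minnn. Qed.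

Lemma seqmeas_noise s ms : seqmeas (noise s ms).
Proof.
apply: (@seqmeas_nth _ (minn (size ms))) => [t|i].
  by rewrite size_map size_zip.
move=> n; have [h|h] := ltnP i (minn (size ms) n); last first.
  rewrite (_ : (fun _ => _) = cst 0); first exact: measurable_cst.
  by apply/funext => t; rewrite nth_default// size_map size_zip size_tuple.
rewrite (_ : (fun _ => _) = (fun t : n.-tuple R => (nth 0 t i - nth 0 ms i) / s)).
  apply: measurable_funM => //; apply: measurable_funB => //.
  exact: gmeas_nth.
apply/funext => t; rewrite (nth_map (0, 0)) ?size_zip ?size_tuple//.
by rewrite nth_zip_cond size_zip size_tuple h.
Qed.

Lemma tmeas_noise s ms G n : gmeas G -> tmeas n (fun xs => (G (noise s ms xs))%:E).
Proof.
move=> mG; apply/measurable_EFinP.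
exact: (gmeas_comp mG (@seqmeas_noise s ms)).
Qed.

(** Uniformity in the mean vector and in its length makes the bound inherited by both parts of a
    split, including cells that are truncated or empty. *)
Definition noise_bounded (s : R) G (a : R) := forall ms,
  (gauss_iter s ms (fun xs => (G (noise s ms xs))%:E) <= a%:E)%E.

(** Independence of the first j noise coordinates from the others: the inner integral over the
    latter does not depend on the former and comes out as a constant. *)
Lemma noise_bounded_split s ms j G G' (a a' : R) :
  gmeas G -> gmeas G' -> (forall z, 0 <= G z) -> (forall z, 0 <= G' z) ->
  noise_bounded s G a -> noise_bounded s G' a' ->
  (gauss_iter s ms (fun xs => (G (take j (noise s ms xs)) *
      G' (drop j (noise s ms xs)))%:E) <= (a * a')%:E)%E.
Proof.
move=> mG mG' G0 G'0 Ga G'a'.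
have a'0 : 0 <= a'.
  rewrite -lee_fin; apply: le_trans (G'a' [::]).
  by rewrite lee_fin.
rewrite -(cat_take_drop j ms) gauss_iter_cat.
set ms1 := take j ms; set ms2 := drop j ms.
set I2 := gauss_iter s ms2 (fun xs => (G' (noise s ms2 xs))%:E).
have I20 : (0 <= I2)%E by apply: gauss_iter_ge0 => xs; rewrite lee_fin.
rewrite (_ : gauss_iter s ms1 _ =
    gauss_iter s ms1 (fun xs => ((G (noise s ms1 xs))%:E * I2)%E)); last first.
  apply: eq_gauss_iter => xs szx; rewrite -gauss_iterZl//.
  - apply: eq_gauss_iter => ys szy.
    (* If j exceeds the length, everything lies in the first part and the second is empty. *)
    have szj : size ms1 = j \/ ms2 = [::].
      rewrite /ms1 /ms2 size_take; case: ltnP => [_|h]; [by left|right].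
      by rewrite drop_oversize.
    have [-> ->] : take j (noise s (ms1 ++ ms2) (xs ++ ys)) = noise s ms1 xs /\
        drop j (noise s (ms1 ++ ms2) (xs ++ ys)) = noise s ms2 ys.
      have nE : noise s (ms1 ++ ms2) (xs ++ ys) = noise s ms1 xs ++ noise s ms2 ys.
        by rewrite /noise zip_cat ?map_cat.
      rewrite nE; case: szj => h.
        by rewrite take_size_cat ?drop_size_cat// size_noise.
      have -> : noise s ms2 ys = [::] by rewrite h; case: (ys).
      have szn : (size (noise s ms1 xs) <= j)%N.
        by rewrite size_noise// size_take_min geq_minl.
      by rewrite cats0 take_oversize ?drop_oversize.
    by rewrite EFinM.
  - by move=> ys; rewrite lee_fin.
  - exact: tmeas_noise.
apply: (@le_trans _ _ (gauss_iter s ms1 (fun xs => a'%:E * (G (noise s ms1 xs))%:E)%E)).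
  apply: le_gauss_iter => //.
  - by move=> xs; rewrite mule_ge0// lee_fin.
  - by move=> xs; rewrite mule_ge0// lee_fin.
  - by apply: tmeas_mul; [exact: tmeas_noise|exact: tmeas_cst].
  - by apply: tmeas_mul; [exact: tmeas_cst|exact: tmeas_noise].
  - by move=> xs _; rewrite muleC lee_wpmul2r// ?lee_fin//; exact: G'a'.
rewrite gauss_iterZl//; last exact: tmeas_noise; last by move=> xs; rewrite lee_fin.
by rewrite mulrC EFinM lee_wpmul2l//; exact: Ga.
Qed.

End seq_measurability.

(** * The exponential factor that controls one cell *)

Section cell_factor.
Context {R : realType}.
Implicit Types (c S m s rho : R) (zs : seq R).

(* The square root of the martingale exp(S^2/(2c))/sqrt c, where c grows by 1
   at each step of the walk S. *)
Definition root_mart c S : R := expR (S ^+ 2 / (4 * c)) / Num.sqrt (Num.sqrt c).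

Lemma root_mart_ge0 c S : 0 <= root_mart c S.
Proof. by rewrite divr_ge0 ?expR_ge0 ?sqrtr_ge0. Qed.

Lemma root_mart_gt0 c S : 0 < c -> 0 < root_mart c S.
Proof. by move=> c0; rewrite divr_gt0 ?expR_gt0 ?sqrtr_gt0. Qed.

Lemma sqr_root_mart c S : 0 < c ->
  root_mart c S ^+ 2 = expR (S ^+ 2 / (2 * c)) / Num.sqrt c.
Proof.
move=> c0; rewrite /root_mart exprMn exprVn sqr_sqrtr ?sqrtr_ge0//; congr (_ / _).
by rewrite expr2 -expRD; congr expR; field; rewrite gt_eqF.
Qed.

Fixpoint run_max c S m zs : R :=
  if zs is z :: zs' then
    run_max (c + 1) (S + z) (Num.max m (root_mart (c + 1) (S + z))) zs'
  else m.

Lemma run_max_ge c S m zs : m <= run_max c S m zs.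
Proof.
elim: zs c S m => [//|z zs IH] c S m /=.
by apply: le_trans (IH _ _ _); rewrite le_max lexx.
Qed.

Lemma run_max_prefix c S m zs d : root_mart c S <= m -> (d <= size zs)%N ->
  root_mart (c + d%:R) (S + \sum_(z <- take d zs) z) <= run_max c S m zs.
Proof.
elim: zs c S m d => [|z zs IH] c S m [|d] // hm hd.
- by rewrite take0 big_nil !addr0.
- by rewrite take0 big_nil !addr0; exact: le_trans hm (run_max_ge _ _ _ _).
- rewrite /= big_cons addrA -natr1 [d%:R + 1]addrC addrA.
  by apply: IH => //; rewrite le_max lexx orbT.
Qed.

Lemma measurable_root_mart c (d : measure_display) (T : measurableType d)
    (S : T -> R) :
  measurable_fun setT S -> measurable_fun setT (fun t => root_mart c (S t)).
Proof.
move=> mS; apply: measurable_funM => //; apply: measurableT_comp => //.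
by apply: measurable_funM => //; exact: measurable_funX.
Qed.

Lemma measurable_run_max n (d : measure_display) (T : measurableType d) c
    (S m : T -> R) (Z : T -> n.-tuple R) :
  measurable_fun setT S -> measurable_fun setT m -> measurable_fun setT Z ->
  measurable_fun setT (fun t => run_max c (S t) (m t) (Z t)).
Proof.
elim: n c S m Z => [|n IH] c S m Z mS mm mZ.
  rewrite (_ : (fun _ => _) = m)//.
  by apply/funext => t; rewrite (tuple0 (Z t)).
have mZi : measurable_fun setT (fun t => thead (Z t)).
  by move/measurable_fun_tnthP : mZ => /(_ ord0).
have mS' : measurable_fun setT (fun t => S t + thead (Z t)) by exact: measurable_funD.
rewrite (_ : (fun _ => _) = (fun t => run_max (c + 1) (S t + thead (Z t))
   (Num.max (m t) (root_mart (c + 1) (S t + thead (Z t)))) [tuple of behead (Z t)])).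
  apply: IH => //.
    by apply: measurable_maxr => //; exact: measurable_root_mart.
  apply: (measurableT_comp (f := fun t : n.+1.-tuple R => [tuple of behead t])) => //.
  exact: measurable_behead.
by apply/funext => t; rewrite [in LHS](tuple_eta (Z t)).
Qed.

Lemma gmeas_run_max c S m : gmeas (run_max c S m).
Proof. by move=> n; apply: (@measurable_run_max n) => //; exact: measurable_id. Qed.

(* The bound m + u^2/m is a potential: replacing m by a larger running maximum
   u' costs 2u' <= m + u'^2/m, and u'^2 is a martingale. *)
Lemma run_max_expectation c S m s ms : 0 < s -> 0 < c -> 0 < m ->
  root_mart c S <= m ->
  (gauss_iter s ms (fun xs => (run_max c S m (noise s ms xs))%:E) <=
   (m + root_mart c S ^+ 2 / m)%:E)%E.
Proof.
move=> s0; elim: ms c S m => [|mu ms IH] c S m c0 m0 hm.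
  by rewrite /= lee_fin lerDl divr_ge0 ?sqr_ge0// ltW.
have rm0 zs c' S' m' : 0 < m' -> 0 <= run_max c' S' m' zs.
  by move=> h; apply: le_trans (run_max_ge _ _ _ _); exact: ltW.
have c10 : 0 < c + 1 by rewrite addr_gt0.
have rmm z : 0 < Num.max m (root_mart (c + 1) (S + z)) by rewrite lt_max m0.
pose f x := (m + root_mart (c + 1) (S + (x - mu) / s) ^+ 2 / m)%:E.
have mf2 : measurable_fun [set: R] (fun x : R => root_mart (c + 1) (S + (x - mu) / s) ^+ 2).
  apply: measurable_funX; apply: measurable_root_mart; apply: measurable_funD => //.
  by apply: measurable_funM => //; exact: measurable_funB.
apply: (@le_trans _ _ (\int[normal_prob mu s]_x f x)%E).
  apply: ge0_le_integral => //.
  - by move=> x _; apply: gauss_iter_ge0 => xs; rewrite lee_fin rm0.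
  - apply: (@measurable_gauss_iter_cons _ s ms
      (fun xs => (run_max c S m (noise s (mu :: ms) xs))%:E)) => [xs|].
      by rewrite lee_fin rm0.
    exact: tmeas_noise (gmeas_run_max _ _ _).
  - by apply/measurable_EFinP; apply: measurable_funD => //; exact: measurable_funM.
  - move=> x _; set z := (x - mu) / s.
    apply: (le_trans (IH (c + 1) (S + z) _ c10 (rmm _) _)).
      by rewrite le_max lexx orbT.
    rewrite lee_fin -/z; set u := root_mart (c + 1) (S + z).
    have [um|mu'] := leP u m; first by rewrite lexx.
    have u0 : 0 < u by exact: lt_trans mu'.
    rewrite expr2 mulfK ?gt_eqF// -(ler_pM2r m0) mulrDl [X in _ <= X]mulrDl.
    by rewrite mulfVK ?gt_eqF//; have := sqr_ge0 (u - m); nra.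
rewrite /f; under eq_integral do rewrite EFinD EFinM.
rewrite ge0_integralD//; last 3 first.
- by move=> x _; rewrite lee_fin ltW.
- by move=> x _; rewrite lee_fin divr_ge0 ?sqr_ge0 ?ltW.
- by apply/measurable_EFinP; exact: measurable_funM.
rewrite integral_cst//=.
have -> : normal_prob mu s [set: R] = 1%E by exact: normal_prob_setT.
rewrite mule1 EFinD leeD2l//.
rewrite ge0_integralZr//; last 3 first.
- exact/measurable_EFinP.
- by move=> x _; rewrite lee_fin sqr_ge0.
- by rewrite lee_fin invr_ge0 ltW.
rewrite EFinM; apply: lee_wpmul2r; first by rewrite lee_fin invr_ge0 ltW.
under eq_integral do rewrite sqr_root_mart//.
by rewrite normal_exp_square// sqr_root_mart.
Qed.

(** For d <= c one has c + d <= 2c, so the maximum scaled by (2c)^(1/4) dominates exp(S_d^2/(8c)).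
    The summand 1 keeps the logarithm nonnegative, and rho is the discount exp(-t^2/8) earned by a
    threshold t. *)
Definition cell_factor rho c zs : R :=
  1 + rho * (Num.sqrt (Num.sqrt (2 * c)) * run_max c 0 (root_mart c 0) zs).

Lemma cell_factor_ge1 rho c zs : 0 <= rho -> 1 <= cell_factor rho c zs.
Proof.
move=> r0; rewrite /cell_factor lerDl !mulr_ge0 ?sqrtr_ge0//.
exact: le_trans (root_mart_ge0 _ _) (run_max_ge _ _ _ _).
Qed.

Lemma gmeas_cell_factor rho c : gmeas (cell_factor rho c).
Proof.
apply: gmeasD; first exact: gmeas_cst.
apply: gmeasM; first exact: gmeas_cst.
by apply: gmeasM; [exact: gmeas_cst|exact: gmeas_run_max].
Qed.

Lemma cell_factor_bounded s rho c : 0 < s -> 0 <= rho -> 0 < c ->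
  noise_bounded s (cell_factor rho c) (1 + 3 * rho).
Proof.
move=> s0 r0 c0 ms.
have sc0 : 0 < Num.sqrt (Num.sqrt c) by rewrite !sqrtr_gt0.
have m0 : 0 < root_mart c 0 by exact: root_mart_gt0.
have rm0 zs : 0 <= run_max c 0 (root_mart c 0) zs.
  exact: le_trans (root_mart_ge0 _ _) (run_max_ge _ _ _ _).
set k := rho * Num.sqrt (Num.sqrt (2 * c)).
have k0 : 0 <= k by rewrite mulr_ge0 ?sqrtr_ge0.
rewrite (_ : gauss_iter s ms _ = gauss_iter s ms (fun xs =>
   1 + k%:E * (run_max c 0 (root_mart c 0) (noise s ms xs))%:E)%E); last first.
  by apply: eq_gauss_iter => xs _; rewrite /cell_factor mulrA EFinD EFinM.
have mrm : tmeas (size ms) (fun xs => (run_max c 0 (root_mart c 0) (noise s ms xs))%:E).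
  exact: tmeas_noise (gmeas_run_max _ _ _).
rewrite gauss_iterD//; last 3 first.
- by move=> xs; rewrite mule_ge0// lee_fin.
- exact: tmeas_cst.
- by apply: tmeas_mul => //; exact: tmeas_cst.
rewrite gauss_iter_cst gauss_iterZl//; last by move=> xs; rewrite lee_fin.
rewrite EFinD leeD2l//.
apply: (@le_trans _ _ (k%:E * (root_mart c 0 + root_mart c 0 ^+ 2 / root_mart c 0)%:E)%E).
  by rewrite lee_wpmul2l//; apply: run_max_expectation.
rewrite -EFinM lee_fin expr2 mulfK ?gt_eqF// /k -mulrA mulrC ler_wpM2r//.
have -> : root_mart c 0 = (Num.sqrt (Num.sqrt c))^-1.
  by rewrite /root_mart expr0n mul0r expR0 div1r.
rewrite sqrtrM// sqrtrM ?sqrtr_ge0//.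
rewrite -mulrA mulrDr mulfV ?gt_eqF//.
(* The maximum started at c^(-1/4) has mean at most twice that value. After scaling this is 2 *
   2^(1/4) <= 3. *)
have h : Num.sqrt (Num.sqrt 2) <= 3 / 2 :> R.
  have -> : 3 / 2 = Num.sqrt (Num.sqrt ((3 / 2) ^+ 4)) :> R.
    rewrite -[4%N]/(2 * 2)%N exprM sqrtr_sqr ger0_norm ?sqr_ge0//.
    by rewrite sqrtr_sqr ger0_norm//; lra.
  by rewrite !ler_wsqrtr//; lra.
lra.
Qed.

(** With g the factor, rho exp(S^2/(8c)) <= g. Taking logarithms gives S^2 <= c (t^2 + 8 ln g): only
    the excess over the threshold is random. *)
Lemma prefix_le_cell_factor (t : R) c zs d : 0 < c -> 0 <= t ->
  (size zs)%:R <= c -> (d <= size zs)%N ->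
  `|\sum_(z <- take d zs) z| <=
  Num.sqrt c * (t + Num.sqrt (8 * ln (cell_factor (expR (- (t ^+ 2 / 8))) c zs))).
Proof.
move=> c0 t0 szc dz; set S := \sum_(z <- _) z; set rho := expR _; set g := cell_factor _ _ _.
have g1 : 1 <= g by apply: cell_factor_ge1; exact: expR_ge0.
have lg0 : 0 <= ln g by exact: ln_ge0.
have d0 : 0 <= d%:R :> R by [].
have dc : d%:R <= c by apply: le_trans szc; rewrite ler_nat.
have cd0 : 0 < c + d%:R by lra.
have h1 : expR (S ^+ 2 / (8 * c)) <=
    Num.sqrt (Num.sqrt (2 * c)) * run_max c 0 (root_mart c 0) zs.
  apply: (@le_trans _ _ (Num.sqrt (Num.sqrt (2 * c)) * root_mart (c + d%:R) S)); last first.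
    rewrite ler_wpM2l ?sqrtr_ge0// -[S]add0r; exact: run_max_prefix.
  rewrite /root_mart mulrCA -[leLHS]mulr1 ler_pM ?expR_ge0//.
    by rewrite ler_expR ler_wpM2l ?sqr_ge0// lef_pV2 ?posrE; lra.
  rewrite ler_pdivlMr ?sqrtr_gt0// mul1r !ler_wsqrtr//; lra.
have h2 : expR (S ^+ 2 / (8 * c) - t ^+ 2 / 8) <= g.
  rewrite expRD mulrC -/rho /g /cell_factor.
  apply: (@le_trans _ _ (rho * (Num.sqrt (Num.sqrt (2 * c)) * run_max c 0 (root_mart c 0) zs))).
    by rewrite ler_wpM2l// expR_ge0.
  by rewrite lerDr.
have h3 : S ^+ 2 / (8 * c) - t ^+ 2 / 8 <= ln g.
  by rewrite -[leLHS]expRK ler_ln ?posrE ?expR_gt0// (lt_le_trans _ g1).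
have h4 : S ^+ 2 <= c * (t ^+ 2 + 8 * ln g).
  have : S ^+ 2 / (8 * c) <= ln g + t ^+ 2 / 8 by lra.
  rewrite ler_pdivrMr; [nra|lra].
set y := Num.sqrt (8 * ln g).
have y2 : y ^+ 2 = 8 * ln g by rewrite sqr_sqrtr// mulr_ge0.
have y0 : 0 <= y by exact: sqrtr_ge0.
rewrite -(@ler_pXn2r _ 2) ?nnegrE ?normr_ge0// ?mulr_ge0 ?sqrtr_ge0 ?addr_ge0//.
rewrite -normrX ger0_norm ?sqr_ge0// exprMn sqr_sqrtr ?(ltW c0)//.
apply: (le_trans h4); rewrite ler_wpM2l ?(ltW c0)// -y2.
have := mulr_ge0 t0 y0; nra.
Qed.

End cell_factor.

(** * Chaining for monotone vectors *)

Section jumps.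
Context {T : eqType}.
Implicit Types (x y : T) (v w : seq T).

Fixpoint jumps_from x v : nat :=
  if v is y :: v' then ((x != y) + jumps_from y v')%N else 0%N.

Definition jumps v : nat := if v is x :: v' then jumps_from x v' else 0%N.

(** If x differs from y, the value has to change somewhere on the way through v. *)
Lemma jumps_from_cat x v y w :
  ((x != y) + jumps_from y w <= jumps_from x (v ++ y :: w))%N.
Proof.
elim: v x => [//|z v IH] x /=.
apply: leq_trans (leq_add (leqnn _) (IH z)); rewrite addnA leq_add2r.
by have [<-|xz] := eqVneq x z; have [xy|xy] := eqVneq x y; case: (z != y).
Qed.

Lemma jumps_cat v w : (jumps v + jumps w <= jumps (v ++ w))%N.
Proof.
case: v => [//|x v]; elim: v x => [|y v IH] x /=; last first.
  by rewrite -addnA leq_add2l; exact: IH.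
by case: w => [//|y w] /=; rewrite leq_addl.
Qed.

Lemma jumps_rcons v x y : jumps (rcons (rcons v x) y) = (jumps (rcons v x) + (x != y))%N.
Proof.
case: v => [|z v] /=; first by rewrite addn0.
by elim: v z => [|w v IH] z /=; rewrite ?addn0 -?addnA// IH.
Qed.

Lemma jumps_rev v : jumps (rev v) = jumps v.
Proof.
elim: v => [//|x [//|y v] IH].
by rewrite rev_cons rev_cons jumps_rcons -rev_cons IH /= addnC eq_sym.
Qed.

End jumps.

Lemma jumps_map (T T' : eqType) (f : T -> T') (v : seq T) :
  (jumps (map f v) <= jumps v)%N.
Proof.
case: v => [//|x v] /=; elim: v x => [//|y v IH] x /=.
by apply: leq_add => //; have [->|] := eqVneq x y; rewrite ?eqxx// leq_b1.
Qed.

Section chaining.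
Context {R : realType}.
Implicit Types (v e w : seq R) (x y t eta : R).

Definition dot v e : R := \sum_(p <- zip v e) p.1 * p.2.
Definition nrm2 v : R := \sum_(x <- v) x ^+ 2.

Lemma dot_cat v w e f : size v = size e -> dot (v ++ w) (e ++ f) = dot v e + dot w f.
Proof. by move=> sz; rewrite /dot zip_cat// big_cat. Qed.

Lemma dot_rev v e : size v = size e -> dot (rev v) (rev e) = dot v e.
Proof.
move=> sz; rewrite /dot -rev_zip//.
by apply: perm_big; rewrite perm_rev.
Qed.

Lemma nrm2_cat v w : nrm2 (v ++ w) = nrm2 v + nrm2 w.
Proof. by rewrite /nrm2 big_cat. Qed.

Lemma nrm2_rev v : nrm2 (rev v) = nrm2 v.
Proof. by apply: perm_big; rewrite perm_rev. Qed.

Lemma nrm2_ge0 v : 0 <= nrm2 v.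
Proof. by apply: sumr_ge0 => x _; exact: sqr_ge0. Qed.

(* Abel summation, with [A] the sum of the terms of [e] already consumed. *)
Lemma abel_le_shift (A K : R) x v e : path >=%R x v -> all (>= 0) (x :: v) ->
  size e = (size v).+1 ->
  (forall d, (d <= size e)%N -> `|A + \sum_(z <- take d e) z| <= K) ->
  `|x * A + dot (x :: v) e| <= x * K.
Proof.
elim: v A x e => [|y v IH] A x [|a e] //= hp /andP[x0 hall] sz hK.
  case: e sz hK => //= _ /(_ 1%N erefl); rewrite /dot /= !big_seq1 /= => hK.
  by rewrite -mulrDr normrM (ger0_norm x0) ler_wpM2l.
have [xy hp'] := andP hp.
have -> : x * A + dot (x :: y :: v) (a :: e) =
  (x - y) * (A + a) + (y * (A + a) + dot (y :: v) e).
  by rewrite /dot /= big_cons /=; ring.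
apply: (le_trans (ler_normD _ _)).
have -> : x * K = (x - y) * K + y * K by ring.
rewrite lerD//.
  rewrite normrM ger0_norm ?subr_ge0// ler_wpM2l ?subr_ge0//.
  by have := hK 1%N erefl; rewrite /= take0 big_seq1.
apply: IH => //; first by case: sz.
by move=> d hd; have := hK d.+1 hd; rewrite /= big_cons addrA.
Qed.

Lemma abel_le (K : R) x v e : path >=%R x v -> all (>= 0) (x :: v) ->
  size e = (size v).+1 ->
  (forall d, (d <= size e)%N -> `|\sum_(z <- take d e) z| <= K) ->
  `|dot (x :: v) e| <= x * K.
Proof.
move=> hp hall sz hK; have := @abel_le_shift 0 K x v e hp hall sz.
by rewrite mulr0 add0r; apply => d hd; rewrite add0r; exact: hK.
Qed.

Fixpoint cell_sum (X : nat -> seq R -> R) (f l : nat) e : R :=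
  if f is f'.+1 then X l (take (4 ^ l) e) + cell_sum X f' l.+1 (drop (4 ^ l) e)
  else 0.

Lemma cell_sum_ge0 X f l e : (forall l zs, 0 <= X l zs) -> 0 <= cell_sum X f l e.
Proof. by move=> X0; elim: f l e => [//|f IH] l e /=; rewrite addr_ge0. Qed.

Lemma path_ge_all x v y w : path >=%R x (v ++ y :: w) ->
  all (fun z => y <= z) (x :: v).
Proof.
elim: v x => [|z v IH] x /=; first by case/andP=> ->.
move=> /andP[zx /IH /= /andP[yz ->]].
by rewrite (le_trans yz zx) yz.
Qed.

(* The cell of length 4^l contributes y (t + sqrt X) with y = x 2^l. When the
   next cell starts at the same value, y is half of the next y, so that the
   terms t y telescope; otherwise a jump pays for t y. *)
Lemma chaining_nonincreasing t eta X f l x v e : 0 <= t -> 0 < eta ->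
  (forall l zs, 0 <= X l zs) ->
  (forall l zs d, (size zs <= 4 ^ l)%N -> (d <= size zs)%N ->
     `|\sum_(z <- take d zs) z| <= 2 ^+ l * (t + Num.sqrt (X l zs))) ->
  path >=%R x v -> all (>= 0) (x :: v) -> size e = (size v).+1 ->
  (3 * (size v).+1 + 4 ^ l <= 4 ^ (l + f))%N ->
  `|dot (x :: v) e| + t * (x * 2 ^+ l) <=
  3 * eta * ((x * 2 ^+ l) ^+ 2 + 4 * nrm2 (x :: v)) +
  (jumps_from x v).+1%:R * (t ^+ 2 / (2 * eta)) + cell_sum X f l e / (4 * eta).
Proof.
move=> t0 eta0 X0 HX; elim: f l x v e => [|f IH] l x v e hp hall sz hsz.
  (* Cells of lengths 4^l, ..., 4^(l+f-1) hold (4^(l+f) - 4^l)/3 entries in all. The size hypothesis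
     says that this suffices, which is impossible for f = 0. *)
  by move: hsz; rewrite addn0; lia.
have x0 : 0 <= x by case/andP: hall.
have amgm a b : a * b <= eta * b ^+ 2 + a ^+ 2 / (4 * eta).
  have -> : eta * b ^+ 2 + a ^+ 2 / (4 * eta) =
    a * b + eta * (b - a / (2 * eta)) ^+ 2 by field; rewrite gt_eqF.
  by rewrite lerDl mulr_ge0 ?sqr_ge0// ltW.
set Y := x * 2 ^+ l.
have Y0 : 0 <= Y by rewrite mulr_ge0// exprn_ge0.
have c0 : 0 <= t ^+ 2 / (2 * eta) by rewrite divr_ge0 ?sqr_ge0// mulr_ge0// ltW.
have tY := amgm t Y.
have half : t ^+ 2 / (4 * eta) = t ^+ 2 / (2 * eta) / 2 by field; rewrite gt_eqF.
rewrite half in tY.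
have etaY : 0 <= eta * Y ^+ 2 by rewrite mulr_ge0 ?sqr_ge0// ltW.
have [small|big] := leqP (size v).+1 (4 ^ l).
  rewrite /= take_oversize ?sz// drop_oversize ?sz//.
  have CS0 : 0 <= cell_sum X f l.+1 [::] / (4 * eta).
    by rewrite divr_ge0 ?cell_sum_ge0// mulr_ge0// ltW.
  rewrite [(X l e + _) / _]mulrDl.
  have h := abel_le hp hall sz (fun d => @HX l e d _).
  have {h} := h _; rewrite sz => /(_ small) h.
  have XY := amgm (Num.sqrt (X l e)) Y; rewrite sqr_sqrtr// in XY.
  have hd : `|dot (x :: v) e| <= Y * t + Y * Num.sqrt (X l e).
    by rewrite -mulrDr /Y -mulrA.
  have j1 : t ^+ 2 / (2 * eta) <= (jumps_from x v).+1%:R * (t ^+ 2 / (2 * eta)).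
    by rewrite ler_peMl// ler1n.
  have nn := mulr_ge0 (ltW eta0) (nrm2_ge0 (x :: v)).
  have -> : 3 * eta * (Y ^+ 2 + 4 * nrm2 (x :: v)) =
    3 * (eta * Y ^+ 2) + 12 * (eta * nrm2 (x :: v)) by ring.
  rewrite [Y * t]mulrC [Y * Num.sqrt _]mulrC in hd.
  lra.
have p4 : (0 < 4 ^ l)%N by rewrite expn_gt0.
pose k := (4 ^ l).-1; have kE : (4 ^ l = k.+1)%N by rewrite prednK.
pose v1 := take k v.
case v2E : (drop k v) => [|y v2].
  by have := size_drop k v; rewrite v2E /=; clear -big kE; lia.
have vE : v = v1 ++ y :: v2 by rewrite -v2E cat_take_drop.
have szv1 : size v1 = k by rewrite size_takel//; clear -big kE; lia.
pose e1 := take (4 ^ l) e; pose e2 := drop (4 ^ l) e.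
have eE : e = e1 ++ e2 by rewrite cat_take_drop.
have sze1 : size e1 = (size v1).+1 by rewrite size_takel ?szv1// sz; clear -big kE; lia.
have sze2 : size e2 = (size v2).+1.
  rewrite size_drop sz vE size_cat szv1 /=; clear -big kE; lia.
move: (hp) (hall); rewrite vE cat_path /= all_cat /=.
move=> /and3P[hp1 hly hp2] /and4P[_ hall1 y0 hall2].
have ge_y : all (fun z => y <= z) (x :: v1).
  by apply: (@path_ge_all _ _ _ v2); rewrite -vE.
have yx : y <= x by case/andP: ge_y.
(* Every entry of the cell is at least y, so the squared norm of the cell pays for the boundary term
   Y2^2 of the next one. *)
have nv1 : 4 ^+ l * y ^+ 2 <= nrm2 (x :: v1).
  have -> : 4 ^+ l * y ^+ 2 = \sum_(z <- x :: v1) y ^+ 2.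
    by rewrite big_const_seq count_predT -[size _]/(size v1).+1 szv1 -kE iter_addr_0
      -[RHS]mulr_natl natrX.
  rewrite /nrm2 big_seq [leRHS]big_seq; apply: ler_sum => z zv.
  by rewrite ler_sqr ?nnegrE// ?(allP ge_y)// (le_trans y0)// (allP ge_y).
set Y2 := y * 2 ^+ l.+1.
have Y2sq : Y2 ^+ 2 <= 4 * nrm2 (x :: v1).
  have -> : Y2 ^+ 2 = 4 * (4 ^+ l * y ^+ 2).
    rewrite /Y2 [2 ^+ l.+1]exprS; have -> : (4 : R) ^+ l = (2 ^+ l) ^+ 2.
      by rewrite exprAC; congr (_ ^+ l); ring.
    by ring.
  by rewrite ler_pM2l.
have hsz2 : (3 * (size v2).+1 + 4 ^ l.+1 <= 4 ^ (l.+1 + f))%N.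
  move: hsz; rewrite vE size_cat szv1 /= addSnnS expnS; clear -kE; lia.
have := IH l.+1 y v2 e2 hp2 _ sze2 hsz2; rewrite /= y0 hall2 => /(_ isT).
rewrite -/Y2 => IH2.
have h1 : `|dot (x :: v1) e1| <= Y * t + Y * Num.sqrt (X l e1).
  rewrite -mulrDr /Y -mulrA; apply: abel_le => //.
    by rewrite /= x0 hall1.
  by move=> d hd; apply: HX => //; rewrite sze1 szv1 kE.
have XY := amgm (Num.sqrt (X l e1)) Y; rewrite sqr_sqrtr// in XY.
have hdot : `|dot (x :: v1 ++ y :: v2) e| <= `|dot (x :: v1) e1| + `|dot (y :: v2) e2|.
  by rewrite {1}eE -cat_cons dot_cat ?ler_normD// sze1.
rewrite /= -/e1 -/e2 [(X l e1 + _) / _]mulrDl.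
have -> : nrm2 (x :: v1 ++ y :: v2) = nrm2 (x :: v1) + nrm2 (y :: v2).
  by rewrite -nrm2_cat.
have hj := jumps_from_cat x v1 y v2.
have hN : eta * Y2 ^+ 2 <= 4 * (eta * nrm2 (x :: v1)).
  by rewrite [leRHS]mulrCA ler_wpM2l// ltW.
have E1 a b : 3 * eta * (a + 4 * b) = 3 * (eta * a) + 12 * (eta * b) by ring.
rewrite !E1 in IH2 *; rewrite mulrDr.
rewrite [Y * t]mulrC [Y * Num.sqrt _]mulrC in h1.
have [xy|xy] := eqVneq x y.
  have YY2 : Y2 = 2 * Y by rewrite /Y2 /Y xy [2 ^+ l.+1]exprS; ring.
  have hj' : (jumps_from y v2).+1%:R * (t ^+ 2 / (2 * eta)) <=
      (jumps_from x (v1 ++ y :: v2)).+1%:R * (t ^+ 2 / (2 * eta)).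
    by rewrite ler_wpM2r// ler_nat ltnS (leq_trans _ hj)// leq_addl.
  have tY2 : t * Y2 = t * Y + t * Y by rewrite YY2; ring.
  lra.
have tY20 : 0 <= t * Y2 by rewrite !mulr_ge0// exprn_ge0.
have hj' : (jumps_from y v2).+1%:R * (t ^+ 2 / (2 * eta)) + t ^+ 2 / (2 * eta) <=
    (jumps_from x (v1 ++ y :: v2)).+1%:R * (t ^+ 2 / (2 * eta)).
  rewrite -{2}[t ^+ 2 / (2 * eta)]mul1r -mulrDl natr1 ler_wpM2r// ler_nat ltnS.
  by move: hj; rewrite xy.
lra.
Qed.

Lemma nonincreasing_block_bound t eta X f v e : 0 <= t -> 0 < eta ->
  (forall l zs, 0 <= X l zs) ->
  (forall l zs d, (size zs <= 4 ^ l)%N -> (d <= size zs)%N ->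
     `|\sum_(z <- take d zs) z| <= 2 ^+ l * (t + Num.sqrt (X l zs))) ->
  sorted >=%R v -> all (>= 0) v -> size e = size v ->
  (3 * size v < 4 ^ f)%N ->
  `|dot v e| <= 15 * eta * nrm2 v +
  (jumps v).+1%:R * (t ^+ 2 / (2 * eta)) + cell_sum X f 0 e / (4 * eta).
Proof.
move=> t0 eta0 X0 HX hs hall sz hsz.
have c0 : 0 <= t ^+ 2 / (2 * eta) by rewrite divr_ge0 ?sqr_ge0// mulr_ge0// ltW.
have CS0 : 0 <= cell_sum X f 0 e / (4 * eta).
  by rewrite divr_ge0 ?cell_sum_ge0// mulr_ge0// ltW.
case: v hs hall sz hsz => [|x v] hs hall sz hsz.
  move/size0nil : sz => e0; rewrite e0 in CS0 *.
  rewrite /dot big_nil normr0 addr_ge0// addr_ge0//.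
    by rewrite mulr_ge0 ?nrm2_ge0// mulr_ge0// ltW.
  by rewrite mulr_ge0.
have := @chaining_nonincreasing t eta X f 0 x v e t0 eta0 X0 HX hs hall sz.
rewrite add0n expn0 addn1 => /(_ hsz); rewrite expr0 mulr1.
have x0 : 0 <= x by case/andP: hall.
have tx := mulr_ge0 t0 x0.
(* The boundary term of the first cell has no earlier cell to pay for it and costs 3 eta x^2; with
   the factor 12 from chaining this gives 15. *)
have xn : eta * x ^+ 2 <= eta * nrm2 (x :: v).
  rewrite ler_wpM2l ?(ltW eta0)// /nrm2 big_cons lerDl; exact: nrm2_ge0.
have -> : 3 * eta * (x ^+ 2 + 4 * nrm2 (x :: v)) =
  3 * (eta * x ^+ 2) + 12 * (eta * nrm2 (x :: v)) by ring.
rewrite -[15 * eta * _]mulrA /=; lra.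
Qed.

End chaining.

(** * From cells to monotone blocks: bounds for the noise term *)

Section blocks.
Context {R : realType}.
Implicit Types (v e w : seq R) (x y t eta s : R) (g : nat -> seq R -> R).

Fixpoint cells_prod g (f l : nat) e : R :=
  if f is f'.+1 then g l (take (4 ^ l) e) * cells_prod g f' l.+1 (drop (4 ^ l) e)
  else 1.

Lemma cells_prod_ge1 g f l e : (forall l zs, 1 <= g l zs) -> 1 <= cells_prod g f l e.
Proof.
by move=> g1; elim: f l e => [//|f IH] l e /=; rewrite mulr_ege1.
Qed.

(** The excesses of the cells add up to the logarithm of a product, whose mean can be bounded factor
    by factor. *)
Lemma cell_sum_ln (c : R) g f l e : (forall l zs, 1 <= g l zs) ->
  cell_sum (fun l zs => c * ln (g l zs)) f l e = c * ln (cells_prod g f l e).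
Proof.
move=> g1; elim: f l e => [|f IH] l e /=; first by rewrite ln1 mulr0.
rewrite IH lnM ?mulrDr// posrE; apply: lt_le_trans ltr01 _ => //.
exact: cells_prod_ge1.
Qed.

Definition fwd_factor t (l : nat) e : R := cell_factor (expR (- (t ^+ 2 / 8))) (4 ^+ l) e.
(** [bwd_block] takes its cells from the end of e, but the second reversal makes each cell be read
    in its original order. The martingale then follows the order of integration in [gauss_iter], and
    no exchange of coordinates is needed. The price is a factor 2 in [bwd_factor_prefix]. *)
Definition bwd_factor t (l : nat) e : R := fwd_factor t l (rev e).
Definition fwd_block t f e : R := cells_prod (fwd_factor t) f 0 e.
Definition bwd_block t f e : R := cells_prod (bwd_factor t) f 0 (rev e).

Lemma fwd_factor_ge1 t l e : 1 <= fwd_factor t l e.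
Proof. by apply: cell_factor_ge1; exact: expR_ge0. Qed.

Lemma bwd_factor_ge1 t l e : 1 <= bwd_factor t l e.
Proof. exact: fwd_factor_ge1. Qed.

Lemma fwd_block_ge1 t f e : 1 <= fwd_block t f e.
Proof. by apply: cells_prod_ge1; exact: fwd_factor_ge1. Qed.

Lemma bwd_block_ge1 t f e : 1 <= bwd_block t f e.
Proof. by apply: cells_prod_ge1; exact: bwd_factor_ge1. Qed.

Lemma fwd_factor_prefix t l e d : 0 <= t -> (size e <= 4 ^ l)%N -> (d <= size e)%N ->
  `|\sum_(z <- take d e) z| <= 2 ^+ l * (t + Num.sqrt (8 * ln (fwd_factor t l e))).
Proof.
move=> t0 sz hd.
have -> : 2 ^+ l = Num.sqrt (4 ^+ l) :> R.
  have -> : (4 : R) ^+ l = (2 ^+ l) ^+ 2 by rewrite exprAC; congr (_ ^+ l); ring.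
  by rewrite sqrtr_sqr ger0_norm// exprn_ge0.
by apply: prefix_le_cell_factor => //; rewrite -natrX ler_nat.
Qed.

Let double_sqrt x : 0 <= x -> 2 * Num.sqrt (8 * x) = Num.sqrt (32 * x).
Proof.
move=> x0; have -> : 32 * x = 2 ^+ 2 * (8 * x) by ring.
by rewrite [RHS]sqrtrM ?sqr_ge0// sqrtr_sqr ger0_norm.
Qed.

(** Weakened to the constants of the backward direction, so that both directions lead to the same
    bound. *)
Lemma fwd_factor_prefix2 t l e d : 0 <= t -> (size e <= 4 ^ l)%N -> (d <= size e)%N ->
  `|\sum_(z <- take d e) z| <= 2 ^+ l * (2 * t + Num.sqrt (32 * ln (fwd_factor t l e))).
Proof.
move=> t0 sz hd; apply: (le_trans (fwd_factor_prefix t0 sz hd)).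
have l0 := ln_ge0 (fwd_factor_ge1 t l e).
rewrite ler_wpM2l ?exprn_ge0// -double_sqrt// lerD//; first by lra.
by have := sqrtr_ge0 (8 * ln (fwd_factor t l e)); lra.
Qed.

(* A suffix sum is a difference of two prefix sums. *)
Lemma bwd_factor_prefix t l e d : 0 <= t -> (size e <= 4 ^ l)%N -> (d <= size e)%N ->
  `|\sum_(z <- take d e) z| <= 2 ^+ l * (2 * t + Num.sqrt (32 * ln (bwd_factor t l e))).
Proof.
move=> t0 sz hd; rewrite /bwd_factor; set e' := rev e.
have l0 := ln_ge0 (fwd_factor_ge1 t l e').
have sz' : (size e' <= 4 ^ l)%N by rewrite size_rev.
have -> : \sum_(z <- take d e) z = \sum_(z <- take (size e') e') z -
    \sum_(z <- take (size e' - d) e') z.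
  rewrite take_size -{1}(cat_take_drop (size e' - d) e') big_cat /= addrAC subrr add0r.
  have -> : drop (size e' - d) e' = rev (take d e).
    by rewrite /e' size_rev drop_rev subKn.
  by apply: perm_big; rewrite perm_sym perm_rev.
have h1 := fwd_factor_prefix t0 sz' (leqnn _).
have h2 := fwd_factor_prefix t0 sz' (leq_subr d _).
rewrite -double_sqrt// -mulrDr mulrCA.
apply: (le_trans (ler_normB _ _)); lra.
Qed.

Lemma dotBl v w e : size v = size w -> size e = size v ->
  dot [seq p.1 - p.2 | p <- zip v w] e = dot v e - dot w e.
Proof.
rewrite /dot; elim: v w e => [|x v IH] [|y w] [|a e] //=.
  by move=> _ _; rewrite !big_nil subr0.
by move=> [szw] [sze]; rewrite !big_cons /= IH//; ring.
Qed.

Definition pos_part v := [seq Num.max 0 x | x <- v].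
Definition neg_part v := [seq Num.max 0 (- x) | x <- v].

Lemma dot_parts v e : size e = size v -> dot v e = dot (pos_part v) e - dot (neg_part v) e.
Proof.
move=> sz; rewrite -dotBl ?size_map//; congr (dot _ e).
elim: v {e sz} => [//|x v IH] /=; rewrite -IH; congr (_ :: _).
by have [x0|x0] := leP 0 x; rewrite /Num.max; case: ltP; lra.
Qed.

Lemma nrm2_parts v : nrm2 v = nrm2 (pos_part v) + nrm2 (neg_part v).
Proof.
rewrite /nrm2 !big_map -big_split; apply: eq_bigr => x _ /=.
have [x0|x0] := leP 0 x.
  by rewrite [X in _ = _ + X ^+ 2]max_l ?expr0n ?addr0//; lra.
by rewrite max_r ?sqrrN ?expr0n ?add0r//; lra.
Qed.

Lemma fwd_bound t eta f v e : 0 <= t -> 0 < eta ->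
  sorted >=%R v -> all (>= 0) v -> size e = size v -> (3 * size v < 4 ^ f)%N ->
  `|dot v e| <= 15 * eta * nrm2 v + (jumps v).+1%:R * (2 * t ^+ 2 / eta) +
    8 / eta * ln (fwd_block t f e).
Proof.
move=> t0 eta0 hs hall sz hsz.
have t20 : 0 <= 2 * t by lra.
have := @nonincreasing_block_bound R (2 * t) eta (fun l zs => 32 * ln (fwd_factor t l zs))
  f v e t20 eta0 _ _ hs hall sz hsz.
rewrite cell_sum_ln; last exact: fwd_factor_ge1.
have -> : (2 * t) ^+ 2 / (2 * eta) = 2 * t ^+ 2 / eta by field; rewrite gt_eqF.
rewrite -/(fwd_block t f e).
have -> : 32 * ln (fwd_block t f e) / (4 * eta) = 8 / eta * ln (fwd_block t f e).
  by field; rewrite gt_eqF.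
apply.
- by move=> l zs; rewrite mulr_ge0// ln_ge0// fwd_factor_ge1.
- by move=> l zs d h1 h2; exact: fwd_factor_prefix2.
Qed.

Lemma bwd_bound t eta f v e : 0 <= t -> 0 < eta ->
  sorted <=%R v -> all (>= 0) v -> size e = size v -> (3 * size v < 4 ^ f)%N ->
  `|dot v e| <= 15 * eta * nrm2 v + (jumps v).+1%:R * (2 * t ^+ 2 / eta) +
    8 / eta * ln (bwd_block t f e).
Proof.
move=> t0 eta0 hs hall sz hsz.
have t20 : 0 <= 2 * t by lra.
have hs' : sorted >=%R (rev v) by rewrite rev_sorted.
have hall' : all (>= 0) (rev v) by rewrite all_rev.
have sz' : size (rev e) = size (rev v) by rewrite !size_rev.
have hsz' : (3 * size (rev v) < 4 ^ f)%N by rewrite size_rev.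
have := @nonincreasing_block_bound R (2 * t) eta (fun l zs => 32 * ln (bwd_factor t l zs))
  f (rev v) (rev e) t20 eta0 _ _ hs' hall' sz' hsz'.
rewrite dot_rev// nrm2_rev jumps_rev cell_sum_ln; last exact: bwd_factor_ge1.
have -> : (2 * t) ^+ 2 / (2 * eta) = 2 * t ^+ 2 / eta by field; rewrite gt_eqF.
rewrite -/(bwd_block t f e).
have -> : 32 * ln (bwd_block t f e) / (4 * eta) = 8 / eta * ln (bwd_block t f e).
  by field; rewrite gt_eqF.
apply.
- by move=> l zs; rewrite mulr_ge0// ln_ge0// bwd_factor_ge1.
- by move=> l zs d h1 h2; exact: bwd_factor_prefix.
Qed.

Definition monotone v := sorted <=%R v || sorted >=%R v.

(** The positive and negative parts decrease towards opposite ends of the block, so one uses the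
    forward and the other the backward cells. Each has at most the jumps of v, which doubles the
    price of a jump. *)
Lemma monotone_block_bound t eta f v e : 0 <= t -> 0 < eta ->
  monotone v -> size e = size v -> (3 * size v < 4 ^ f)%N ->
  `|dot v e| <= 15 * eta * nrm2 v + (jumps v).+1%:R * (4 * t ^+ 2 / eta) +
    8 / eta * (ln (fwd_block t f e) + ln (bwd_block t f e)).
Proof.
move=> t0 eta0 hm sz hsz.
have pos0 : all (>= 0) (pos_part v).
  by apply/allP => _ /mapP[x _ ->]; rewrite le_max lexx.
have neg0 : all (>= 0) (neg_part v).
  by apply/allP => _ /mapP[x _ ->]; rewrite le_max lexx.
have szp : size e = size (pos_part v) by rewrite size_map.
have szn : size e = size (neg_part v) by rewrite size_map.
have hszp : (3 * size (pos_part v) < 4 ^ f)%N by rewrite size_map.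
have hszn : (3 * size (neg_part v) < 4 ^ f)%N by rewrite size_map.
have c0 : 0 <= 2 * t ^+ 2 / eta by rewrite divr_ge0 ?mulr_ge0 ?sqr_ge0// ltW.
have jp : (jumps (pos_part v)).+1%:R * (2 * t ^+ 2 / eta) <=
    (jumps v).+1%:R * (2 * t ^+ 2 / eta).
  by rewrite ler_wpM2r// ler_nat ltnS; exact: jumps_map.
have jn : (jumps (neg_part v)).+1%:R * (2 * t ^+ 2 / eta) <=
    (jumps v).+1%:R * (2 * t ^+ 2 / eta).
  by rewrite ler_wpM2r// ler_nat ltnS; exact: jumps_map.
have -> : (jumps v).+1%:R * (4 * t ^+ 2 / eta) =
  (jumps v).+1%:R * (2 * t ^+ 2 / eta) + (jumps v).+1%:R * (2 * t ^+ 2 / eta).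
  by field; rewrite gt_eqF.
rewrite dot_parts// nrm2_parts [15 * eta * _]mulrDr [8 / eta * _]mulrDr.
apply: (le_trans (ler_normB _ _)).
case/orP: hm => hs.
  have hp : sorted <=%R (pos_part v).
    apply: (homo_sorted (e := <=%R)) hs => x y /= xy.
    by rewrite /= ge_max !le_max lexx /= xy orbT.
  have hn : sorted >=%R (neg_part v).
    apply: (homo_sorted (e := <=%R)) hs => x y /= xy.
    by rewrite /= ge_max !le_max lexx /= lerN2 xy orbT.
  have := bwd_bound t0 eta0 hp pos0 szp hszp.
  have := fwd_bound t0 eta0 hn neg0 szn hszn.
  lra.
have hp : sorted >=%R (pos_part v).
  apply: (homo_sorted (e := >=%R)) hs => x y /= xy.
  by rewrite /= ge_max !le_max lexx /= xy orbT.
have hn : sorted <=%R (neg_part v).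
  apply: (homo_sorted (e := >=%R)) hs => x y /= xy.
  by rewrite /= ge_max !le_max lexx /= lerN2 xy orbT.
have := fwd_bound t0 eta0 hp pos0 szp hszp.
have := bwd_bound t0 eta0 hn neg0 szn hszn.
lra.
Qed.

Fixpoint blocks_prod (G : seq R -> R) (bs : seq nat) e : R :=
  if bs is b :: bs' then G (take b e) * blocks_prod G bs' (drop b e) else 1.

Lemma blocks_prod_ge1 G bs e : (forall e, 1 <= G e) -> 1 <= blocks_prod G bs e.
Proof.
by move=> g1; elim: bs e => [//|b bs IH] e /=; rewrite mulr_ege1.
Qed.

Lemma blocks_bound t eta f bs v e : 0 <= t -> 0 < eta ->
  size v = sumn bs -> size e = sumn bs -> all monotone (reshape bs v) ->
  all (fun b => 3 * b < 4 ^ f)%N bs ->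
  `|dot v e| <= 15 * eta * nrm2 v + (jumps v + size bs)%:R * (4 * t ^+ 2 / eta) +
    8 / eta * (ln (blocks_prod (fwd_block t f) bs e) +
               ln (blocks_prod (bwd_block t f) bs e)).
Proof.
move=> t0 eta0; have c0 : 0 <= 4 * t ^+ 2 / eta.
  by rewrite divr_ge0 ?mulr_ge0 ?sqr_ge0// ltW.
elim: bs v e => [|b bs IH] v e szv sze hm hb.
  move/size0nil: szv => ->; move/size0nil: sze => ->.
  by rewrite /dot /nrm2 !big_nil normr0 /= ln1 !(mulr0, addr0, add0r, mul0r).
rewrite /= in szv sze hm hb *; case/andP: hm => hm1 hm2; case/andP: hb => hb1 hb2.
have szv1 : size (take b v) = b by rewrite size_takel// szv leq_addr.
have sze1 : size (take b e) = b by rewrite size_takel// sze leq_addr.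
have szv2 : size (drop b v) = sumn bs by rewrite size_drop szv addKn.
have sze2 : size (drop b e) = sumn bs by rewrite size_drop sze addKn.
have IH' := IH _ _ szv2 sze2 hm2 hb2.
have sze1' : size (take b e) = size (take b v) by rewrite szv1.
have hb1' : (3 * size (take b v) < 4 ^ f)%N by rewrite szv1.
have h1 := monotone_block_bound t0 eta0 hm1 sze1' hb1'.
have F1 e' : 1 <= fwd_block t f e' by exact: fwd_block_ge1.
have B1 e' : 1 <= bwd_block t f e' by exact: bwd_block_ge1.
have pos x : 1 <= x -> x \is Num.pos by rewrite posrE; exact: lt_le_trans.
rewrite !lnM ?pos ?blocks_prod_ge1//.
have hd : `|dot v e| <= `|dot (take b v) (take b e)| + `|dot (drop b v) (drop b e)|.
  rewrite -{1}(cat_take_drop b v) -{1}(cat_take_drop b e) dot_cat ?ler_normD//.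
have -> : nrm2 v = nrm2 (take b v) + nrm2 (drop b v) by rewrite -nrm2_cat cat_take_drop.
have hj : (jumps (take b v)).+1%:R * (4 * t ^+ 2 / eta) +
    (jumps (drop b v) + size bs)%:R * (4 * t ^+ 2 / eta) <=
    (jumps v + (size bs).+1)%:R * (4 * t ^+ 2 / eta).
  rewrite -mulrDl -natrD ler_wpM2r// ler_nat.
  by have := jumps_cat (take b v) (drop b v); rewrite cat_take_drop; clear; lia.
move: hd h1 IH' hj; clear; lra.
Qed.

Lemma gmeas_cells_prod g f l : (forall l, gmeas (g l)) -> gmeas (cells_prod g f l).
Proof.
move=> mg; elim: f l => [|f IH] l /=; first exact: gmeas_cst.
apply: gmeasM; first exact: (gmeas_comp (mg l) (seqmeas_take _)).
exact: (gmeas_comp (IH _) (seqmeas_drop _)).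
Qed.

Lemma gmeas_fwd_block t f : gmeas (fwd_block t f).
Proof. by apply: gmeas_cells_prod => l; exact: gmeas_cell_factor. Qed.

Lemma gmeas_bwd_factor t l : gmeas (bwd_factor t l).
Proof. exact: (gmeas_comp (gmeas_cell_factor _ _) seqmeas_rev). Qed.

Lemma gmeas_bwd_block t f : gmeas (bwd_block t f).
Proof.
apply: (gmeas_comp (G := cells_prod (bwd_factor t) f 0) _ seqmeas_rev).
by apply: gmeas_cells_prod => l; exact: gmeas_bwd_factor.
Qed.

Lemma gmeas_blocks_prod G bs : gmeas G -> gmeas (blocks_prod G bs).
Proof.
move=> mG; elim: bs => [|b bs IH] /=; first exact: gmeas_cst.
apply: gmeasM; first exact: (gmeas_comp mG (seqmeas_take _)).
exact: (gmeas_comp IH (seqmeas_drop _)).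
Qed.

Lemma fwd_factor_bounded s t l : 0 < s ->
  noise_bounded s (fwd_factor t l) (1 + 3 * expR (- (t ^+ 2 / 8))).
Proof.
by move=> s0; apply: cell_factor_bounded; rewrite ?expR_ge0// exprn_gt0.
Qed.

Lemma fwd_block_bounded s t f : 0 < s ->
  noise_bounded s (fwd_block t f) ((1 + 3 * expR (- (t ^+ 2 / 8))) ^+ f).
Proof.
move=> s0; suff main l : noise_bounded s (cells_prod (fwd_factor t) f l)
    ((1 + 3 * expR (- (t ^+ 2 / 8))) ^+ f) by exact: main.
elim: f l => [|f IH] l ms.
  by rewrite gauss_iter_cst.
rewrite exprS; apply: (noise_bounded_split _ _ (G := fwd_factor t l)
  (G' := cells_prod (fwd_factor t) f l.+1)).
- exact: gmeas_cell_factor.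
- by apply: gmeas_cells_prod => l'; exact: gmeas_cell_factor.
- by move=> z; apply: le_trans ler01 (fwd_factor_ge1 _ _ _).
- by move=> z; apply: le_trans ler01 (cells_prod_ge1 _ _ _ _) => *; exact: fwd_factor_ge1.
- exact: fwd_factor_bounded.
- exact: IH.
Qed.

Lemma bwd_block_bounded s t f : 0 < s ->
  noise_bounded s (bwd_block t f) ((1 + 3 * expR (- (t ^+ 2 / 8))) ^+ f).
Proof.
move=> s0; suff main l : noise_bounded s (fun z => cells_prod (bwd_factor t) f l (rev z))
    ((1 + 3 * expR (- (t ^+ 2 / 8))) ^+ f) by exact: main.
elim: f l => [|f IH] l ms.
  by rewrite gauss_iter_cst.
rewrite exprSr; set K := (4 ^ l)%N.
(* In the original order the first cell of the reversed list is the final stretch, so the split is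
   at size ms - 4^l; truncation gives 0 when the cell covers the whole list. *)
rewrite (_ : gauss_iter s ms _ = gauss_iter s ms (fun xs =>
  (cells_prod (bwd_factor t) f l.+1 (rev (take (size ms - K) (noise s ms xs))) *
   fwd_factor t l (drop (size ms - K) (noise s ms xs)))%:E)); last first.
  apply: eq_gauss_iter => xs sz; congr EFin.
  rewrite /= mulrC /bwd_factor take_rev revK drop_rev size_noise//.
apply: (noise_bounded_split _ _ (G' := fwd_factor t l)
  (G := fun z => cells_prod (bwd_factor t) f l.+1 (rev z))).
- apply: (gmeas_comp (G := cells_prod (bwd_factor t) f l.+1) _ seqmeas_rev).
  by apply: gmeas_cells_prod => l'; exact: gmeas_bwd_factor.
- exact: gmeas_cell_factor.
- by move=> z; apply: le_trans ler01 (cells_prod_ge1 _ _ _ _) => *; exact: bwd_factor_ge1.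
- by move=> z; apply: le_trans ler01 (fwd_factor_ge1 _ _ _).
- exact: IH.
- exact: fwd_factor_bounded.
Qed.

Lemma blocks_prod_bounded s G (a : R) bs : gmeas G -> (forall e, 1 <= G e) ->
  noise_bounded s G a -> noise_bounded s (blocks_prod G bs) (a ^+ size bs).
Proof.
move=> mG G1 Ga; elim: bs => [|b bs IH] ms.
  by rewrite gauss_iter_cst.
rewrite exprS; apply: (noise_bounded_split _ _ (G := G) (G' := blocks_prod G bs)) => //.
- exact: gmeas_blocks_prod.
- by move=> z; apply: le_trans ler01 (G1 _).
- by move=> z; apply: le_trans ler01 (blocks_prod_ge1 _ _ _).
Qed.

End blocks.

(** * Near least squares estimators *)

Section near_least_squares.
Context {R : realType}.
Implicit Types (n : nat) (delta : R).

Lemma measurable_sqdist n (a : n.-tuple R) :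
  measurable_fun setT (fun x : n.-tuple R => sqdist x a).
Proof.
apply: measurable_sum => i; apply: measurable_funX; apply: measurable_funB => //.
exact: measurable_tnth.
Qed.

(** Choosing the first index that is good enough makes the choice measurable: a preimage is a
    countable union of sets where index i works and no smaller one does. *)
Lemma near_minimizer_seq n (t : nat -> n.-tuple R) delta : 0 < delta ->
  exists that : n.-tuple R -> n.-tuple R, measurable_fun setT that /\
    forall x, (exists i, that x = t i) /\
      (forall j, sqdist x (that x) <= sqdist x (t j) + delta).
Proof.
move=> d0.
pose E i := [set x : n.-tuple R | forall j, sqdist x (t i) <= sqdist x (t j) + delta].
have mE i : measurable (E i).
  have -> : E i = \bigcap_j ((fun x : n.-tuple R =>
      sqdist x (t j) + delta - sqdist x (t i)) @^-1` `[0, +oo[).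
    apply/seteqP; split=> x /=.
      by move=> h j _; rewrite /= in_itv /= andbT subr_ge0.
    by move=> h j; have := h j I; rewrite /= in_itv /= andbT subr_ge0.
  apply: bigcapT_measurable => j; rewrite -[X in measurable X]setTI.
  apply: (measurable_funB (measurable_funD (@measurable_sqdist n (t j))
    (measurable_cst delta)) (@measurable_sqdist n (t i))) => //.
have exE x : exists i, `[< E i x >].
  pose A := [set sqdist x (t i) | i in [set: nat]].
  have A0 : has_inf A.
    split; first by exists (sqdist x (t 0%N)), 0%N.
    by exists 0 => _ [i _ <-]; apply: sumr_ge0 => j _; exact: sqr_ge0.
  have [_ [i _ <-] hi] := inf_adherent d0 A0.
  exists i; apply/asboolP => j; apply: (le_trans (ltW hi)).
  rewrite lerD2r; apply: ge_inf; first by case: A0.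
  by exists j.
pose that x := t (ex_minn (exE x)).
exists that; split; last first.
  move=> x; split; first by exists (ex_minn (exE x)).
  by rewrite /that; case: ex_minnP => i /asboolP.
move=> _ B mB; rewrite setTI.
have -> : that @^-1` B = \bigcup_(i in [set i | B (t i)])
    (E i `&` \bigcap_(j in [set j | (j < i)%N]) ~` E j).
  apply/seteqP; split=> x /=.
    rewrite /that; case: ex_minnP => i /asboolP Ei mini Bi.
    exists i => //; split=> // j /= ji Ej.
    by have /mini : `[< E j x >] by [apply/asboolP]; rewrite leqNgt ji.
  move=> [i Bi [Ei nE]]; rewrite /that; case: ex_minnP => k /asboolP Ek mink.
  have ki : (k <= i)%N by apply: mink; exact/asboolP.
  have [ik|ki'] := eqVneq k i; first by rewrite ik.
  by exfalso; apply: (nE k) => //=; rewrite ltn_neqAle ki' ki.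
apply: bigcup_measurable => i _; apply: measurableI => //.
apply: bigcap_measurableType => j _; exact: measurableC.
Qed.

(** Rounding down to multiples of 1/(N+1) is nondecreasing, so closure under entrywise nondecreasing
    maps makes the rational points of Theta dense in it. One half of delta is spent on rounding, the
    other on the choice among these countably many points. *)
Lemma near_least_squares n (Theta : set (n.-tuple R)) delta : 0 < delta ->
  Theta !=set0 ->
  (forall (h : R -> R), {homo h : x y / x <= y} ->
     forall th, Theta th -> Theta (map_tuple h th)) ->
  exists that : n.-tuple R -> n.-tuple R, measurable_fun setT that /\
    forall x, Theta (that x) /\
      (forall th, Theta th -> sqdist x (that x) <= sqdist x th + delta).
Proof.
move=> d0 [th0 Th0] Hh.
pose toR (q : n.-tuple rat) : n.-tuple R := map_tuple ratr q.
pose rnd (N : nat) (x : R) : R := (Num.floor (x * N.+1%:R))%:~R / N.+1%:R.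
pose rndq (N : nat) (x : R) : rat := (Num.floor (x * N.+1%:R))%:~R / N.+1%:R.
have N0 N : (0 : R) < N.+1%:R by rewrite ltr0n.
have rndE N x : ratr (rndq N x) = rnd N x.
  by rewrite /rndq fmorph_div /= ratr_int ratr_nat.
have rnd_homo N : {homo rnd N : x y / x <= y}.
  move=> x y xy; rewrite ler_pM2r ?invr_gt0// ler_int; apply: le_floor.
  by rewrite ler_pM2r.
have rnd_err N x : `|rnd N x - x| <= N.+1%:R^-1.
  have h1 : (Num.floor (x * N.+1%:R))%:~R <= x * N.+1%:R by exact: floor_le.
  have h2 : x * N.+1%:R < (Num.floor (x * N.+1%:R))%:~R + 1.
    by have := floorD1_gt (x * N.+1%:R); rewrite intrD.
  rewrite distrC ger0_norm; last by rewrite subr_ge0 ler_pdivrMr.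
  rewrite -(ler_pM2r (N0 N)) mulVf ?gt_eqF// mulrBl mulfVK ?gt_eqF//; lra.
have toR_rnd N th : toR (map_tuple (rndq N) th) = map_tuple (rnd N) th.
  by apply: eq_from_tnth => i; rewrite !tnth_map rndE.
(* Codes that name no rational point of Theta are sent to th0, so the whole sequence stays in
   Theta. *)
pose t i := if unpickle i is Some q then
  (if `[< Theta (toR q) >] then toR q else th0) else th0.
have Tt i : Theta (t i).
  by rewrite /t; case: unpickle => // q; case: asboolP.
have d20 : 0 < delta / 2 by rewrite divr_gt0.
have [that [mthat that_lse]] := near_minimizer_seq t d20.
exists that; split=> // x; have [[i ->] hx] := that_lse x; split=> // th Tth.
(* If |c - b| <= e <= 1, then (a - c)^2 <= (a - b)^2 + (2|a - b| + 1) e; S collects the coefficients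
   of e. *)
pose S := \sum_(i < n) (2 * `|tnth x i - tnth th i| + 1).
have S0 : 0 <= S by apply: sumr_ge0 => j _; rewrite addr_ge0// mulr_ge0.
pose N := Num.bound (S / (delta / 2)).
have hN : S / N.+1%:R <= delta / 2.
  rewrite ler_pdivrMr// mulrC -ler_pdivrMr//.
  have /archi_boundP/ltW h : 0 <= S / (delta / 2) by rewrite divr_ge0// ltW.
  by apply: (le_trans h); rewrite ler_nat.
have [j tj] : exists j, t j = map_tuple (rnd N) th.
  exists (pickle (map_tuple (rndq N) th)); rewrite /t pickleK toR_rnd.
  by case: asboolP => // -[]; apply: Hh => //; exact: rnd_homo.
apply: (le_trans (hx j)); rewrite tj.
suff h : sqdist x (map_tuple (rnd N) th) <= sqdist x th + S / N.+1%:R.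
  rewrite [delta in leRHS]splitr addrA lerD2r; apply: (le_trans h).
  by rewrite lerD2l.
rewrite /sqdist /S mulr_suml -big_split /=; apply: ler_sum => k _.
rewrite tnth_map; set a := tnth x k; set b := tnth th k.
have hb := rnd_err N b; set e := N.+1%:R^-1 in hb *.
have e1 : e <= 1 by rewrite invf_le1// ler1n.
set c := rnd N b in hb *.
have -> : (a - c) ^+ 2 = (a - b) ^+ 2 - 2 * ((a - b) * (c - b)) + (c - b) ^+ 2 by ring.
have h1 : - ((a - b) * (c - b)) <= `|a - b| * e.
  apply: (le_trans (ler_norm _)); rewrite normrN normrM ler_wpM2l//.
have h2 : (c - b) ^+ 2 <= e.
  rewrite -[(c - b) ^+ 2]ger0_norm ?sqr_ge0// normrX expr2.
  apply: (@le_trans _ _ (e * 1)); last by rewrite mulr1.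
  by apply: ler_pM => //; exact: le_trans e1.
have -> : (2 * `|a - b| + 1) * e = 2 * (`|a - b| * e) + e by ring.
lra.
Qed.

End near_least_squares.

(** * Unimodal vectors *)

Section partition.
Context {A : eqType}.

Lemma constant_blocks (u : seq A) : exists bs : seq nat,
  [/\ sumn bs = size u, (size bs <= (jumps u).+1)%N, all (ltn 0) bs &
      forall I x y, I \in reshape bs u -> x \in I -> y \in I -> x = y].
Proof.
elim: u => [|x u [bs [sumE szE pos cst]]]; first by exists [::]; split.
case: u sumE szE cst => [|y u] sumE szE cst.
  exists [:: 1%N]; split=> // I a b; rewrite /= inE => /eqP ->.
  by rewrite !inE => /eqP -> /eqP ->.
case: bs sumE szE pos cst => [|b bs] //= sumE szE /andP[b0 pos] cst.
have [xy|xy] := eqVneq x y.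
  exists (b.+1 :: bs); split=> //=.
  - by rewrite addSn sumE.
  - move=> I a c; rewrite inE => /orP[/eqP ->|hI]; last first.
      by apply: cst; rewrite inE hI orbT.
    have yb : y \in take b (y :: u) by case: (b) b0 => //= b' _; rewrite inE eqxx.
    have h z : z \in x :: take b (y :: u) -> z = y.
      rewrite inE => /orP[/eqP ->//|hz].
      by apply: (cst _ z y _ hz yb); rewrite inE eqxx.
    by move=> /h -> /h ->.
exists [:: 1, b & bs]%N; split=> //=.
- by rewrite add1n sumE.
- by rewrite b0.
- move=> I a c; rewrite inE ?take0 ?drop0 => /orP[/eqP ->|hI]; last exact: cst.
  by rewrite !inE => /eqP -> /eqP ->.
Qed.

End partition.

Lemma jumps_pair (A B C : eqType) (f : A -> B) (g : A -> C) (s : seq A) :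
  (jumps [seq (f i, g i) | i <- s] <= jumps (map f s) + jumps (map g s))%N.
Proof.
case: s => [//|x s] /=; elim: s x => [//|y s IH] x /=.
rewrite addnACA; apply: leq_add (IH y).
by rewrite xpair_eqE negb_and; case: (f x != f y).
Qed.

(** Each jump raises the integer value by at least 1. *)
Lemma jumps_nondecreasing (f : nat -> nat) (n : nat) :
  {homo f : i j / (i <= j)%N} -> (jumps (map f (iota 0 n.+1)) <= f n - f 0)%N.
Proof.
move=> fh.
suff gen p : (jumps_from (f p) (map f (iota p.+1 n)) <= f (p + n)%N - f p)%N.
  exact: (gen 0%N).
elim: n p => [//|n IH] p.
rewrite -[jumps_from _ _]/((f p != f p.+1) + jumps_from (f p.+1) (map f (iota p.+2 n)))%N.
have h1 : (f p <= f p.+1)%N by apply: fh.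
have h2 : (f p.+1 <= f (p.+1 + n))%N by apply: fh; rewrite leq_addr.
have h3 := IH p.+1; rewrite -addSnnS.
move: h1 h2 h3; case: (eqVneq (f p) (f p.+1)) => h /=; lia.
Qed.

Lemma reshape_iota (bs : seq nat) (p n : nat) (I : seq nat) :
  I \in reshape bs (iota p n) -> I = [::] \/
  exists q b, [/\ I = iota q b.+1, (p <= q)%N & (q + b.+1 <= p + n)%N].
Proof.
elim: bs p n => [|b bs IH] p n //=; rewrite inE => /orP[/eqP ->|].
  rewrite take_iota; case h : (minn b n) => [|m]; first by left.
  by right; exists p, m; split=> //; rewrite leq_add2l -h geq_minr.
rewrite drop_iota => /IH[->|[q [m [-> pq qm]]]]; first by left.
right; exists q, m; split=> //; lia.
Qed.

Section unimodal.
Context {R : realType}.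
Implicit Types (n k : nat).

Lemma unimodal_homo n k (h : R -> R) (th : n.-tuple R) :
  {homo h : x y / x <= y} -> unimodal_k k th -> unimodal_k k (map_tuple h th).
Proof.
move=> hh [a [l [mu [ha1 ha2 hl [hmu1 hmu2] hv]]]].
exists a, l, (h \o mu); split=> //.
  by split=> j h1 h2 /=; apply: hh; [exact: hmu1|exact: hmu2].
by move=> j i jk hi; rewrite tnth_map (hv j).
Qed.

Lemma unimodal_piece n k (a : nat -> nat) (i : nat) : a 0%N = 0%N -> a k = n -> (i < n)%N ->
  exists2 j, (1 <= j <= k)%N & (a j.-1 < i.+1 <= a j)%N.
Proof.
move=> a0 ak ilt.
have ex : exists j, (i.+1 <= a j)%N by exists k; rewrite ak.
case: (ex_minnP ex) => j ij jmin.
have j0 : (0 < j)%N by case: (j) ij => //; rewrite a0.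
exists j; first by rewrite j0 jmin// ak.
rewrite ij andbT ltnS leqNgt; apply/negP => h.
by have := jmin _ h; lia.
Qed.

(** A jump can occur only at one of the k - 1 interior breakpoints of the representation, so the
    list of jump positions injects into the list of these. *)
Lemma unimodal_jumps n k (th : n.-tuple R) : unimodal_k k th -> (jumps th <= k.-1)%N.
Proof.
move=> [a [l [mu [[a0 ak] ha2 hl _ hv]]]].
have k0 : (0 < k)%N by lia.
pose J := [seq i <- iota 1 n.-1 | nth 0 th i.-1 != nth 0 th i].
have JE : jumps th = size J.
  rewrite /J size_filter; move: (size_tuple th).
  case: (tval th) => [|x v] <- //=.
  have gen p (s : seq R) y : jumps_from y s =
      count (fun i => nth 0 (y :: s) (i - p.+1) != nth 0 (y :: s) (i - p)) (iota p.+1 (size s)).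
    elim: s p y => [//|z s IH] p y /=.
    rewrite subnn subSnn /= (IH p.+1 z); congr (_ + _)%N.
    apply: eq_in_count => i; rewrite mem_iota => /andP[h1 h2] /=.
    have e1 : nth 0 [:: y, z & s] (i - p.+1) = nth 0 (z :: s) (i - p.+2).
      by have -> : (i - p.+1 = (i - p.+2).+1)%N by lia.
    have e2 : nth 0 [:: y, z & s] (i - p) = nth 0 (z :: s) (i - p.+1).
      by have -> : (i - p = (i - p.+1).+1)%N by lia.
    by rewrite e1 e2.
  rewrite (gen 0%N v x); apply: eq_count => i.
  by rewrite subn0 subn1.
have -> : k.-1 = size (map a (iota 1 k.-1)) by rewrite size_map size_iota.
rewrite JE; apply: uniq_leq_size; first by rewrite filter_uniq// iota_uniq.
move=> i; rewrite mem_filter mem_iota => /andP[hne hi].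
have i1 : (0 < i)%N by case/andP: hi.
have ilt : (i < n)%N by lia.
have ilt' : (i.-1 < n)%N by lia.
have [j jk hj] := unimodal_piece a0 ak ilt'.
have : (i <= a j)%N by lia.
rewrite leq_eqVlt => /orP[/eqP iaj|lt].
  apply/mapP; exists j => //; rewrite mem_iota; case/andP: jk => j1 jk.
  rewrite j1 /=; suff : (j != k)%N by lia.
  by apply/negP => /eqP jk'; move: iaj; rewrite jk' ak; lia.
exfalso; move/negP: hne; apply; apply/eqP.
have h1 := hv j (Ordinal ilt') jk hj; rewrite (tnth_nth 0) /= in h1.
have := hv j (Ordinal ilt) jk; rewrite (tnth_nth 0) /= => ->; last by lia.
by rewrite h1.
Qed.

(* The mode is cut off after its piece, so that both sides are monotone. *)
Lemma unimodal_mode n k (th : n.-tuple R) : unimodal_k k th ->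
  exists m, [/\ (m <= n)%N, sorted <=%R (take m th), sorted >=%R (drop m th) &
    ((k <= 2)%N -> monotone th)].
Proof.
move=> [a [l [mu [[a0 ak] ha2 hl [hmu1 hmu2] hv]]]].
have a_homo i j : (i <= j <= k)%N -> (a i <= a j)%N.
  case/andP; elim: j => [|j IH] ij jk; first by move: ij; rewrite leqn0 => /eqP ->.
  move: ij; rewrite leq_eqVlt => /orP[/eqP ->//|]; rewrite ltnS => ij.
  by apply: leq_trans (IH ij (ltnW jk)) (ha2 _ jk).
have up i : (i.+1 < a l)%N -> (i.+1 < n)%N -> nth 0 th i <= nth 0 th i.+1.
  move=> il iN; have iN' := ltnW iN.
  have [j jk hj] := unimodal_piece a0 ak iN'.
  have [j' jk' hj'] := unimodal_piece a0 ak iN.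
  have e1 := hv j (Ordinal iN') jk hj; have e2 := hv j' (Ordinal iN) jk' hj'.
  rewrite (tnth_nth 0) /= in e1; rewrite (tnth_nth 0) /= in e2; rewrite e1 e2.
  have jj' : (j <= j')%N.
    by rewrite leqNgt; apply/negP => h; have := @a_homo j' j.-1; lia.
  have j'l : (j' <= l)%N.
    by rewrite leqNgt; apply/negP => h; have := @a_homo l j'.-1; lia.
  have j1 : (1 <= j)%N by lia.
  clear - hmu1 jj' j'l j1; elim: j' jj' j'l => [|q IH] jq ql; first by lia.
  move: jq; rewrite leq_eqVlt => /orP[/eqP ->//|]; rewrite ltnS => jq.
  by apply: (le_trans (IH jq (ltnW ql))); apply: hmu1 => //; lia.
have down i : (a l.-1 <= i)%N -> (i.+1 < n)%N -> nth 0 th i.+1 <= nth 0 th i.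
  move=> il iN; have iN' := ltnW iN.
  have [j jk hj] := unimodal_piece a0 ak iN'.
  have [j' jk' hj'] := unimodal_piece a0 ak iN.
  have e1 := hv j (Ordinal iN') jk hj; have e2 := hv j' (Ordinal iN) jk' hj'.
  rewrite (tnth_nth 0) /= in e1; rewrite (tnth_nth 0) /= in e2; rewrite e1 e2.
  have jj' : (j <= j')%N.
    by rewrite leqNgt; apply/negP => h; have := @a_homo j' j.-1; lia.
  have lj : (l <= j)%N.
    by rewrite leqNgt; apply/negP => h; have := @a_homo j l.-1; lia.
  have j'k : (j' <= k)%N by lia.
  clear - hmu2 jj' lj j'k; elim: j' jj' j'k => [|q IH] jq qk; first by move: jq; rewrite leqn0 => /eqP ->.
  move: jq; rewrite leq_eqVlt => /orP[/eqP ->//|]; rewrite ltnS => jq.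
  by apply: le_trans (IH jq (ltnW qk)); apply: hmu2 => //; lia.
have aln : (a l <= n)%N by rewrite -ak; apply: a_homo; lia.
have all1 : (a l.-1 <= a l)%N by apply: a_homo; lia.
have up_all m : (m <= a l)%N -> sorted <=%R (take m th).
  move=> ml; apply/(sortedP 0) => i; rewrite size_takel ?size_tuple; last by lia.
  by move=> im; rewrite !nth_take; [apply: up; lia|lia|lia].
have down_all m : (a l.-1 <= m)%N -> sorted >=%R (drop m th).
  move=> ml; apply/(sortedP 0) => i; rewrite size_drop size_tuple => im.
  by rewrite !nth_drop addnS; apply: down; lia.
exists (a l); split=> // [||k2].
- exact: up_all.
- exact: down_all.
(* With at most two pieces, the peak piece is the last one or the first one. *)
apply/orP; have [l2|l1] := leqP 2 l.
  left; have -> : (th : seq R) = take (a l) th; last exact: up_all.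
  have -> : l = k by lia.
  by rewrite ak take_oversize// size_tuple.
right; have -> : (th : seq R) = drop 0 th by rewrite drop0.
apply: down_all; have -> : l = 1%N by lia.
by rewrite a0.
Qed.

End unimodal.

(** * Deterministic ingredients of the upper bound *)

Section upper_bound.
Context {R : realType}.
Implicit Types (n k : nat) (s : R).

Lemma monotone_map (h : R -> R) (v : seq R) : {homo h : x y / x <= y} ->
  monotone v -> monotone (map h v).
Proof.
move=> hh /orP[hs|hs]; apply/orP; [left|right].
  by apply: (homo_sorted (e := <=%R)) hs.
by apply: (homo_sorted (e := >=%R)) hs => x y /= /hh.
Qed.

Lemma monotone_take_drop (v : seq R) p b : monotone v -> monotone (take b (drop p v)).
Proof.
move=> /orP[hs|hs]; apply/orP; [left|right];
  by apply: take_sorted; exact: drop_sorted.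
Qed.

(** [bs] is chosen before th': the blocks depend on the estimate only through the cut m. For fixed m
    they are deterministic, and the moment bounds for the noise apply. In the count, one of the
    final 2 is due to the cut at m, the other to having one block more than cuts. *)
Lemma wedge_blocks n (th : n.-tuple R) (w m : nat) : (0 < n)%N -> (0 < w)%N ->
  exists bs : seq nat, [/\ sumn bs = n, (size bs <= jumps th + n %/ w + 2)%N,
    all (fun b => b <= w)%N bs &
    forall (th' : n.-tuple R) s, 0 < s ->
      monotone (take m th') -> monotone (drop m th') ->
      all monotone (reshape bs
        [seq (nth 0 th' i - nth 0 th i) / s | i <- iota 0 n])].
Proof.
move=> n0 w0.
(* Cutting where the label changes makes th constant on each block, of length
   at most w, on one side of m. *)
pose lab i := (nth 0 th i, ((i %/ w)%N, nat_of_bool (m <= i)%N)).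
have [bs [sumE szE pos cst]] := constant_blocks [seq lab i | i <- iota 0 n].
rewrite size_map size_iota in sumE.
have blockE I i j : I \in reshape bs (iota 0 n) -> i \in I -> j \in I -> lab i = lab j.
  move=> hI hi hj; apply: (cst (map lab I)).
  - by rewrite -map_reshape; apply: map_f.
  - exact: map_f.
  - exact: map_f.
have small I : I \in reshape bs (iota 0 n) -> (size I <= w)%N.
  move=> hI; have [->//|[q [b [IE _ _]]]] := reshape_iota hI.
  have : lab q = lab (q + b)%N.
    by apply: (blockE I) => //; rewrite IE mem_iota; lia.
  rewrite /lab => -[_ + _]; rewrite IE size_iota => e.
  have h1 := leq_trunc_div q w; have h2 := ltn_ceil (q + b) w0.
  by rewrite -e mulSn in h2; lia.
exists bs; split=> //.
- apply: (leq_trans szE); rewrite addn2 ltnS.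
  have e1 : map (fun i => nth 0 th i) (iota 0 n) = th.
    by rewrite map_nth_iota0 ?size_tuple// take_oversize// size_tuple.
  have := jumps_pair (fun i => nth 0 th i)
    (fun i => ((i %/ w)%N, nat_of_bool (m <= i)%N)) (iota 0 n).
  rewrite -/lab e1 => h1.
  have h2 := jumps_pair (fun i => (i %/ w)%N) (fun i => nat_of_bool (m <= i)%N) (iota 0 n).
  have nE : n = n.-1.+1 by rewrite prednK.
  have h3 : (jumps (map (fun i => (i %/ w)%N) (iota 0 n)) <= n %/ w)%N.
    rewrite {1}nE; apply: leq_trans (jumps_nondecreasing _ _) _.
      by move=> i j ij; exact: leq_div2r.
    by apply: (leq_trans (leq_subr _ _)); apply: leq_div2r; rewrite leq_pred.
  have h4 : (jumps (map (fun i => nat_of_bool (m <= i)%N) (iota 0 n)) <= 1)%N.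
    rewrite nE; apply: leq_trans (jumps_nondecreasing _ _) _.
      by move=> i j ij; case: (leqP m i) => // mi; rewrite (leq_trans mi ij).
    by apply: (leq_trans (leq_subr _ _)); case: (m <= _)%N.
  apply: (leq_trans h1); rewrite -addn1 -addnA leq_add2l.
  by apply: (leq_trans h2); exact: leq_add.
- apply/allP => b.
  rewrite -(@reshapeKl _ bs (iota 0 n)) ?size_iota ?sumE//.
  by move=> /mapP[I hI ->]; exact: small.
- move=> th' s s0 hm1 hm2.
  rewrite -map_reshape all_map; apply/allP => I hI /=.
  have [->//|[q [b [IE _ qb]]]] := reshape_iota hI.
  have qI : q \in I by rewrite IE mem_iota; lia.
  have -> : [seq (nth 0 th' i - nth 0 th i) / s | i <- I] =
      map (fun x => (x - nth 0 th q) / s) (map (fun i => nth 0 th' i) I).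
    rewrite -map_comp; apply/eq_in_map => i iI /=.
    by have [-> _ _] := blockE _ _ _ hI iI qI.
  apply: monotone_map => [x y xy|]; first by rewrite ler_pM2r ?invr_gt0// lerB.
  rewrite IE map_nth_iota; last by rewrite size_tuple; lia.
  have [mq|qm] := leqP m q.
    have -> : drop q th' = drop (q - m) (drop m th') by rewrite drop_drop subnK.
    exact: monotone_take_drop.
  have qbm : (q + b < m)%N.
    have lI : (q + b)%N \in I by rewrite IE mem_iota; lia.
    have [_ _] := blockE _ _ _ hI qI lI.
    by rewrite leqNgt qm /=; case: (leqP m (q + b)).
  have -> : take b.+1 (drop q th') = take b.+1 (drop q (take m th')).
    rewrite -{1}(cat_take_drop m th') drop_cat.
    have szm : (q + b < size (take m th'))%N by rewrite size_take_min size_tuple; lia.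
    rewrite ifT; last by lia.
    by rewrite takel_cat// size_drop; lia.
  exact: monotone_take_drop.
Qed.

(** The basic inequality of least squares, in units of s: insert x = th + s e and that = th + s v
    and cancel the norm of e. *)
Lemma near_lse_bound n s (x th that : n.-tuple R) (e v : seq R) : 0 < s ->
  e = noise s th x ->
  v = [seq (nth 0 that i - nth 0 th i) / s | i <- iota 0 n] ->
  sqdist x that <= sqdist x th + s ^+ 2 ->
  [/\ size e = n, sqdist that th = s ^+ 2 * nrm2 v & nrm2 v <= 2 * dot v e + 1].
Proof.
move=> s0 -> -> hx.
have eE : noise s th x = [seq (nth 0 x i - nth 0 th i) / s | i <- iota 0 n].
  apply: (@eq_from_nth _ 0); rewrite ?size_noise ?size_map ?size_iota ?size_tuple//.
  move=> i iN; rewrite (nth_map (0, 0)); last by rewrite size_zip !size_tuple minnn.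
  by rewrite nth_zip ?size_tuple//= (nth_map 0%N) ?size_iota// nth_iota// add0n.
rewrite eE size_map size_iota.
have sumE (F : nat -> R) : \sum_(i <- iota 0 n) F i = \sum_(i < n) F i.
  by rewrite -[in LHS](subn0 n) big_mkord.
have nE : nrm2 [seq (nth 0 that i - nth 0 th i) / s | i <- iota 0 n] =
    \sum_(i < n) ((nth 0 that i - nth 0 th i) / s) ^+ 2.
  by rewrite /nrm2 big_map sumE.
have dE : dot [seq (nth 0 that i - nth 0 th i) / s | i <- iota 0 n]
     [seq (nth 0 x i - nth 0 th i) / s | i <- iota 0 n] =
    \sum_(i < n) ((nth 0 that i - nth 0 th i) / s) * ((nth 0 x i - nth 0 th i) / s).
  by rewrite /dot zip_map big_map sumE.
rewrite nE dE; split=> //.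
  rewrite /sqdist mulr_sumr; apply: eq_bigr => i _; rewrite !(tnth_nth 0).
  by field; rewrite gt_eqF.
rewrite -(ler_pM2l (exprn_gt0 2 s0)) mulrDr mulr1 !mulr_sumr -lerBlDl.
move: hx; rewrite /sqdist -lerBlDl -sumrB; apply: le_trans.
rewrite -sumrB; apply: ler_sum => i _; rewrite !(tnth_nth 0).
rewrite le_eqVlt; apply/orP; left; apply/eqP.
by field; rewrite gt_eqF.
Qed.

(** Tangent line of ln at exp a, weakened by 1. Since it is linear in x, a positive factor at the
    random mode can be bounded by the sum over all candidate modes before integrating. *)
Lemma ln_le_affine (a x : R) : 0 < x -> ln x <= a + x * expR (- a).
Proof.
move=> x0; have y0 : 0 < x * expR (- a) by rewrite mulr_gt0 ?expR_gt0.
have := @le_ln1Dx R (x * expR (- a) - 1).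
rewrite addrCA subrr addr0 lnM ?posrE ?expR_gt0// expRK => h.
have : ln x + - a <= x * expR (- a) - 1 by apply: h; lra.
lra.
Qed.

End upper_bound.

(** * The upper bound with a list of candidate modes *)

Section minimax_upper_bound.
Context {R : realType}.
Implicit Types (n k : nat) (s : R).

(** Mean of the noise factors when rho = 1/f: at most e^3 for the f cells of a block, hence at most
    e^(6k) for 2k blocks. *)
Lemma noise_bounded_exp_pow (f j k : nat) : (0 < f)%N -> (j <= 2 * k)%N ->
  ((1 + 3 * f%:R^-1) ^+ f) ^+ j <= expR (6 * k%:R) :> R.
Proof.
move=> f0 jk; have f0' : (0 : R) < f%:R by rewrite ltr0n.
have q0 : (0 : R) <= f%:R^-1 by rewrite invr_ge0 ltW.
have h : (1 + 3 * f%:R^-1) ^+ f <= expR 3 :> R.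
  apply: (@le_trans _ _ (expR (3 * f%:R^-1) ^+ f)).
    apply: lerXn2r; rewrite ?nnegrE ?expR_ge0 ?expR_ge1Dx//.
  by rewrite -expRM_natl mulrCA mulfV ?gt_eqF// mulr1.
apply: (@le_trans _ _ (expR 3 ^+ j)).
  apply: lerXn2r; rewrite ?nnegrE ?expR_ge0//.
rewrite -expRM_natl ler_expR.
have : (j%:R : R) <= 2 * k%:R by rewrite -natrM ler_nat.
lra.
Qed.

Lemma minimax_risk_le n k s (Ms : seq nat) : 0 < s -> (1 <= k <= n)%N ->
  (0 < size Ms)%N ->
  (forall th : n.-tuple R, unimodal_k k th -> exists2 m, m \in Ms &
     monotone (take m th) /\ monotone (drop m th)) ->
  (minimax_risk s (@Theta_wedge R n k) <=
   (s ^+ 2 * ((64 * 60 * 8) * (k%:R * ln ((trunc_log 4 (n %/ k).+1).+2)%:R) +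
     (64 * 60) * (ln (size Ms)%:R + 6 * k%:R) + (64 * 60 + 2)))%:E)%E.
Proof.
move=> s0 /andP[k1 kn] Ms0 modes.
(* As w > n/k, the multiples of w make fewer than k cuts, so there are at most 2k blocks. As w <
   4^(f-1), f cells cover a block of length w. *)
set w := (n %/ k).+1; set f := (trunc_log 4 w).+2.
have n0 : (0 < n)%N by exact: leq_trans k1 kn.
have f1 : (1 : R) <= f%:R by rewrite ler1n.
have f0 : (0 : R) < f%:R by exact: lt_le_trans f1.
have lf0 : 0 <= ln f%:R :> R by exact: ln_ge0.
pose t : R := Num.sqrt (8 * ln f%:R).
have t0 : 0 <= t by exact: sqrtr_ge0.
have t2 : t ^+ 2 = 8 * ln f%:R by rewrite sqr_sqrtr// mulr_ge0.
have rhoE : expR (- (t ^+ 2 / 8)) = f%:R^-1.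
  have -> : t ^+ 2 / 8 = ln f%:R by rewrite t2; field.
  by rewrite expRN lnK.
have s20 : 0 < s ^+ 2 by exact: exprn_gt0.
have Theta0 : @Theta_wedge R n k !=set0.
  exists [tuple of nseq n 0]; apply: (@constant_unimodal _ _ _ 0) => // i.
  by rewrite tnth_nseq.
have [that [mthat that_lse]] := near_least_squares s20 Theta0
  (fun h hh th => @unimodal_homo R n k h th hh).
apply: (@le_trans _ _ (ereal_sup [set risk s that theta | theta in @Theta_wedge R n k])).
  by apply: ereal_inf_lbound; exists that.
apply: ge_ereal_sup => _ [th Tth <-].
have [bs bsP] := choice (fun m => @wedge_blocks R n th w m n0 isT).
have szbs m : (size (bs m) <= 2 * k)%N.
  have [_ h _ _] := bsP m; apply: (leq_trans h).
  have := unimodal_jumps Tth.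
  have : (n %/ w < k)%N by rewrite ltn_divLR// mulnC ltn_ceil.
  by move: k1; clear; lia.
have bsf m : all (fun b => 3 * b < 4 ^ f)%N (bs m).
  have [_ _ /allP h _] := bsP m; apply/allP => b /h bw.
  have : (w < 4 ^ (trunc_log 4 w).+1)%N by exact: trunc_log_ltn.
  by rewrite /f [(4 ^ _.+2)%N]expnS; move: bw; clear; lia.
(* The estimator's cut m is random: [pointwise] below bounds the loss by a sum
   over all candidates, after weighting by exp(-a), a = ln |Ms| + 6k. *)
pose F m e := blocks_prod (fwd_block t f) (bs m) e.
pose B m e := blocks_prod (bwd_block t f) (bs m) e.
have F1 m e : 1 <= F m e by apply: blocks_prod_ge1; exact: fwd_block_ge1.
have B1 m e : 1 <= B m e by apply: blocks_prod_ge1; exact: bwd_block_ge1.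
have F0 m e : 0 <= F m e by exact: le_trans ler01 _.
have B0 m e : 0 <= B m e by exact: le_trans ler01 _.
have M0 : (0 : R) < (size Ms)%:R by rewrite ltr0n.
pose a : R := ln (size Ms)%:R + 6 * k%:R.
have mF m : gmeas (F m) by exact: gmeas_blocks_prod (gmeas_fwd_block _ _).
have mB m : gmeas (B m) by exact: gmeas_blocks_prod (gmeas_bwd_block _ _).
have bF m : noise_bounded s (F m) (expR (6 * k%:R)).
  move=> ms; apply: le_trans (blocks_prod_bounded (bs m) (gmeas_fwd_block t f)
    (fwd_block_ge1 t f) (fwd_block_bounded t f s0) ms) _.
  by rewrite lee_fin rhoE; exact: noise_bounded_exp_pow.
have bB m : noise_bounded s (B m) (expR (6 * k%:R)).
  move=> ms; apply: le_trans (blocks_prod_bounded (bs m) (gmeas_bwd_block t f)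
    (bwd_block_ge1 t f) (bwd_block_bounded t f s0) ms) _.
  by rewrite lee_fin rhoE; exact: noise_bounded_exp_pow.
pose c0 : R := s ^+ 2 * ((64 * 60 * 8) * (k%:R * ln f%:R) + (64 * 60) * a + 2).
pose c1 : R := s ^+ 2 * ((32 * 60) * expR (- a)).
have a0 : 0 <= a by rewrite addr_ge0// ?mulr_ge0// ln_ge0// ler1n.
have c00 : 0 <= c0.
  apply: mulr_ge0; first exact: ltW.
  have h1 : 0 <= k%:R * ln f%:R :> R by rewrite mulr_ge0.
  by move: h1 a0; clear; lra.
have c10 : 0 <= c1 by rewrite !mulr_ge0// ?expR_ge0// ltW.
have pointwise xs : size xs = n ->
    sqdist (that (to_tuple n xs)) th <= c0 + c1 *
      \sum_(m <- Ms) (F m (noise s th xs) + B m (noise s th xs)).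
  move=> szx; pose x : n.-tuple R := to_tuple n xs.
  have xE : xs = x.
    by rewrite /x /to_tuple /insubd insubT ?szx.
  rewrite {2 3}xE -/x; set e := noise s th x.
  pose v := [seq (nth 0 (that x) i - nth 0 th i) / s | i <- iota 0 n].
  have [Tx lse] := that_lse x.
  have [sze -> hv] := near_lse_bound s0 (erefl e) (erefl v) (lse _ Tth).
  have [m mMs [hm1 hm2]] := modes _ Tx.
  have [bsum _ _ /(_ (that x) s s0 hm1 hm2) hmono] := bsP m.
  have szv : size v = sumn (bs m) by rewrite bsum size_map size_iota.
  have sze' : size e = sumn (bs m) by rewrite bsum.
  (* With eta = 1/60 the quadratic term is 15 eta |v|^2 = |v|^2/4; doubled by the basic inequality
     it is half of the left-hand side and is absorbed. *)
  have eta0 : (0 : R) < 60^-1 by rewrite invr_gt0.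
  have hb := blocks_bound t0 eta0 szv sze' hmono (bsf m).
  have hj : (jumps v + size (bs m) <= 4 * k)%N.
    have := jumps_pair (fun i => nth 0 (that x) i) (fun i => nth 0 th i) (iota 0 n).
    have nthE (u : n.-tuple R) : [seq nth 0 u i | i <- iota 0 n] = u.
      by rewrite map_nth_iota0 ?size_tuple// take_oversize// size_tuple.
    rewrite !nthE.
    set vv := [seq (nth 0 (that x) i, nth 0 th i) | i <- iota 0 n].
    have h1 : (jumps v <= jumps vv)%N.
      have -> : v = map (fun p : R * R => (p.1 - p.2) / s) vv by rewrite -map_comp.
      exact: jumps_map.
    move=> h2; have h3 := leq_trans h1 h2.
    have h4 : (jumps v <= k.-1 + k.-1)%N.
      by apply: (leq_trans h3); apply: leq_add; exact: unimodal_jumps.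
    by have := szbs m; move: h4 k1; clear; lia.
  have hj' : (jumps v + size (bs m))%:R * (4 * t ^+ 2 / 60^-1) <=
      4 * k%:R * ((32 * 60) * ln f%:R).
    rewrite t2 invrK; have -> : 4 * (8 * ln f%:R) * 60 = (32 * 60) * ln f%:R :> R by ring.
    by rewrite ler_wpM2r ?mulr_ge0// -natrM ler_nat.
  have lF := ln_le_affine a (lt_le_trans ltr01 (F1 m e)).
  have lB := ln_le_affine a (lt_le_trans ltr01 (B1 m e)).
  set SS := \sum_(m <- Ms) _.
  have hSS : F m e + B m e <= SS.
    rewrite /SS (big_rem m)//= lerDl; apply: sumr_ge0 => m' _; exact: addr_ge0.
  have hSS' := ler_wpM2r (expR_ge0 (- a)) hSS.
  have -> : c0 + c1 * SS = s ^+ 2 * ((64 * 60 * 8) * (k%:R * ln f%:R) +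
      (64 * 60) * a + 2 + (32 * 60) * expR (- a) * SS) by rewrite /c0 /c1; ring.
  rewrite ler_pM2l//.
  rewrite -/(F m e) -/(B m e) in hb.
  have hd := le_trans (ler_norm _) hb.
  have e1 : 15 * 60^-1 * nrm2 v = nrm2 v / 4 by field.
  rewrite e1 in hd.
  rewrite mulrDl in hSS'.
  have e2 : (32 * 60) * expR (- a) * SS = (32 * 60) * (SS * expR (- a)) by ring.
  rewrite e2.
  have hd' : dot v e <= nrm2 v / 4 + 4 * k%:R * ((32 * 60) * ln f%:R) +
      8 / 60^-1 * (ln (F m e) + ln (B m e)).
    by apply: (le_trans hd); rewrite lerD2r lerD2l.
  rewrite invrK in hd'.
  move: hv hd' lF lB hSS'; clear.
  move: (nrm2 v) (dot v e) (ln f%:R) (ln (F m e)) (ln (B m e)) => N D lf lF lB.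
  move: (F m e * expR (- a)) (B m e * expR (- a)) (SS * expR (- a)) (k%:R) => fm bm ss K.
  rewrite (_ : 4 * K * ((32 * 60) * lf) = (128 * 60) * (K * lf)); last by ring.
  by move: (K * lf) => Kf; lra.
have mFB m : tmeas (size th) (fun xs => ((F m (noise s th xs))%:E + (B m (noise s th xs))%:E)%E).
  by apply: tmeas_add; exact: tmeas_noise.
apply: (@le_trans _ _ (gauss_iter s th (fun xs => c0%:E + c1%:E *
    \sum_(m <- Ms) ((F m (noise s th xs))%:E + (B m (noise s th xs))%:E))%E)).
  apply: le_gauss_iter.
  - by move=> xs; rewrite lee_fin; apply: sumr_ge0 => i _; exact: sqr_ge0.
  - move=> xs; rewrite adde_ge0 ?lee_fin// mule_ge0 ?lee_fin//.
    by apply: sume_ge0 => m _; rewrite adde_ge0 ?lee_fin.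
  - by rewrite size_tuple; exact: (tmeas_loss predT).
  - apply: tmeas_add; first exact: tmeas_cst.
    apply: tmeas_mul; first exact: tmeas_cst.
    exact: emeasurable_sum.
  - move=> xs; rewrite size_tuple => szx.
    by rewrite sumEFin -EFinM -EFinD lee_fin; exact: pointwise.
rewrite gauss_iterD; last 4 first.
- by move=> xs; rewrite lee_fin.
- move=> xs; rewrite mule_ge0 ?lee_fin//.
  by apply: sume_ge0 => m _; rewrite adde_ge0 ?lee_fin.
- exact: tmeas_cst.
- apply: tmeas_mul; first exact: tmeas_cst.
  exact: emeasurable_sum.
rewrite gauss_iter_cst gauss_iterZl//; last 2 first.
- by move=> xs; apply: sume_ge0 => m _; rewrite adde_ge0 ?lee_fin.
- exact: emeasurable_sum.
rewrite gauss_iter_sum; last 2 first.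
- by move=> m xs; rewrite adde_ge0 ?lee_fin.
- exact: mFB.
have hsum : (\sum_(m <- Ms) gauss_iter s th
    (fun xs => (F m (noise s th xs))%:E + (B m (noise s th xs))%:E)%E <=
    ((size Ms)%:R * (2 * expR (6 * k%:R)))%:E)%E.
  apply: (@le_trans _ _ (\sum_(m <- Ms) (2 * expR (6 * k%:R))%:E)%E).
    apply: lee_sum => m _; rewrite gauss_iterD.
    - by rewrite mulr_natl mulr2n EFinD; apply: leeD; [exact: bF|exact: bB].
    - by move=> xs; rewrite lee_fin.
    - by move=> xs; rewrite lee_fin.
    - exact: tmeas_noise.
    - exact: tmeas_noise.
  rewrite sumEFin big_const_seq count_predT iter_addr_0.
  by rewrite [(size Ms)%:R * _]mulr_natl.
apply: (@le_trans _ _ (c0%:E + c1%:E * ((size Ms)%:R * (2 * expR (6 * k%:R)))%:E)%E).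
  by rewrite leeD2l// lee_wpmul2l// lee_fin.
rewrite -EFinM -EFinD lee_fin.
have -> : c0 + c1 * ((size Ms)%:R * (2 * expR (6 * k%:R))) =
    s ^+ 2 * ((64 * 60 * 8) * (k%:R * ln f%:R) + (64 * 60) * a + 2 +
      (32 * 60) * expR (- a) * ((size Ms)%:R * (2 * expR (6 * k%:R)))).
  by rewrite /c0 /c1; ring.
rewrite ler_pM2l//.
(* The weight exp(-a) cancels both the number of candidates and the mean e^(6k) of each factor, so
   the union over the modes costs a constant besides a itself. *)
have -> : (32 * 60) * expR (- a) * ((size Ms)%:R * (2 * expR (6 * k%:R))) = (64 * 60).
  have -> : expR (- a) = (size Ms)%:R^-1 * (expR (6 * k%:R))^-1.
    by rewrite /a opprD expRD !expRN lnK.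
  by field; rewrite !gt_eqF// ?expR_gt0.
by rewrite /a; lra.
Qed.

End minimax_upper_bound.

(** * The constant class, numerical bounds and the rate *)

Section constant_upper_bound.
Context {R : realType}.
Implicit Types (n : nat) (s : R).

Lemma dot_nseq n (c : R) (e : seq R) : size e = n ->
  dot (nseq n c) e = c * \sum_(z <- e) z.
Proof.
rewrite /dot; elim: n e => [|n IH] [|a e] //=.
  by rewrite !big_nil mulr0.
by move=> [sz]; rewrite !big_cons /= IH// mulrDr.
Qed.

(** The general bound would leave a factor of order lnln(16n). For constant vectors only the total
    sum of the noise matters, so a single cell of length n suffices. *)
Lemma minimax_risk_le_constant n s : 0 < s -> (0 < n)%N ->
  (minimax_risk s (@Theta_wedge R n 1) <= (s ^+ 2 * 130)%:E)%E.
Proof.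
move=> s0 n0; have n0' : (0 : R) < n%:R by rewrite ltr0n.
have s20 : 0 < s ^+ 2 by exact: exprn_gt0.
have Theta0 : @Theta_wedge R n 1 !=set0.
  exists [tuple of nseq n 0]; apply: (@constant_unimodal _ _ _ 0) => // i.
  by rewrite tnth_nseq.
have [that [mthat that_lse]] := near_least_squares s20 Theta0
  (fun h hh th => @unimodal_homo R n 1 h th hh).
apply: (@le_trans _ _ (ereal_sup [set risk s that theta | theta in @Theta_wedge R n 1])).
  by apply: ereal_inf_lbound; exists that.
apply: ge_ereal_sup => _ [th Tth <-].
have cstE (u : n.-tuple R) : Theta_wedge 1 u -> exists c, forall i, (i < n)%N -> nth 0 u i = c.
  move=> [a [l [mu [[a0 a1] _ _ _ hv]]]]; exists (mu 1%N) => i iN.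
  by have := hv 1%N (Ordinal iN) isT; rewrite (tnth_nth 0) /= a0 a1 => ->.
have [c thc] := cstE _ Tth.
(* Threshold t = 0, hence rho = 1 and mean at most 4; then 130 = 2 + 32 * 4. *)
pose G := cell_factor (expR (- ((0 : R) ^+ 2 / 8))) (n%:R : R).
have G1 e : 1 <= G e by apply: cell_factor_ge1; exact: expR_ge0.
have mG : gmeas G by exact: gmeas_cell_factor.
have bG : noise_bounded s G 4.
  move=> ms; apply: (le_trans (cell_factor_bounded s0 _ n0' ms)); first exact: expR_ge0.
  by rewrite expr0n mul0r oppr0 expR0 lee_fin; lra.
have pointwise xs : size xs = n ->
    sqdist (that (to_tuple n xs)) th <= s ^+ 2 * 2 + s ^+ 2 * 32 * G (noise s th xs).
  move=> szx; pose x : n.-tuple R := to_tuple n xs.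
  have xE : xs = x by rewrite /x /to_tuple /insubd insubT ?szx.
  rewrite {2}xE -/x; set e := noise s th x.
  pose v := [seq (nth 0 (that x) i - nth 0 th i) / s | i <- iota 0 n].
  have [Tx lse] := that_lse x; have [c' thc'] := cstE _ Tx.
  have [sze -> hv] := near_lse_bound s0 (erefl e) (erefl v) (lse _ Tth).
  set d := (c' - c) / s.
  have vE : v = nseq n d.
    apply: (@eq_from_nth _ 0); rewrite size_map size_iota ?size_nseq// => i iN.
    rewrite (nth_map 0%N) ?size_iota// nth_iota// add0n nth_nseq iN.
    by rewrite thc// thc'.
  have nE : nrm2 v = n%:R * d ^+ 2.
    by rewrite vE /nrm2 big_nseq iter_addr_0 mulr_natl.
  rewrite vE dot_nseq// -vE nE in hv; rewrite nE.
  have hn : (size e)%:R <= n%:R :> R by rewrite sze.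
  have := @prefix_le_cell_factor R 0 n%:R e (size e) n0' (lexx _) hn (leqnn _).
  rewrite take_size add0r -/(G e); set S := \sum_(z <- e) z in hv * => hS.
  have lG : 0 <= ln (G e) by exact: ln_ge0.
  have lG' : ln (G e) <= G e.
    have := @le_ln1Dx R (G e - 1); rewrite addrCA subrr addr0 => h.
    by have := G1 e; have : ln (G e) <= G e - 1 by [apply: h; have := G1 e; lra]; lra.
  have hS2 : S ^+ 2 <= n%:R * (8 * ln (G e)).
    rewrite -[leLHS]ger0_norm ?sqr_ge0// normrX.
    rewrite -[X in _ <= X]sqr_sqrtr ?mulr_ge0// sqrtrM//.
    by rewrite lerXn2r ?nnegrE ?mulr_ge0 ?sqrtr_ge0.
  rewrite -mulrA -mulrDr ler_pM2l//.
  have h1 : 2 * (d * S) <= n%:R * d ^+ 2 / 2 + 2 * (S ^+ 2 / n%:R).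
    have -> : n%:R * d ^+ 2 / 2 + 2 * (S ^+ 2 / n%:R) =
      2 * (d * S) + n%:R / 2 * (d - 2 * S / n%:R) ^+ 2 by field; rewrite gt_eqF.
    by rewrite lerDl mulr_ge0 ?sqr_ge0// divr_ge0.
  have h2 : S ^+ 2 / n%:R <= 8 * ln (G e).
    by rewrite ler_pdivrMr// mulrC.
  lra.
have GE0 xs : (0 <= (G (noise s th xs))%:E)%E by rewrite lee_fin; exact: le_trans ler01 _.
have k0 : 0 <= s ^+ 2 * 32 by rewrite mulr_ge0// ltW.
have k2 : 0 <= s ^+ 2 * 2 by rewrite mulr_ge0// ltW.
apply: (@le_trans _ _ (gauss_iter s th (fun xs =>
    (s ^+ 2 * 2)%:E + (s ^+ 2 * 32)%:E * (G (noise s th xs))%:E)%E)).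
  apply: le_gauss_iter.
  - by move=> xs; rewrite lee_fin; apply: sumr_ge0 => i _; exact: sqr_ge0.
  - by move=> xs; apply: adde_ge0 => //; exact: mule_ge0.
  - by rewrite size_tuple; exact: (tmeas_loss predT).
  - apply: tmeas_add; first exact: tmeas_cst.
    by apply: tmeas_mul; [exact: tmeas_cst|exact: tmeas_noise].
  - by move=> xs; rewrite size_tuple => szx; rewrite -EFinM -EFinD lee_fin pointwise.
rewrite gauss_iterD; last 4 first.
- by [].
- by move=> xs; exact: mule_ge0.
- exact: tmeas_cst.
- by apply: tmeas_mul; [exact: tmeas_cst|exact: tmeas_noise].
rewrite gauss_iter_cst gauss_iterZl//; last exact: tmeas_noise.
apply: (@le_trans _ _ ((s ^+ 2 * 2)%:E + (s ^+ 2 * 32)%:E * 4%:E)%E).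
  by rewrite leeD2l// lee_wpmul2l.
by rewrite -EFinM -EFinD lee_fin; lra.
Qed.

End constant_upper_bound.

(** * Comparison of iterated logarithms *)

Section numerics.
Context {R : realType}.
Implicit Types (x y : R) (n k W : nat).

Lemma expR_half_le2 : expR (1 / 2) <= 2 :> R.
Proof.
have h : 1 / 2 <= expR (- (1 / 2)) :> R.
  by apply: le_trans (expR_ge1Dx _); lra.
by rewrite expRN in h; rewrite -[leRHS]invrK -[leLHS]invrK lef_pV2 ?posrE ?invr_gt0 ?expR_gt0//; lra.
Qed.

Lemma ln2_ge : 1 / 2 <= ln 2 :> R.
Proof. by rewrite -[leLHS]expRK ler_ln ?posrE ?expR_gt0 ?expR_half_le2. Qed.

Lemma ln2_le1 : ln 2 <= 1 :> R.
Proof. by have := @le_ln1Dx R 1; apply; lra. Qed.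

Lemma ln16_ge x : 1 <= x -> 2 <= ln (16 * x).
Proof.
move=> x1; apply: (@le_trans _ _ (ln (2 ^+ 4))).
  by rewrite lnXn//; have := ln2_ge; rewrite -mulr_natl; lra.
by rewrite ler_ln ?posrE ?exprn_gt0//; lra.
Qed.

Lemma lnln16_ge x : 1 <= x -> 1 / 2 <= ln (ln (16 * x)).
Proof.
move=> x1; apply: (le_trans ln2_ge); have := ln16_ge x1 => h.
by rewrite ler_ln ?posrE//; lra.
Qed.

Lemma lnln16_le x y : 1 <= x -> x <= y -> ln (ln (16 * x)) <= ln (ln (16 * y)).
Proof.
move=> x1 xy; have h1 := ln16_ge x1; have h2 := ln16_ge (le_trans x1 xy).
rewrite ler_ln ?posrE; [|lra|lra].
by rewrite ler_ln ?posrE; lra.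
Qed.

Lemma ln_le_lnX x y (p : nat) : 0 < x -> 0 < y -> x <= y ^+ p -> ln x <= p%:R * ln y.
Proof.
by move=> x0 y0 xy; rewrite mulr_natl -lnXn// ler_ln ?posrE// exprn_gt0.
Qed.

(** At x = 2 the base is only 5/4, and 9 is the least exponent that works there. All factors but one
    are bounded below by 5/4, the remaining one keeps the growth in x. *)
Lemma pow9_ge x : 2 <= x -> 2 * (x + 1) <= (5 / 8 * x) ^+ 9.
Proof.
move=> x2; have hb : 5 / 4 <= 5 / 8 * x by lra.
rewrite exprS.
apply: (@le_trans _ _ (5 / 8 * x * (5 / 4) ^+ 8)); last first.
  rewrite ler_wpM2l//; first by lra.
  by rewrite lerXn2r ?nnegrE//; lra.
have h : 24 / 5 <= (5 / 4) ^+ 8 :> R.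
  have -> : (5 / 4) ^+ 8 = (25 / 16) ^+ 2 * (25 / 16) ^+ 2 :> R by field.
  have h2 : 2 + 2 / 5 <= (25 / 16) ^+ 2 :> R by rewrite expr2; lra.
  nra.
nra.
Qed.

Lemma pow10_ge x : 1 <= x -> 4 * x <= (5 / 8 * (x + 1)) ^+ 10.
Proof.
move=> x1; have hb : 5 / 4 <= 5 / 8 * (x + 1) by lra.
rewrite exprS.
apply: (@le_trans _ _ (5 / 8 * (x + 1) * (5 / 4) ^+ 9)); last first.
  rewrite ler_wpM2l//; first by lra.
  by rewrite lerXn2r ?nnegrE//; lra.
have h : 32 / 5 <= (5 / 4) ^+ 9 :> R.
  have -> : (5 / 4) ^+ 9 = ((25 / 16) ^+ 2 * (25 / 16) ^+ 2) * (5 / 4) :> R by field.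
  have h2 : 2 + 11 / 25 <= (25 / 16) ^+ 2 :> R by rewrite expr2; lra.
  nra.
nra.
Qed.

Lemma lnln_le_trunc_log x W : 1 <= x -> (0 < W)%N -> x <= W%:R ->
  ln (ln (16 * x)) <= 9 * ln (5 / 8 * (trunc_log 4 W).+2%:R).
Proof.
move=> x1 W0 xW; set M := (trunc_log 4 W).+2.
have M2 : 2 <= M%:R :> R by rewrite ler_nat.
have h16 := ln16_ge x1.
have hln : ln (16 * x) <= 2 * (M%:R + 1).
  have : ln (16 * x) <= M.+1%:R * ln 4.
    apply: ln_le_lnX; [lra|lra|].
    have : (W < 4 ^ (trunc_log 4 W).+1)%N by exact: trunc_log_ltn.
    rewrite -(ltr_nat R) natrX => hW.
    by rewrite /M !exprS in hW *; lra.
  have l4 : ln 4 <= 2 :> R.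
    have -> : 4 = 2 ^+ 2 :> R by ring.
    by rewrite lnXn// mulr2n; have := ln2_le1; lra.
  have -> : M.+1%:R = M%:R + 1 :> R by rewrite natr1.
  have : (M%:R + 1) * ln 4 <= (M%:R + 1) * 2 :> R by rewrite ler_wpM2l//; lra.
  lra.
apply: ln_le_lnX; [lra|by rewrite mulr_gt0//; lra|].
exact: le_trans hln (pow9_ge M2).
Qed.

Lemma ln_en_le n : (0 < n)%N -> ln (expR 1 * n%:R) <= 10 * ln (5 / 8 * n.+1%:R) :> R.
Proof.
move=> n0; have n1 : 1 <= n%:R :> R by rewrite ler1n.
have e4 : expR 1 <= 4 :> R.
  have -> : 1 = 1 / 2 + 1 / 2 :> R by field.
  rewrite expRD; have := expR_half_le2; have := expR_ge0 (1 / 2 : R); nra.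
have -> : n.+1%:R = n%:R + 1 :> R by rewrite natr1.
apply: ln_le_lnX; [by rewrite mulr_gt0 ?expR_gt0//; lra|lra|].
apply: (@le_trans _ _ (4 * n%:R)); first by rewrite ler_wpM2r.
exact: pow10_ge.
Qed.

Lemma ln_trunc_log_le n k : (0 < k <= n)%N ->
  ln ((trunc_log 4 (n %/ k).+1).+2)%:R <= 2 * ln (ln (16 * n%:R / k%:R)) :> R.
Proof.
move=> /andP[k0 kn]; set f := (trunc_log 4 _).+2.
have k0' : (0 : R) < k%:R by rewrite ltr0n.
set x : R := n%:R / k%:R.
have x1 : 1 <= x by rewrite ler_pdivlMr// mul1r ler_nat.
have -> : 16 * n%:R / k%:R = 16 * x by rewrite mulrA.
have h16 := ln16_ge x1; set y := ln (16 * x) in h16 *.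
have q1 : (0 < n %/ k)%N by rewrite divn_gt0.
have qx : (n %/ k)%:R <= x.
  by rewrite ler_pdivlMr// -natrM ler_nat leq_trunc_div.
have h4 : 4 ^+ f <= 32 * x.
  have : (4 ^ trunc_log 4 (n %/ k).+1 <= (n %/ k).+1)%N by exact: trunc_logP.
  rewrite -(ler_nat R) natrX -natr1 /f !exprS => h.
  have : 1 <= (n %/ k)%:R :> R by rewrite ler1n.
  lra.
have hf : f%:R <= 2 * y.
  have l4 : 1 <= ln 4 :> R.
    have -> : 4 = 2 ^+ 2 :> R by ring.
    by rewrite lnXn// mulr2n; have := ln2_ge; lra.
  have : f%:R * ln 4 <= ln (32 * x).
    by rewrite mulr_natl -lnXn// ler_ln ?posrE ?exprn_gt0//; lra.
  have -> : 32 * x = 2 * (16 * x) by ring.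
  rewrite lnM ?posrE; [|lra|lra].
  have := ln2_le1; rewrite -/y.
  have : f%:R <= f%:R * ln 4 :> R by rewrite ler_peMr.
  lra.
(* As y >= 2, f <= 2 y <= y^2, and the outer logarithm turns the square into the factor 2. *)
apply: ln_le_lnX; [by rewrite ltr0n|lra|].
by apply: (le_trans hf); rewrite expr2 ler_wpM2r//; lra.
Qed.

(** In the last regime this absorbs the cost of the unknown mode. If k^2 <= n, then 16 n <= (16
    n/k)^2 and the iterated logarithms of both are comparable. If n < k^2, then ln(en) <= 1 + 2 ln k
    is already at most linear in k. *)
Lemma ln_en_le_lnln n k : (0 < k <= n)%N ->
  ln (expR 1 * n%:R) < k%:R * ln (ln (16 * n%:R)) :> R ->
  ln (expR 1 * n%:R) <= 4 * (k%:R * ln (ln (16 * n%:R / k%:R))) :> R.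
Proof.
move=> /andP[k0 kn] hlt.
have k0' : (1 : R) <= k%:R by rewrite ler1n.
have n0' : (1 : R) <= n%:R by rewrite ler1n (leq_trans k0).
set x : R := n%:R / k%:R.
have x1 : 1 <= x by rewrite ler_pdivlMr ?mul1r ?ler_nat//; lra.
have -> : 16 * n%:R / k%:R = 16 * x by rewrite mulrA.
have L0 := lnln16_ge x1; have h16 := ln16_ge x1; have h16n := ln16_ge n0'.
have [k2|k2] := leP (k%:R ^+ 2) (n%:R : R).
  have h : ln (ln (16 * n%:R)) <= 2 * ln (ln (16 * x)).
    apply: ln_le_lnX; [lra|lra|].
    apply: (@le_trans _ _ (2 * ln (16 * x))); last first.
      by rewrite expr2 ler_wpM2r//; lra.
    apply: ln_le_lnX; [lra|lra|].
    have -> : (16 * x) ^+ 2 = 16 * n%:R * (16 * n%:R / k%:R ^+ 2).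
      by rewrite /x; field; rewrite gt_eqF//; lra.
    have q1 : 1 <= 16 * n%:R / k%:R ^+ 2 :> R.
      by rewrite ler_pdivlMr ?exprn_gt0//; lra.
    by rewrite ler_peMr// mulr_ge0.
  apply: (le_trans (ltW hlt)).
  have -> : 4 * (k%:R * ln (ln (16 * x))) = k%:R * (4 * ln (ln (16 * x))) by ring.
  by rewrite ler_wpM2l//; lra.
have h1 : ln (expR 1 * n%:R) <= 1 + 2 * ln k%:R :> R.
  rewrite lnM ?posrE ?expR_gt0//; last by lra.
  rewrite expRK lerD2l; apply: ln_le_lnX; [lra|lra|exact: ltW].
have h2 : ln k%:R <= k%:R - 1 :> R.
  have := @le_ln1Dx R (k%:R - 1); rewrite addrCA subrr addr0; apply; lra.
have : k%:R * (1 / 2) <= k%:R * ln (ln (16 * x)) by rewrite ler_wpM2l//; lra.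
lra.
Qed.

End numerics.

(** * The four regimes of the rate *)

Lemma wedge_rate_lower (R : realType) (n k : nat) (sigma : R) :
  0 < sigma -> (1 <= k <= n)%N ->
  ((ln (5 / 4) / (32 * 64) * sigma ^+ 2 * wedge_rate n k)%:E
     <= minimax_risk sigma (@Theta_wedge R n k))%E.
Proof.
move=> s0 /andP[k1 kn]; set q : R := ln (5 / 4).
have q0 : 0 < q by apply: ln_gt0; lra.
have q1 : q <= 1 / 4.
  by rewrite /q (_ : 5 / 4 = 1 + 1 / 4); [apply: le_ln1Dx; lra|field].
have n0 : (0 < n)%N by exact: leq_trans k1 kn.
have n1 : (1 : R) <= n%:R by rewrite ler1n.
have k1' : (1 : R) <= k%:R by rewrite ler1n.
have s20 : 0 <= sigma ^+ 2 by exact: sqr_ge0.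
(* The worst loss below is 27 = 9 * 3: the 9 comes from [lnln_le_trunc_log], the 3 from k <= 3 m
   with m = [k./2]. *)
have scale (r b : R) : 0 <= r -> r <= 27 * b ->
    q / (32 * 64) * sigma ^+ 2 * r <= sigma ^+ 2 * b / 2 / 32.
  move=> r0 rb.
  have -> : q / (32 * 64) * sigma ^+ 2 * r = sigma ^+ 2 * (q * r / 32) / 2 / 32 by field.
  do 2 (rewrite ler_pM2r ?invr_gt0//); rewrite ler_wpM2l//.
  have h1 : q * r <= 1 / 4 * r by rewrite ler_wpM2r.
  lra.
rewrite /wedge_rate; case: (eqVneq k 1%N) => [kE|k_neq1].
  rewrite kE mulr1; apply: le_trans (minimax_risk_ge_constant _ s0); last first.
    by rewrite n0.
  rewrite lee_fin -/q mulrC mulrA -mulrA mulrC.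
  have := mulr_ge0 s20 (ltW q0); lra.
have stair m : (0 < m)%N -> (m.*2 <= k)%N ->
    (((sigma ^+ 2 * (ln (5 / 8 * (trunc_log 4 (n %/ m)).+2%:R) * m%:R) / 2 / 32)%:E : \bar R)
    <= minimax_risk sigma (@Theta_wedge R n k))%E.
  move=> m0 mk; have W0 : (0 < n %/ m)%N by rewrite divn_gt0//; move: mk kn; clear; lia.
  have mW : (m * (n %/ m) <= n)%N by rewrite mulnC leq_trunc_div.
  apply: le_trans (minimax_risk_ge_staircase W0 m0 mW mk s0).
  by rewrite lee_fin le_eqVlt; apply/orP; left; apply/eqP; field.
case: (eqVneq k 2%N) => [kE|k_neq2].
  apply: le_trans (stair 1%N isT _); last by rewrite kE.
  rewrite lee_fin; apply: scale.
    by apply: le_trans (lnln16_ge n1); lra.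
  rewrite divn1 mulr1; have h := lnln_le_trunc_log n1 n0 (lexx _).
  by have := lnln16_ge n1; lra.
have k3 : (3 <= k)%N by move: k1 k_neq1 k_neq2; clear; lia.
have L0 := lnln16_ge n1.
case: ifPn => hk.
  apply: (le_trans _ (minimax_risk_ge_spike _ s0)); last by rewrite k3.
  rewrite lee_fin.
  apply: (@le_trans _ _ (sigma ^+ 2 * (2 * ln (5 / 8 * n.+1%:R)) / 2 / 32)); last first.
    by rewrite le_eqVlt; apply/orP; left; apply/eqP; field.
  have h := @ln_en_le R n n0.
  have h0 : 0 <= ln (expR 1 * n%:R) :> R.
    apply: ln_ge0; have := expR_ge1Dx (1 : R) => h2.
    by rewrite -[leLHS]mulr1 ler_pM//; lra.
  apply: scale => //; lra.
pose m := k./2.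
have m0 : (0 < m)%N by rewrite /m; move: k3; clear; lia.
have mk : (m.*2 <= k)%N by rewrite /m; clear; lia.
have km : (k <= 3 * m)%N by rewrite /m; move: k3; clear; lia.
apply: le_trans (stair m m0 mk); rewrite lee_fin.
set x : R := n%:R / k%:R.
have k0' : (0 : R) < k%:R by lra.
have x1 : 1 <= x by rewrite ler_pdivlMr// mul1r ler_nat.
have -> : 16 * n%:R / k%:R = 16 * x by rewrite mulrA.
have W0 : (0 < n %/ m)%N by rewrite divn_gt0//; move: mk kn; clear; lia.
have xW : x <= (n %/ m)%:R.
  rewrite ler_pdivrMr// -natrM ler_nat.
  have h1 := ltn_ceil n m0.
  have h2 : (n %/ m * m.*2 <= n %/ m * k)%N by rewrite leq_mul2l mk orbT.
  have h3 : (m <= n %/ m * m)%N by rewrite leq_pmull.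
  rewrite mulSn in h1; rewrite -addnn mulnDr in h2.
  by move: h1 h2 h3; clear; lia.
have h := lnln_le_trunc_log x1 W0 xW; have Lx := lnln16_ge x1.
set l := ln (5 / 8 * _) in h *.
apply: scale; first by rewrite mulr_ge0; lra.
have l0 : 0 <= l by lra.
have km' : k%:R <= 3 * m%:R :> R by rewrite -natrM ler_nat.
apply: (@le_trans _ _ (k%:R * (9 * l))); first by rewrite ler_wpM2l//; lra.
have : k%:R * (9 * l) <= 3 * m%:R * (9 * l) by rewrite ler_wpM2r//; lra.
have -> : 3 * m%:R * (9 * l) = 27 * (l * m%:R) by ring.
by [].
Qed.

Lemma wedge_rate_upper (R : realType) (n k : nat) (sigma : R) :
  0 < sigma -> (1 <= k <= n)%N ->
  (minimax_risk sigma (@Theta_wedge R n k) <=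
   (64 * 60 * 64 * sigma ^+ 2 * wedge_rate n k)%:E)%E.
Proof.
move=> s0 /andP[k1 kn].
have n0 : (0 < n)%N by exact: leq_trans k1 kn.
have n1 : (1 : R) <= n%:R by rewrite ler1n.
have k1' : (1 : R) <= k%:R by rewrite ler1n.
have s20 : 0 <= sigma ^+ 2 by exact: sqr_ge0.
have rearr r : 64 * 60 * 64 * sigma ^+ 2 * r = sigma ^+ 2 * (64 * 60 * 64 * r).
  by ring.
rewrite /wedge_rate; case: (eqVneq k 1%N) => [kE|k_neq1].
  rewrite kE; apply: (le_trans (minimax_risk_le_constant s0 n0)).
  by rewrite lee_fin mulr1 mulrC ler_wpM2r//; lra.
have kn' : (0 < k <= n)%N by rewrite k1.
have hf := @ln_trunc_log_le R n k kn'.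
set x : R := n%:R / k%:R.
have k0' : (0 : R) < k%:R by lra.
have x1 : 1 <= x by rewrite ler_pdivlMr// mul1r ler_nat.
have xE : 16 * n%:R / k%:R = 16 * x by rewrite mulrA.
rewrite xE in hf *.
have Lx := lnln16_ge x1; have Ln := lnln16_ge n1.
have xn : x <= n%:R by rewrite ler_pdivrMr// ler_peMr//; lra.
have Lxn := lnln16_le x1 xn.
set L := ln (ln (16 * x)) in hf Lx Lxn *.
have hkf := ler_wpM2l (ltW k0') hf.
set lf := ln (trunc_log _ _).+2%:R in hkf.
have kL : k%:R * (1 / 2) <= k%:R * L by rewrite ler_wpM2l//; lra.
have e2 : 2 <= expR 1 :> R by apply: le_trans (expR_ge1Dx _); lra.
have en : 1 <= ln (expR 1 * n%:R) :> R.
  rewrite lnM ?posrE ?expR_gt0//; last by lra.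
  by rewrite expRK lerDl ln_ge0.
case: (eqVneq k 2%N) => [kE|k_neq2].
  (* A single candidate, the trivial cut at 0, makes the union cost ln 1 = 0. *)
  have modes (th : n.-tuple R) : unimodal_k k th -> exists2 m, m \in [:: 0%N] &
     monotone (take m th) /\ monotone (drop m th).
    move=> /unimodal_mode[m [_ _ _ hm]]; exists 0%N; first by rewrite inE.
    by rewrite take0 drop0; split=> //; apply: hm; rewrite kE.
  have sz0 : (0 < size [:: 0%N])%N by [].
  have upper := minimax_risk_le s0 kn' sz0 modes.
  apply: (le_trans upper).
  rewrite lee_fin -[size _]/1%N ln1 add0r -/lf.
  rewrite rearr ler_wpM2l//.
  have k2 : k%:R = 2 :> R by rewrite kE.
  by rewrite k2 in hkf kL *; lra.
have modes (th : n.-tuple R) : unimodal_k k th -> exists2 m, m \in iota 0 n.+1 &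
   monotone (take m th) /\ monotone (drop m th).
  move=> /unimodal_mode[m [mn h1 h2 _]]; exists m; first by rewrite mem_iota.
  by rewrite /monotone h1 h2 orbT.
have sz0 : (0 < size (iota 0 n.+1))%N by rewrite size_iota.
have upper := minimax_risk_le s0 kn' sz0 modes.
rewrite size_iota -/lf in upper.
have lnn : ln n.+1%:R <= ln (expR 1 * n%:R) :> R.
  rewrite ler_ln ?posrE ?mulr_gt0 ?expR_gt0 ?ltr0n//.
  have -> : n.+1%:R = n%:R + 1 :> R by rewrite natr1.
  by apply: (@le_trans _ _ (2 * n%:R)); [lra|rewrite ler_wpM2r].
case: ifPn => hk; apply: (le_trans upper); rewrite lee_fin;
  rewrite rearr ler_wpM2l//.
  rewrite ler_pdivlMr in hk; last by lra.
  have h : k%:R * L <= ln (expR 1 * n%:R).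
    by apply: le_trans hk; rewrite ler_wpM2l// ltW.
  lra.
have hlt : ln (expR 1 * n%:R) < k%:R * ln (ln (16 * n%:R)) :> R.
  by rewrite -ltNge ltr_pdivrMr in hk; [|lra].
have := ln_en_le_lnln kn' hlt; rewrite xE -/L => h.
lra.
Qed.

Theorem mainTheorem9 (R : realType) :
  exists c C : R, 0 < c /\ 0 < C /\
    forall (n k : nat) (sigma : R), 0 < sigma -> (1 <= k <= n)%N ->
      ((c * sigma ^+ 2 * wedge_rate n k)%:E
         <= minimax_risk sigma (@Theta_wedge R n k))%E /\
      (minimax_risk sigma (@Theta_wedge R n k)
         <= (C * sigma ^+ 2 * wedge_rate n k)%:E)%E.
Proof.
exists (ln (5 / 4) / (32 * 64)), (64 * 60 * 64).
split; first by rewrite divr_gt0// ?ln_gt0//; lra.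
split; first by lra.
move=> n k sigma s0 kn; split; first exact: wedge_rate_lower.
exact: wedge_rate_upper.
Qed.
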